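(* Let $\Lambda$ be a lattice in $\mathbb{R}^d$ with dual lattice $\Lambda^*$, let $U$ be an open convex neighborhood of the origin in $\mathbb{R}^d$ such that $U\cap\Lambda^*=\{0\}$, let $\Omega\subseteq\mathbb{R}^d$ be open, and let $f\in\mathcal{D}'(\Omega)$ be a distribution. Then the analytic wave front set $WF_A(f)$ coincides with the complement in $\Omega\times(\mathbb{R}^d\setminus\{0\})$ of the set of points $(x_0,\xi_0)$ for which there are an open neighborhood $V\subseteq\Omega\cap(x_0+U)$ of $x_0$, an open conic neighborhood $\Gamma$ of $\xi_0$, and a bounded sequence $(f_p)_{p\in\mathbb{N}}$ in $\mathcal{E}'(\Omega\cap(x_0+U))$, with $f_p=f$ on $V$ for all $p\in\mathbb{N}$, such that for some $h>0$ $$\sup_{\mu\in\Gamma\cap\Lambda}|\widehat{f_p}(\mu)||\mu|^p\le h^{p+1}p!\,,\qquad\forall p\in\mathbb{N}.$$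
   Context: A lattice $\Lambda$ in $\mathbb{R}^d$ is a discrete subgroup spanning the real vector space $\mathbb{R}^d$; its dual lattice is $\Lambda^*=\{\mu^*\in\mathbb{R}^d:\ \mu\cdot\mu^*\in\mathbb{Z}\ \forall\mu\in\Lambda\}$. An open conic neighborhood of $\xi_0\neq0$ is an open subset of $\mathbb{R}^d\setminus\{0\}$ containing $\xi_0$ and invariant under multiplication by positive scalars. Fourier transform: $\widehat\varphi(\xi)=\int\varphi(x)e^{-2\pi i\xi\cdot x}\,dx$, and $\widehat g(\xi)=\langle g(x),e^{-2\pi i\xi\cdot x}\rangle$ for $g\in\mathcal{E}'$. $\mathcal{E}'(W)$ denotes the space of compactly supported distributions on the open set $W$ (dual of $C^\infty(W)$). Analytic wave front set (Hörmander): $WF_A(f)$ is the complement in $\Omega\times(\mathbb{R}^d\setminus\{0\})$ of the set of points $(x_0,\xi_0)$ for which there are an open conic neighborhood $\Gamma$ of $\xi_0$, an open neighborhood $V\subseteq\Omega$ of $x_0$ and a bounded sequence $(f_p)_{p\in\mathbb{N}}$ in $\mathcal{E}'(\Omega)$, with $f_p=f$ on $V$ for all $p$, such that for some $A,C>0$ $$\sup_{\xi\in\Gamma}|\widehat{f_p}(\xi)||\xi|^p<AC^pp!\,,\qquad\forall p\in\mathbb{N}.$$ *)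

(* Defs.v *)
From HB Require Import structures.
From mathcomp Require Import all_boot all_order all_algebra.
From mathcomp Require Import complex.
From mathcomp Require Import all_classical all_reals all_analysis.

Set Implicit Arguments.
Unset Strict Implicit.
Unset Printing Implicit Defensive.

Import Order.TTheory GRing.Theory Num.Theory.
Import numFieldNormedType.Exports.

Local Open Scope classical_set_scope.
Local Open Scope ring_scope.
Local Open Scope complex_scope.

Section Euclidean.
Context {R : realType} {d : nat}.
Implicit Types (x y xi : 'rV[R]_d) (L G : set 'rV[R]_d).

Definition dotv x y : R := \sum_(i < d) x 0 i * y 0 i.

(* The Euclidean norm; the library norm `|x| on 'rV[R]_d is the max norm. *)
Definition enorm x : R := Num.sqrt (dotv x x).

Definition is_lattice L : Prop :=
  [/\ L 0,
      (forall x y, L x -> L y -> L (x - y)),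
      L `<=` isolated L &
      forall x, exists (n : nat) (c : 'I_n -> R) (v : 'I_n -> 'rV[R]_d),
        (forall i, L (v i)) /\ x = \sum_(i < n) c i *: v i].

Definition dual_lattice L : set 'rV[R]_d :=
  [set y | forall x, L x -> dotv x y \is a Num.int].

Definition open_conic_nbhd xi G : Prop :=
  [/\ open G, G xi, ~ G 0 & forall (t : R) y, 0 < t -> G y -> G (t *: y)].

End Euclidean.

Section Distributions.
Context {R : realType} {d : nat}.
Implicit Types (phi psi : 'rV[R]_d -> R[i]) (s : seq 'I_d).
Implicit Types (K V W Omega : set 'rV[R]_d).

Local Notation reC := (@complex.Re R).
Local Notation imC := (@complex.Im R).

Definition cmod (z : R[i]) : R := complex.Re `|z|.

Definition partial (j : 'I_d) phi : 'rV[R]_d -> R[i] := fun x =>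
  derive (reC \o phi) x (delta_mx 0 j)
  +i* derive (imC \o phi) x (delta_mx 0 j).

(* [:: j_1; ...; j_k] encodes the derivative d_{j_1} ... d_{j_k} of order k;
   on smooth functions this only depends on the associated multi-index. *)
Definition partials s phi : 'rV[R]_d -> R[i] := foldr partial phi s.

(* C^oo(W), for W open. Elements are represented by total functions, whose
   values outside W are irrelevant. *)
Definition smooth W : set ('rV[R]_d -> R[i]) := [set phi |
  forall s x, W x ->
    [/\ {for x, continuous (reC \o partials s phi)},
        {for x, continuous (imC \o partials s phi)} &
        forall j : 'I_d,
          derivable (reC \o partials s phi) x (delta_mx 0 j) /\
          derivable (imC \o partials s phi) x (delta_mx 0 j)]].

Definition supp phi : set 'rV[R]_d := closure [set x | phi x != 0].

(* D(W) = C_c^oo(W), each element being extended by 0 to R^d. *)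
Definition test_function W : set ('rV[R]_d -> R[i]) := [set phi |
  [/\ smooth setT phi, compact (supp phi) & supp phi `<=` W]].

(* max_{|alpha| <= N} sup_K |d^alpha phi|. For phi smooth near the compact K
   this sup is over a bounded set; it is 0 if K is empty. *)
Definition seminorm K (N : nat) phi : R :=
  sup [set r | exists s x,
    [/\ (size s <= N)%N, K x & r = cmod (partials s phi x)]].

Definition linear_on (E : set ('rV[R]_d -> R[i]))
    (u : ('rV[R]_d -> R[i]) -> R[i]) : Prop :=
  forall (a : R[i]) phi psi, E phi -> E psi ->
    u (fun x => a * phi x + psi x) = a * u phi + u psi.

(* Distributions are functionals on all functions, of which only the values on
   test functions (for D') or on C^oo(W) (for E') are meaningful. *)

Definition distributions Omega : set (('rV[R]_d -> R[i]) -> R[i]) := [set u |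
  linear_on (test_function Omega) u /\
  forall K, compact K -> K `<=` Omega ->
    exists (c : R) (N : nat), forall phi,
      test_function Omega phi -> supp phi `<=` K ->
      cmod (u phi) <= c * seminorm K N phi].

(* E'(W), the continuous dual of the Frechet space C^oo(W). As the seminorms
   form a directed family, continuity is domination by one of them. *)
Definition compact_distributions W : set (('rV[R]_d -> R[i]) -> R[i]) :=
  [set u |
  linear_on (smooth W) u /\
  exists K (c : R) (N : nat), [/\ compact K, K `<=` W &
    forall phi, smooth W phi -> cmod (u phi) <= c * seminorm K N phi]].

Definition bounded_in_smooth W (B : set ('rV[R]_d -> R[i])) : Prop :=
  B `<=` smooth W /\
  forall K (N : nat), compact K -> K `<=` W ->
    exists M : R, forall phi, B phi -> seminorm K N phi <= M.

(* Bounded sequences of E'(W), for the strong dual topology. *)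
Definition bounded_sequence W (F : nat -> ('rV[R]_d -> R[i]) -> R[i]) : Prop :=
  (forall p, compact_distributions W (F p)) /\
  forall B, bounded_in_smooth W B ->
    exists M : R, forall p phi, B phi -> cmod (F p phi) <= M.

Definition eq_on V (u v : ('rV[R]_d -> R[i]) -> R[i]) : Prop :=
  forall phi, test_function V phi -> u phi = v phi.

(* x |-> exp (- 2 pi i xi.x) *)
Definition wave (xi : 'rV[R]_d) : 'rV[R]_d -> R[i] := fun x =>
  cos (2 * pi * dotv xi x) -i* sin (2 * pi * dotv xi x).

Definition fourier (u : ('rV[R]_d -> R[i]) -> R[i]) (xi : 'rV[R]_d) : R[i] :=
  u (wave xi).

Definition analytic_regular Omega f (x0 xi0 : 'rV[R]_d) : Prop :=
  exists (G V : set 'rV[R]_d) (F : nat -> ('rV[R]_d -> R[i]) -> R[i]),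
    [/\ open_conic_nbhd xi0 G,
        open_nbhs x0 V /\ V `<=` Omega,
        bounded_sequence Omega F,
        (forall p, eq_on V (F p) f) &
        exists A C : R, [/\ 0 < A, 0 < C & forall p : nat,
          (ereal_sup [set (cmod (fourier (F p) xi) * enorm xi ^+ p)%:E
                     | xi in G] < (A * C ^+ p * p`!%:R)%:E)%E]].

Definition WF_A Omega f : set ('rV[R]_d * 'rV[R]_d) :=
  (Omega `*` ~` [set 0]) `\` [set z | analytic_regular Omega f z.1 z.2].

Definition lattice_regular (L U : set 'rV[R]_d) Omega f
    (x0 xi0 : 'rV[R]_d) : Prop :=
  let W := Omega `&` [set x0 + u | u in U] in
  exists (V G : set 'rV[R]_d) (F : nat -> ('rV[R]_d -> R[i]) -> R[i]),
    [/\ open_nbhs x0 V /\ V `<=` W,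
        open_conic_nbhd xi0 G,
        bounded_sequence W F,
        (forall p, eq_on V (F p) f) &
        exists h : R, 0 < h /\ forall p : nat,
          (ereal_sup [set (cmod (fourier (F p) mu) * enorm mu ^+ p)%:E
                     | mu in G `&` L] <= (h ^+ p.+1 * p`!%:R)%:E)%E].

End Distributions.

(* Main.v *)
(* Both inclusions follow from one localisation argument. Let [M] be a lattice
   whose dual, translated at [x0], meets the common compact support [K] of the
   [f_p] at most in [x0], and suppose that the Fourier transforms of the [f_p]
   are controlled on the points of [M] in a cone. Multiply [f_p] by an
   Ehrenpreis cutoff [chi_p] supported near [x0]. Near [K] the function
   [chi_p exp (- 2 pi i xi . x)] agrees with its periodization along the dual of
   [M], which is a limit, with all derivatives, of trigonometric polynomials with
   frequencies in [M]. The frequencies close to [xi] are controlled by hypothesis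
   and the others by the decay of the coefficients, so the Fourier transform of
   [chi_p f_p] is controlled on all of a smaller cone. For the lattice of the
   theorem this gives analytic regularity, with [M] the given lattice; the
   converse uses a fine multiple of [Z^d].

   The trigonometric polynomials are obtained without integration, by
   interpolation on a grid: their coefficients are estimated by summation by
   parts, and Rolle's theorem gives the convergence of the derivatives. *)
Require Import Defs.
From HB Require Import structures.
From mathcomp Require Import all_boot all_order all_algebra.
From mathcomp Require Import complex.
From mathcomp Require Import all_classical all_reals all_analysis.
From mathcomp Require Import ring lra zify.

Import Order.TTheory GRing.Theory Num.Theory.
Import numFieldNormedType.Exports.

Local Open Scope classical_set_scope.
Local Open Scope ring_scope.

Set Implicit Arguments.
Unset Strict Implicit.
Unset Printing Implicit Defensive.

(** The obstacle is that nothing is known at the frequencies between the lattice points, so [xi] has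
    to be reached by a sum over the lattice whose constants do not depend on [xi]. Since the
    sequence is bounded, all [f_p] share one compact set, one order [N] and one constant, so their
    Fourier transforms grow at most like [|mu| ^ N]. If [mu] leaves the cone, some coordinate of
    [mu - xi] in the lattice basis has a size [r] at least comparable to [|xi|], and [r ^ (p + N)]
    absorbs both [|xi| ^ p] and that growth; two more derivatives make the sum over the lattice
    converge. The cutoff thus needs [p + N + 2] derivatives with a bound of type [C ^ p p!]. No
    fixed non-zero function of compact support has such derivatives for all [p], which is why the
    cutoff depends on [p]. The grid is a mere device: the estimates are uniform in its number of
    nodes, and the approximation error tends to 0 for each fixed [xi], at a rate that does not
    matter. *)

Section ComplexModulus.
Context {R : realType}.
Implicit Types z w : complex R.

Lemma cmodE z : cmod z = Num.sqrt (complex.Re z ^+ 2 + complex.Im z ^+ 2).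
Proof. by rewrite /cmod normc_def. Qed.

Lemma cmodC z : ((cmod z)%:C)%C = `|z|.
Proof. by rewrite cmodE normc_def. Qed.

Lemma cmod_ge0 z : 0 <= cmod z.
Proof. by rewrite cmodE sqrtr_ge0. Qed.

Lemma cmodM z w : cmod (z * w) = cmod z * cmod w.
Proof. by apply: complexI; rewrite rmorphM /= !cmodC normrM. Qed.

Lemma cmodD z w : cmod (z + w) <= cmod z + cmod w.
Proof. by rewrite -lecR rmorphD /= !cmodC ler_normD. Qed.

Lemma cmod0 : cmod (0 : complex R) = 0.
Proof. by apply: complexI; rewrite cmodC normr0. Qed.

Lemma cmod1 : cmod (1 : complex R) = 1.
Proof. by apply: complexI; rewrite cmodC normr1. Qed.

Lemma cmodN z : cmod (- z) = cmod z.
Proof. by apply: complexI; rewrite !cmodC normrN. Qed.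

Lemma cmodB z w : cmod (z - w) <= cmod z + cmod w.
Proof. by rewrite -(cmodN w) cmodD. Qed.

Lemma cmodX z n : cmod (z ^+ n) = cmod z ^+ n.
Proof. by elim: n => [|n IH]; rewrite ?expr0 ?cmod1// !exprS cmodM IH. Qed.

Lemma cmod_prod (I : Type) (r : seq I) (P : pred I) (f : I -> complex R) :
  cmod (\prod_(i <- r | P i) f i) = \prod_(i <- r | P i) cmod (f i).
Proof. exact: (big_morph _ cmodM cmod1). Qed.

Lemma cmod_sum (I : Type) (r : seq I) (P : pred I) (f : I -> complex R) :
  cmod (\sum_(i <- r | P i) f i) <= \sum_(i <- r | P i) cmod (f i).
Proof.
elim/big_rec2: _ => [|i y z _ h]; first by rewrite cmod0.
by apply: le_trans (cmodD _ _) _; rewrite lerD2l.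
Qed.

Lemma cmod_real (x : R) : cmod (x%:C)%C = `|x|.
Proof. by rewrite cmodE /= expr0n addr0 sqrtr_sqr. Qed.

Lemma Re_le_cmod z : `|complex.Re z| <= cmod z.
Proof. by rewrite -lecR cmodC normc_ge_Re. Qed.

Lemma Im_le_cmod z : `|complex.Im z| <= cmod z.
Proof. by rewrite cmodE -sqrtr_sqr ler_wsqrtr// lerDr sqr_ge0. Qed.

Lemma cmod_le_ReIm z : cmod z <= `|complex.Re z| + `|complex.Im z|.
Proof.
have -> : z = ((complex.Re z)%:C)%C + (0 +i* complex.Im z)%C.
  by case: z => a b; apply/eqP; rewrite eq_complex /= addr0 add0r !eqxx.
apply: le_trans (cmodD _ _) _; rewrite cmod_real /= !(add0r, addr0) lerD2l.
by rewrite cmodE /= expr0n add0r sqrtr_sqr.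
Qed.

End ComplexModulus.

(** * Calculus of complex-valued functions of a real variable *)

Section ComplexDerivative.
Context {R : realType} {V : normedModType R}.
Implicit Types (f g : V -> complex R) (x v : V) (l m : complex R).

(** The variable is real, so differentiability is that of the real and imaginary parts, the form
    used by [partial] and [smooth]. *)
Definition cder x v f l : Prop :=
  is_derive x v (@complex.Re R \o f) (complex.Re l) /\
  is_derive x v (@complex.Im R \o f) (complex.Im l).

Definition ccont f x : Prop :=
  {for x, continuous (@complex.Re R \o f)} /\
  {for x, continuous (@complex.Im R \o f)}.

Lemma cder_cst x v l : cder x v (fun=> l) 0.
Proof. by split; apply: is_derive_cst. Qed.

Lemma cderD x v f g l m : cder x v f l -> cder x v g m ->
  cder x v (fun y => f y + g y) (l + m).
Proof.
move=> [f1 f2] [g1 g2]; split.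
  rewrite [X in is_derive _ _ X _](_ : _ =
    (@complex.Re R \o f) + (@complex.Re R \o g)); last first.
    by apply/funext => y /=; rewrite raddfD.
  by rewrite raddfD /=; apply: is_deriveD.
rewrite [X in is_derive _ _ X _](_ : _ =
  (@complex.Im R \o f) + (@complex.Im R \o g)); last first.
  by apply/funext => y /=; rewrite raddfD.
by rewrite raddfD /=; apply: is_deriveD.
Qed.

Lemma cderM x v f g l m : cder x v f l -> cder x v g m ->
  cder x v (fun y => f y * g y) (l * g x + f x * m).
Proof.
move=> [f1 f2] [g1 g2]; split.
  rewrite [X in is_derive _ _ X _](_ : _ =
    (@complex.Re R \o f) * (@complex.Re R \o g) -
    (@complex.Im R \o f) * (@complex.Im R \o g)); last first.
    by apply/funext => y /=; rewrite !fctE /=; case: (f y) => ? ?; case: (g y).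
  apply: (is_derive_eq (is_deriveB (is_deriveM f1 g1) (is_deriveM f2 g2))).
  rewrite /GRing.scale /=; case: l f1 f2 => a b f1 f2; case: m g1 g2 => c d g1 g2.
  by case: (f x) => ? ?; case: (g x) => ? ? /=; ring.
rewrite [X in is_derive _ _ X _](_ : _ =
  (@complex.Re R \o f) * (@complex.Im R \o g) +
  (@complex.Im R \o f) * (@complex.Re R \o g)); last first.
  by apply/funext => y /=; rewrite !fctE /=; case: (f y) => ? ?; case: (g y).
apply: is_derive_eq.
rewrite /GRing.scale /=; case: l f1 f2 => a b f1 f2; case: m g1 g2 => c d g1 g2.
by case: (f x) => ? ?; case: (g x) => ? ? /=; ring.
Qed.

Lemma cder_sum x v (I : Type) (r : seq I) (f : I -> V -> complex R)
    (l : I -> complex R) : (forall i, cder x v (f i) (l i)) ->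
  cder x v (fun y => \sum_(i <- r) f i y) (\sum_(i <- r) l i).
Proof.
move=> h; elim: r => [|i r IH].
  by rewrite big_nil; under eq_fun do rewrite big_nil; exact: cder_cst.
by rewrite big_cons; under eq_fun do rewrite big_cons; exact: cderD.
Qed.

Lemma cder_near x v f g l : (\near x, f x = g x) -> cder x v f l -> cder x v g l.
Proof.
move=> fg [f1 f2]; split; [apply: near_eq_is_derive f1|apply: near_eq_is_derive f2];
by near=> y; rewrite /= (near fg y).
Unshelve. all: by end_near. Qed.

Lemma ccontD x f g : ccont f x -> ccont g x -> ccont (fun y => f y + g y) x.
Proof.
move=> [f1 f2] [g1 g2]; split.
  rewrite (_ : (_ \o _) = (@complex.Re R \o f) + (@complex.Re R \o g)).
    exact: continuousD.
  by apply/funext => y /=; rewrite raddfD.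
rewrite (_ : (_ \o _) = (@complex.Im R \o f) + (@complex.Im R \o g)).
  exact: continuousD.
by apply/funext => y /=; rewrite raddfD.
Qed.

Lemma ccontM x f g : ccont f x -> ccont g x -> ccont (fun y => f y * g y) x.
Proof.
move=> [f1 f2] [g1 g2]; split.
  rewrite (_ : (_ \o _) = (@complex.Re R \o f) * (@complex.Re R \o g) -
    (@complex.Im R \o f) * (@complex.Im R \o g)).
    by apply: continuousB; apply: continuousM.
  by apply/funext => y; rewrite !fctE /=; case: (f y) => ? ?; case: (g y).
rewrite (_ : (_ \o _) = (@complex.Re R \o f) * (@complex.Im R \o g) +
  (@complex.Im R \o f) * (@complex.Re R \o g)).
  by apply: continuousD; apply: continuousM.
by apply/funext => y; rewrite !fctE /=; case: (f y) => ? ?; case: (g y).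
Qed.

Lemma ccont_cst x l : ccont (fun=> l) x.
Proof. by split; apply: cst_continuous. Qed.

Lemma ccont_near x f g : (\near x, f x = g x) -> ccont f x -> ccont g x.
Proof.
move=> fg [f1 f2]; have e := nbhs_singleton fg.
split.
  apply: (cvg_trans _ (_ : (@complex.Re R \o f) y @[y --> x] --> _)).
    by apply: near_eq_cvg; near=> y; rewrite /= (near fg y).
  by rewrite /= -e; exact: f1.
apply: (cvg_trans _ (_ : (@complex.Im R \o f) y @[y --> x] --> _)).
  by apply: near_eq_cvg; near=> y; rewrite /= (near fg y).
by rewrite /= -e; exact: f2.
Unshelve. all: by end_near. Qed.

End ComplexDerivative.

(** * Functions of class C^k, with bounds on their derivatives *)

Section SmoothFunctions.
Context {R : realType} {d : nat}.
Local Notation E := 'rV[R]_d.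
Local Notation e_ j := (delta_mx 0 j : 'rV[R]_d).
Implicit Types (f g : E -> complex R) (W S K : set E).

Lemma partialE j f x l : cder x (e_ j) f l -> partial j f x = l.
Proof. by move=> [[_ a] [_ b]]; rewrite /partial a b; case: l {a b}. Qed.

Lemma partials_rcons s j f : partials (rcons s j) f = partials s (partial j f).
Proof. by rewrite /partials foldr_rcons. Qed.

Lemma eq_partials W f g : open W -> (forall x, W x -> f x = g x) ->
  forall s x, W x -> partials s f x = partials s g x.
Proof.
move=> oW fg; elim=> [|j s IH] x Wx //=; first exact: fg.
rewrite /partial; congr (_ +i* _)%C; apply: near_eq_derive;
  by near=> y; rewrite /= IH//; near: y; exact: open_nbhs_nbhs.
Unshelve. all: by end_near. Qed.

Lemma eq_partial W f g j x : open W -> (forall y, W y -> f y = g y) ->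
  W x -> partial j f x = partial j g x.
Proof. by move=> oW fg Wx; exact: (eq_partials oW fg [:: j]). Qed.

(** The recursion takes the innermost derivative first, so that inductions on [k] generalise over
    [f]; [partials] unfolds from the outermost one, and [partials_rcons] relates the two. *)
Fixpoint Ck W (k : nat) f : Prop :=
  (forall x, W x -> ccont f x) /\
  if k is k'.+1 then forall j,
    (forall x, W x -> cder x (e_ j) f (partial j f x)) /\ Ck W k' (partial j f)
  else True.

Definition Ck_bound S (k : nat) f (c : R) : Prop :=
  forall s x, (size s <= k)%N -> S x -> cmod (partials s f x) <= c.

Lemma sm_cont W k f x : Ck W k f -> W x -> ccont f x.
Proof. by case: k => [|k] [h _] Wx; exact: h. Qed.

Lemma eq_sm W k f g : open W -> (forall x, W x -> f x = g x) ->
  Ck W k f -> Ck W k g.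
Proof.
move=> oW; elim: k f g => [|k IH] f g fg /= [h1 h2].
  split=> // x Wx; apply: ccont_near (h1 x Wx).
  by near=> y; apply: fg; near: y; exact: open_nbhs_nbhs.
split=> [x Wx|j].
  apply: ccont_near (h1 x Wx).
  by near=> y; apply: fg; near: y; exact: open_nbhs_nbhs.
have [h3 h4] := h2 j; split; last first.
  by apply: (IH (partial j f)) => // x Wx; exact: (eq_partial _ oW fg).
move=> x Wx; rewrite -(eq_partial _ oW fg Wx); apply: cder_near (h3 x Wx).
by near=> y; apply: fg; near: y; exact: open_nbhs_nbhs.
Unshelve. all: by end_near. Qed.

(** Derivatives enter as explicit candidates [D], which spares every later instance a computation of
    [partial]. *)
Lemma smS W k f (D : 'I_d -> E -> complex R) : open W ->
  (forall x, W x -> ccont f x) ->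
  (forall j x, W x -> cder x (e_ j) f (D j x)) ->
  (forall j, Ck W k (D j)) -> Ck W k.+1 f.
Proof.
move=> oW cf df sD; split=> // j; split=> [x Wx|].
  by rewrite (partialE (df j x Wx)); exact: df.
by apply: (eq_sm oW _ (sD j)) => x Wx; rewrite (partialE (df j x Wx)).
Qed.

Lemma sm_le W k l f : (k <= l)%N -> Ck W l f -> Ck W k f.
Proof.
elim: k l f => [|k IH] [|l] f //= kl [h1 h2]; split=> // j.
by have [h3 h4] := h2 j; split=> //; exact: IH h4.
Qed.

Lemma sm_sub W W' k f : W' `<=` W -> Ck W k f -> Ck W' k f.
Proof.
move=> WW; elim: k f => [|k IH] f /= [h1 h2]; first by split=> // x /WW; exact: h1.
split=> [x /WW|j]; first exact: h1.
by have [h3 h4] := h2 j; split=> [x /WW|]; [exact: h3|exact: IH].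
Qed.

Lemma sm_cst W k l : open W -> Ck W k (fun=> l).
Proof.
move=> oW; elim: k l => [|k IH] l; first by split=> // x _; exact: ccont_cst.
by apply: (smS (D := fun _ _ => 0)) => // *; [exact: ccont_cst|exact: cder_cst].
Qed.

Lemma smD W k f g : open W -> Ck W k f -> Ck W k g ->
  Ck W k (fun x => f x + g x).
Proof.
move=> oW; elim: k f g => [|k IH] f g sf sg.
  by split=> // x Wx; apply: ccontD; [exact: sm_cont sf Wx|exact: sm_cont sg Wx].
apply: (smS (D := fun j x => partial j f x + partial j g x)) => //.
- by move=> x Wx; apply: ccontD; [exact: sm_cont sf Wx|exact: sm_cont sg Wx].
- by move=> j x Wx; case: sf => _ /(_ j)[] h _; case: sg => _ /(_ j)[] h' _;
    exact: cderD (h x Wx) (h' x Wx).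
- by move=> j; case: sf => _ /(_ j)[] _ h; case: sg => _ /(_ j)[] _ h'; exact: IH.
Qed.

Lemma smM W k f g : open W -> Ck W k f -> Ck W k g ->
  Ck W k (fun x => f x * g x).
Proof.
move=> oW; elim: k f g => [|k IH] f g sf sg.
  by split=> // x Wx; apply: ccontM; [exact: sm_cont sf Wx|exact: sm_cont sg Wx].
apply: (smS (D := fun j x => partial j f x * g x + f x * partial j g x)) => //.
- by move=> x Wx; apply: ccontM; [exact: sm_cont sf Wx|exact: sm_cont sg Wx].
- by move=> j x Wx; case: sf => _ /(_ j)[] h _; case: sg => _ /(_ j)[] h' _;
    exact: cderM (h x Wx) (h' x Wx).
- move=> j; have sf' := sm_le (leqnSn k) sf; have sg' := sm_le (leqnSn k) sg.
  case: sf => _ /(_ j)[] _ h; case: sg => _ /(_ j)[] _ h'.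
  by apply: smD => //; apply: IH.
Qed.

Lemma smB W k f g : open W -> Ck W k f -> Ck W k g ->
  Ck W k (fun x => f x - g x).
Proof.
move=> oW sf sg; have := smD oW sf (smM oW (sm_cst k (-1) oW) sg).
by apply: eq_sm => // x _; rewrite mulN1r.
Qed.

Lemma sm_prod W k (I : eqType) (r : seq I) (f : I -> E -> complex R) : open W ->
  (forall i, i \in r -> Ck W k (f i)) -> Ck W k (fun x => \prod_(i <- r) f i x).
Proof.
move=> oW; elim: r => [|i r IH] h.
  apply: eq_sm (sm_cst k 1 oW) => // x _; by rewrite big_nil.
apply: (@eq_sm _ _ (fun x => f i x * \prod_(i <- r) f i x)) => //.
  by move=> x _; rewrite big_cons.
apply: smM => //; first by apply: h; rewrite mem_head.
by apply: IH => j jr; apply: h; rewrite in_cons jr orbT.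
Qed.

Lemma smoothP W f : open W -> smooth W f <-> forall k, Ck W k f.
Proof.
move=> oW; split=> [h k|h].
  elim: k f h => [|k IH] f h.
    by split=> // x Wx; have [? ? _] := h [::] x Wx; split.
  apply: (smS (D := fun j => partial j f)) => //.
  - by move=> x Wx; have [? ? _] := h [::] x Wx; split.
  - move=> j x Wx; have [_ _ /(_ j)[h1 h2]] := h [::] x Wx.
    by split; apply: DeriveDef.
  - move=> j; apply: IH => s x Wx; have := h (rcons s j) x Wx.
    by rewrite partials_rcons.
(* Induction from the end of the list: its last index is the innermost derivative. *)
move=> s; elim/last_ind: s f h => [|s j IH] f h x Wx; last first.
  rewrite partials_rcons; apply: IH => // k.
  by have [_ /(_ j)[]] := h k.+1.
have [[c1 c2] h2] := (sm_cont (h 0%N) Wx, h 1%N).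
split=> // j; have [_ /(_ j)[/(_ x Wx)[[? _] [? _]] _]] := h2.
by split.
Qed.

Lemma bd0P S f c : Ck_bound S 0 f c <-> forall x, S x -> cmod (f x) <= c.
Proof.
split=> [h x Sx|h s x]; first exact: (h [::]).
by rewrite leqn0 => /nilP ->; exact: h.
Qed.

Lemma bdSP S k f c : Ck_bound S k.+1 f c <->
  (forall x, S x -> cmod (f x) <= c) /\ (forall j, Ck_bound S k (partial j f) c).
Proof.
split=> [h|[h1 h2] s].
  split=> [x Sx|j s x sk Sx]; first exact: (h [::]).
  by rewrite -partials_rcons; apply: h; rewrite ?size_rcons.
case/lastP: s => [|s j] x; first by move=> _; exact: h1.
by rewrite size_rcons partials_rcons => sk Sx; exact: h2.
Qed.

Lemma bd_val S k f c x : Ck_bound S k f c -> S x -> cmod (f x) <= c.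
Proof. by move=> h Sx; exact: (h [::]). Qed.

Lemma bd_le S k f c c' : c <= c' -> Ck_bound S k f c -> Ck_bound S k f c'.
Proof. by move=> cc h s x sk Sx; exact: le_trans (h s x sk Sx) cc. Qed.

Lemma bd_leq S k l f c : (k <= l)%N -> Ck_bound S l f c -> Ck_bound S k f c.
Proof. by move=> kl h s x sk Sx; exact: h (leq_trans sk kl) Sx. Qed.

Lemma bd_sub S S' k f c : S' `<=` S -> Ck_bound S k f c -> Ck_bound S' k f c.
Proof. by move=> SS h s x sk /SS; exact: h. Qed.

Lemma eq_bd W S k f g c : open W -> S `<=` W -> (forall x, W x -> f x = g x) ->
  Ck_bound S k f c -> Ck_bound S k g c.
Proof.
by move=> oW SW fg h s x sk Sx; rewrite -(eq_partials oW fg s (SW x Sx)); exact: h.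
Qed.

Lemma bdS W S k f (D : 'I_d -> E -> complex R) c : open W -> S `<=` W ->
  (forall j x, W x -> cder x (e_ j) f (D j x)) ->
  (forall x, S x -> cmod (f x) <= c) ->
  (forall j, Ck_bound S k (D j) c) -> Ck_bound S k.+1 f c.
Proof.
move=> oW SW df h1 h2; apply/bdSP; split=> // j.
by apply: (eq_bd oW SW _ (h2 j)) => x Wx; rewrite (partialE (df j x Wx)).
Qed.

Lemma bd_cst S k l : Ck_bound S k (fun=> l) (cmod l).
Proof.
elim: k l => [|k IH] l; first exact/bd0P.
apply: (@bdS setT) => // [|j x _|j]; [exact: openT|exact: cder_cst|].
by apply: bd_le (IH 0); rewrite cmod0 cmod_ge0.
Qed.

Lemma bdD W S k f g a b : open W -> S `<=` W -> Ck W k f -> Ck W k g ->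
  Ck_bound S k f a -> Ck_bound S k g b -> Ck_bound S k (fun x => f x + g x) (a + b).
Proof.
move=> oW SW; elim: k f g => [|k IH] f g sf sg bf bg.
  apply/bd0P => x Sx; apply: le_trans (cmodD _ _) _.
  by apply: lerD; [exact: bd_val bf Sx|exact: bd_val bg Sx].
apply: (bdS oW SW (D := fun j x => partial j f x + partial j g x)).
- by move=> j x Wx; case: sf => _ /(_ j)[] h _; case: sg => _ /(_ j)[] h' _;
    exact: cderD (h x Wx) (h' x Wx).
- move=> x Sx; apply: le_trans (cmodD _ _) _.
  by apply: lerD; [exact: bd_val bf Sx|exact: bd_val bg Sx].
- move=> j; case: sf => _ /(_ j)[] _ h; case: sg => _ /(_ j)[] _ h'.
  by case/bdSP: bf => _ ?; case/bdSP: bg => _ ?; apply: IH.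
Qed.

(** Each differentiation turns a product into two products, whence the factor [2 ^+ k]. *)
Lemma bdM W S k f g a b : open W -> S `<=` W -> 0 <= a -> 0 <= b ->
  Ck W k f -> Ck W k g ->
  Ck_bound S k f a -> Ck_bound S k g b -> Ck_bound S k (fun x => f x * g x) (2 ^+ k * a * b).
Proof.
move=> oW SW a0 b0; elim: k f g => [|k IH] f g sf sg bf bg.
  apply/bd0P => x Sx; rewrite cmodM expr0 mul1r.
  by apply: ler_pM; rewrite ?cmod_ge0//; [exact: bd_val bf Sx|exact: bd_val bg Sx].
apply: (bdS oW SW (D := fun j x => partial j f x * g x + f x * partial j g x)).
- by move=> j x Wx; case: sf => _ /(_ j)[] h _; case: sg => _ /(_ j)[] h' _;
    exact: cderM (h x Wx) (h' x Wx).
- move=> x Sx; rewrite cmodM -mulrA; apply: (@le_trans _ _ (a * b)).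
    by apply: ler_pM; rewrite ?cmod_ge0//; [exact: bd_val bf Sx|exact: bd_val bg Sx].
  by rewrite ler_peMl ?mulr_ge0// exprn_ege1// ler1n.
- move=> j; have sf' := sm_le (leqnSn k) sf; have sg' := sm_le (leqnSn k) sg.
  have bf' := bd_leq (leqnSn k) bf; have bg' := bd_leq (leqnSn k) bg.
  case: sf => _ /(_ j)[] _ h; case: sg => _ /(_ j)[] _ h'.
  case/bdSP: bf => _ ?; case/bdSP: bg => _ ?.
  rewrite exprS mulrDl mul1r !mulrDl.
  by apply: (bdD oW SW); [exact: smM|exact: smM|exact: IH|exact: IH].
Qed.

Lemma bdZ W S k f a l : open W -> S `<=` W -> Ck W k f ->
  Ck_bound S k f a -> Ck_bound S k (fun x => l * f x) (cmod l * a).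
Proof.
move=> oW SW; elim: k f => [|k IH] f sf bf.
  apply/bd0P => x Sx; rewrite cmodM ler_wpM2l ?cmod_ge0//; exact: bd_val bf Sx.
apply: (bdS oW SW (D := fun j x => l * partial j f x)).
- move=> j x Wx; case: sf => _ /(_ j)[] h _.
  have := cderM (cder_cst x (e_ j) l) (h x Wx).
  by rewrite mul0r add0r.
- move=> x Sx; rewrite cmodM ler_wpM2l ?cmod_ge0//; exact: bd_val bf Sx.
- move=> j; case: sf => _ /(_ j)[] _ h.
  by case/bdSP: bf => _ ?; apply: IH.
Qed.

Lemma bd_prod W S k (I : eqType) (r : seq I) (f : I -> E -> complex R) c :
  open W -> S `<=` W -> 0 <= c ->
  (forall i, i \in r -> Ck W k (f i)) -> (forall i, i \in r -> Ck_bound S k (f i) c) ->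
  Ck_bound S k (fun x => \prod_(i <- r) f i x) ((2 ^+ k * c) ^+ size r).
Proof.
move=> oW SW c0; elim: r => [|i r IH] h h'.
  apply: (eq_bd oW SW (f := fun=> 1)); first by move=> x _; rewrite big_nil.
  by have := @bd_cst S k 1; rewrite cmod1.
apply: (eq_bd oW SW (f := fun x => f i x * \prod_(i <- r) f i x)).
  by move=> x _; rewrite big_cons.
rewrite /= exprS; apply: (bdM oW SW) => //.
- by rewrite exprn_ge0// mulr_ge0// exprn_ge0.
- by apply: h; rewrite mem_head.
- by apply: sm_prod => // j jr; apply: h; rewrite in_cons jr orbT.
- by apply: h'; rewrite mem_head.
- by apply: IH => j jr; [apply: h|apply: h']; rewrite in_cons jr orbT.
Qed.

Lemma bd_exists W K k f : compact K -> K `<=` W -> Ck W k f ->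
  exists2 c, 0 <= c & Ck_bound K k f c.
Proof.
move=> cK KW; elim: k f => [|k IH] f sf.
  have h (u : E -> R) : (forall x, K x -> {for x, continuous u}) ->
      exists2 c, 0 <= c & forall x, K x -> `|u x| <= c.
    move=> cu; have cu' : {within K, continuous u}.
      by apply: continuous_in_subspaceT => x /set_mem; exact: cu.
    have [M [Mr hM]] := compact_bounded (continuous_compact cu' cK).
    exists (`|M| + 1) => // x Kx; apply: hM; last by exists x.
    by rewrite (le_lt_trans (ler_norm M))// ltrDl.
  have [a a0 ha] := h (@complex.Re R \o f) (fun x Kx => (sm_cont sf (KW x Kx)).1).
  have [b b0 hb] := h (@complex.Im R \o f) (fun x Kx => (sm_cont sf (KW x Kx)).2).
  exists (a + b); first exact: addr_ge0.
  apply/bd0P => x Kx; apply: le_trans (cmod_le_ReIm _) _.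
  by apply: lerD; [exact: ha|exact: hb].
have [c c0 hc] := IH f (sm_le (leqnSn k) sf).
have h j : exists c', 0 <= c' /\ Ck_bound K k (partial j f) c'.
  by case: sf => _ /(_ j)[_ /IH[c' ? ?]]; exists c'.
have [C hC] := choice h.
exists (c + \sum_j C j); first by rewrite addr_ge0// sumr_ge0// => j _; case: (hC j).
have Cge j : C j <= \sum_j C j.
  by rewrite (bigD1 j)//= lerDl sumr_ge0// => i _; case: (hC i).
apply/bdSP; split=> [x Kx|j].
  by apply: le_trans (bd_val hc Kx) _; rewrite lerDl sumr_ge0// => j _; case: (hC j).
apply: bd_le (hC j).2; apply: le_trans (Cge j) _; by rewrite lerDr.
Qed.

(** The [sup] of the empty set is 0, so for empty [K] the bound rests on [0 <= c]. *)
Lemma seminorm_le K N f c : 0 <= c -> Ck_bound K N f c -> seminorm K N f <= c.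
Proof.
move=> c0 h; rewrite /seminorm; set A := [set _ | _].
have [[r Ar]|A0] := pselect (A !=set0); last first.
  by rewrite (_ : A = set0) ?sup0//; apply/eqP/negP => /negP/set0P.
by apply: ge_sup; [exists r|move=> _ [s [x [sN Kx ->]]]; exact: h].
Qed.

Lemma bd_seminorm W K N f : compact K -> K `<=` W -> Ck W N f ->
  Ck_bound K N f (seminorm K N f).
Proof.
move=> cK KW sf s x sN Kx; apply: ub_le_sup; last by exists s, x.
have [c _ hc] := bd_exists cK KW sf.
by exists c => _ [t [y [tN Ky ->]]]; exact: hc.
Qed.

Lemma seminorm_ge0 K N f : 0 <= seminorm K N f.
Proof.
rewrite /seminorm; set A := [set _ | _].
have [[r Ar]|A0] := pselect (A !=set0); last first.
  by rewrite (_ : A = set0) ?sup0//; apply/eqP/negP => /negP/set0P.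
(* By convention [sup] is 0 on a set without upper bound. *)
have [ub|nub] := pselect (has_ubound A); last by rewrite sup_out// => -[].
apply: le_trans (ub_le_sup ub Ar).
by case: Ar => s [x [_ _ ->]]; exact: cmod_ge0.
Qed.

End SmoothFunctions.

(** * Smooth functions of one real variable, and smoothing by averages *)

Section RealTowers.
Context {R : realType}.
Implicit Types (f g F : R -> R) (T : nat -> R -> R).

(** A smooth function is carried together with all its derivatives, so that none has to be computed
    or shown to exist again. *)
Definition tower T := forall n (x : R), is_derive x 1 (T n) (T n.+1 x).

Lemma is_derive_continuous F (dF : R -> R) :
  (forall x : R, is_derive x 1 F (dF x)) -> continuous F.
Proof.
move=> h x; apply: differentiable_continuous; apply/derivable1_diffP.
by have [] := h x.
Qed.

Lemma is_derive_affine F (dF : R -> R) (a b x : R) :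
  (forall x : R, is_derive x 1 F (dF x)) ->
  is_derive x 1 (fun y => F (a * y + b)) (a * dF (a * x + b)).
Proof.
move=> h; rewrite mulrC.
have ha : is_derive x 1 (fun y : R => a * y + b) a.
  have h1 : is_derive x 1 (fun y : R => a * y) a.
    by have := @is_deriveZ _ _ _ (@id R) a x 1 1 _; rewrite /GRing.scale /= mulr1; exact.
  by have := @is_deriveD _ _ _ (fun y : R => a * y) (cst b) x 1 a 0 h1 _; rewrite addr0; exact.
exact: (@is_derive1_comp _ F (fun y => a * y + b) x (dF (a * x + b)) a).
Qed.

Lemma MVT_everywhere F (dF : R -> R) (x y : R) :
  (forall x : R, is_derive x 1 F (dF x)) -> x <= y ->
  exists2 z, x <= z <= y & F y - F x = dF z * (y - x).
Proof.
move=> h xy; have cF : {within `[x, y], continuous F}.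
  by apply: continuous_subspaceT; exact: is_derive_continuous h.
have [z zxy e] := MVT_segment xy (fun z _ => h z) cF.
by exists z => //; move: zxy; rewrite in_itv.
Qed.

Lemma derive_lipschitz F (dF : R -> R) c :
  (forall x : R, is_derive x 1 F (dF x)) -> (forall x, `|dF x| <= c) ->
  forall x y, `|F y - F x| <= c * `|y - x|.
Proof.
move=> h hc x y; wlog xy : x y / x <= y => [H|].
  have [/H//|/ltW/H] := leP x y.
  by rewrite -(opprB (F x)) normrN -(opprB x) normrN.
have [z _ ->] := MVT_everywhere h xy.
by rewrite normrM ler_wpM2r.
Qed.

(** With [f] zero to the left of [A], the integral from [A - 1] is a primitive on the whole line: it
    vanishes left of [A], and from there on the fundamental theorem applies. *)
Lemma exists_primitive f (A : R) : continuous f -> (forall x, x <= A -> f x = 0) ->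
  exists F, forall x : R, is_derive x 1 F (f x).
Proof.
move=> cf f0; pose F x := \int[lebesgue_measure]_(t in `[A - 1, x]) f t.
exists F => x; have [xA|Ax] := ltP x A.
  rewrite f0 ?ltW//; apply: (@near_eq_is_derive R R R (cst 0)).
  near=> y; rewrite /F /Rintegral (eq_integral (cst 0%E)) ?integral0//= => t.
  rewrite inE/= in_itv/= => /andP[_ ty]; rewrite f0//.
  by apply: le_trans ty _; apply: ltW; near: y; exact: lt_nbhsl.
have hx : x < x + 1 by rewrite ltrDl.
have [||| dF e] := @continuous_FTC1 _ f (BLeft (A - 1)) x _ hx.
- apply: continuous_compact_integrable; first exact: segment_compact.
  exact: continuous_subspaceT.
- by rewrite lte_fin; lra.
- exact: cf.
- by apply: DeriveDef; rewrite -?derive1E.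
Unshelve. all: by end_near. Qed.

(* Moving average over an interval of length [2 w] gains one derivative at the
   cost of a factor [1 / w]. *)
Lemma moving_average T (a b w c0 : R) : tower T -> 0 < w ->
  (forall x, a < `|x| -> T 0%N x = 0) ->
  (forall x, `|x| < b -> T 0%N x = c0) ->
  exists T', [/\ tower T',
    (forall x, a + w < `|x| -> T' 0%N x = 0),
    (forall x, `|x| < b - w -> T' 0%N x = c0),
    (forall n c, (forall x, `|T n x| <= c) -> forall x, `|T' n x| <= c) &
    (forall n c, (forall x, `|T n x| <= c) -> forall x, `|T' n.+1 x| <= c / w)].
Proof.
move=> tT w0 Ta Tb.
have cT : continuous (T 0%N) by exact: is_derive_continuous (tT 0%N).
have [|P dP] := @exists_primitive (T 0%N) (- `|a| - 1) cT.
  move=> x xa; apply: Ta; rewrite ltr0_norm; last by have := normr_ge0 a; lra.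
  by have := ler_norm a; lra.
(* [Q] is the tower of a primitive, so [T' n] is the average of [Q n.+1 = T n] over the window. *)
pose Q n := if n is n'.+1 then T n' else P.
have dQ n (x : R) : is_derive x 1 (Q n) (Q n.+1 x).
  by case: n => [|n]; [exact: dP|exact: tT].
pose T' n x := (2 * w)^-1 * (Q n (x + w) - Q n (x - w)).
have dT' : tower T'.
  move=> n x.
  have h (u : R) : is_derive x 1 (fun y => Q n (y + u)) (Q n.+1 (x + u)).
    have := is_derive_affine 1 u x (dQ n); rewrite !mul1r.
    by under eq_fun do rewrite mul1r.
  exact: (@is_deriveZ _ _ _ (fun y => Q n (y + w) - Q n (y - w))).
have w2 : (2 * w)^-1 * (w + w) = 1 by field; rewrite gt_eqF.
(* An average is a value of [T n] at some point of the window; support, plateau and size are all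
   read off at that point. *)
have hmvt n x : exists2 z, x - w <= z <= x + w & T' n x = Q n.+1 z.
  have [|z hz e] := MVT_everywhere (dQ n) (_ : x - w <= x + w); first lra.
  exists z => //; rewrite /T' e.
  by rewrite (_ : x + w - (x - w) = w + w) ?(mulrC (Q _ _)) ?mulrA ?w2 ?mul1r//; ring.
exists T'; split=> //.
- move=> x ax; have [z hz ->] := hmvt 0%N x; apply: Ta.
  have [x0|x0] := leP 0 x.
    by move: ax; rewrite ger0_norm// => ax; rewrite ltr_normr; lra.
  by move: ax; rewrite ltr0_norm// => ax; rewrite ltr_normr; lra.
- move=> x bx; have [z hz ->] := hmvt 0%N x; apply: Tb.
  by move: bx; rewrite !ltr_norml; lra.
- by move=> n c hc x; have [z _ ->] := hmvt n x; exact: hc.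
(* Here [Q n.+1] is [T n] itself, so the difference quotient is bounded with no further
   derivative. *)
- move=> n c hc x; rewrite /T' /= normrM gtr0_norm ?invr_gt0; last lra.
  rewrite mulrC ler_pdivrMr; last lra.
  have -> : c / w * (2 * w) = c + c by field; rewrite gt_eqF.
  exact: le_trans (ler_normB _ _) (lerD (hc _) (hc _)).
Qed.

Lemma iterated_average T (a b w c0 : R) (p : nat) : tower T -> 0 < w ->
  (forall x, a < `|x| -> T 0%N x = 0) ->
  (forall x, `|x| < b -> T 0%N x = c0) ->
  exists T', [/\ tower T',
    (forall x, a + w *+ p < `|x| -> T' 0%N x = 0),
    (forall x, `|x| < b - w *+ p -> T' 0%N x = c0),
    (forall n c, (forall x, `|T n x| <= c) -> forall x, `|T' n x| <= c) &
    (forall n c, (forall x, `|T n x| <= c) ->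
       forall x, `|T' (n + p)%N x| <= c / w ^+ p)].
Proof.
move=> tT w0 Ta Tb; elim: p => [|p [T' [tT' T'a T'b T'c T'p]]].
  exists T; split=> //; rewrite ?mulr0n ?addr0 ?subr0// => n c hc x.
  by rewrite addn0 expr0 divr1.
have [T'' [tT'' T''a T''b T''c T''p]] := moving_average tT' w0 T'a T'b.
exists T''; split=> //.
- by move=> x hx; apply: T''a; rewrite -addrA -mulrSr.
- by move=> x hx; apply: T''b; rewrite -addrA -opprD -mulrSr.
- by move=> n c hc; apply: T''c; exact: T'c.
- move=> n c hc x; rewrite addnS exprSr invfM mulrA.
  exact: T''p (T'p _ _ hc) x.
Qed.

(** Existence of [k] derivatives is closed under products by a short induction, where a tower would
    need the general Leibniz formula; [sm1_tower] returns to towers. *)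
Fixpoint Ck_real (k : nat) g : Prop :=
  if k is k'.+1 then exists2 dg : R -> R, (forall x : R, is_derive x 1 g (dg x)) & Ck_real k' dg
  else True.

Lemma sm1_tower g : (forall k, Ck_real k g) -> exists2 T, tower T & T 0%N = g.
Proof.
move=> h; exists (fun n => derive1n n g); last by [].
have dE (u du : R -> R) : (forall x : R, is_derive x 1 u (du x)) -> derive1 u = du.
  by move=> hu; apply/funext => x; rewrite derive1E; have [_ ->] := hu x.
have {}h n : forall k, Ck_real k (derive1n n g).
  elim: n => [|n IH] k; first exact: h.
  by have [dg h1 h2] := IH k.+1; rewrite derive1nS (dE _ _ h1).
by move=> n x; have [dg h1 _] := h n 1%N; rewrite derive1nS (dE _ _ h1).
Qed.

Lemma sm1_le k l g : (k <= l)%N -> Ck_real l g -> Ck_real k g.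
Proof.
elim: k l g => [|k IH] [|l] g //= kl [dg h1 h2].
by exists dg => //; exact: IH h2.
Qed.

Lemma sm1D k f g : Ck_real k f -> Ck_real k g -> Ck_real k (fun x => f x + g x).
Proof.
elim: k f g => [//|k IH] f g [df h1 h2] [dg h3 h4].
by exists (fun x => df x + dg x); [move=> x; exact: is_deriveD|exact: IH].
Qed.

Lemma sm1Z k c f : Ck_real k f -> Ck_real k (fun x => c * f x).
Proof.
elim: k f => [//|k IH] f [df h1 h2].
by exists (fun x => c * df x); [move=> x; exact: is_deriveZ|exact: IH].
Qed.

Lemma sm1M k f g : Ck_real k f -> Ck_real k g -> Ck_real k (fun x => f x * g x).
Proof.
elim: k f g => [//|k IH] f g sf sg.
have sf' := sm1_le (leqnSn k) sf; have sg' := sm1_le (leqnSn k) sg.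
case: sf => df h1 h2; case: sg => dg h3 h4.
exists (fun x => f x * dg x + g x * df x).
  by move=> x; exact: is_deriveM.
by apply: sm1D; apply: IH.
Qed.

Lemma sm1_affine k f (a b : R) : Ck_real k f -> Ck_real k (fun x => f (a * x + b)).
Proof.
elim: k f => [//|k IH] f [df h1 h2].
exists (fun x => a * df (a * x + b)); last by apply: sm1Z; exact: IH.
by move=> x; exact: is_derive_affine.
Qed.

End RealTowers.

(** * Smooth bumps, plateaus and Ehrenpreis cutoffs on the line *)

Section SmoothCutoffs.
Context {R : realType}.
Implicit Types (T : nat -> R -> R).

(* [x^-n exp (-1/x)], extended by 0: the derivative of such a function is a
   combination of two of them. *)
Definition flat (n : nat) (x : R) : R :=
  if 0 < x then x^-1 ^+ n * expR (- x^-1) else 0.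

Lemma flat_ge0 n x : 0 <= flat n x.
Proof.
rewrite /flat; case: ifP => // x0.
by rewrite mulr_ge0 ?expR_ge0// exprn_ge0// invr_ge0 ltW.
Qed.

Lemma flat_neg n x : x <= 0 -> flat n x = 0.
Proof. by rewrite /flat leNgt => /negbTE ->. Qed.

(** The quadratic bound yields derivative 0 at the origin; it comes from the term of degree [n + 2]
    of the exponential series at [1 / x]. *)
Lemma flat_le n (x : R) : flat n x <= (n.+2)`!%:R * x ^+ 2.
Proof.
rewrite /flat; case: ifP => x0; last by rewrite mulr_ge0// sqr_ge0.
have y0 : 0 < x^-1 by rewrite invr_gt0.
have f0 : 0 < (n.+2)`!%:R :> R by rewrite ltr0n fact_gt0.
have h : x^-1 ^+ n.+2 / (n.+2)`!%:R <= expR x^-1.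
  by apply: le_trans (expR_ge1Dxn n.+1 (ltW y0)); rewrite lerDr.
rewrite expRN ler_pdivrMr ?expR_gt0//.
move: h; rewrite ler_pdivrMr// => h.
have -> : x^-1 ^+ n = x ^+ 2 * x^-1 ^+ n.+2.
  by rewrite -(addn2 n) exprD mulrCA -exprMn mulfV ?gt_eqF// expr1n mulr1.
rewrite (_ : _ * x ^+ 2 * _ = x ^+ 2 * (expR x^-1 * (n.+2)`!%:R)); last by ring.
by rewrite ler_wpM2l// sqr_ge0.
Qed.

Lemma is_derive_flat n (x : R) :
  is_derive x 1 (flat n) (- n%:R * flat n.+1 x + flat n.+2 x).
Proof.
have [x0|x0|->] := ltgtP x 0.
- rewrite /flat ltNge (ltW x0) /= mulr0 addr0.
  apply: (@near_eq_is_derive R R R (cst 0)).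
  near=> y; rewrite /flat ltNge [X in ~~ X](_ : _ = true)//.
  by apply: ltW; near: y; exact: lt_nbhsl.
- apply: (@near_eq_is_derive R R R (fun y => y^-1 ^+ n * expR (- y^-1))).
    near=> y; rewrite /flat ifT//; near: y; exact: lt_nbhsr.
  have dV : is_derive x 1 (fun y : R => y^-1) (- x ^- 2).
    have := @is_deriveV _ id x 1 1; rewrite /GRing.scale /= mulr1; apply.
    by rewrite gt_eqF.
  have dn : is_derive x 1 (fun y : R => y^-1 ^+ n) (n%:R * x^-1 ^+ n.-1 * - x ^- 2).
    rewrite (_ : (fun y => _) = (fun y : R => y^-1) ^+ n); last by apply/funext=> y; rewrite fctE.
    exact: is_deriveX.
  have dNV : is_derive x 1 (fun y : R => - y^-1) (x ^- 2).
    by have := @is_deriveN _ _ _ (fun y : R => y^-1) x 1 _ dV; rewrite opprK.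
  have de : is_derive x 1 (fun y : R => expR (- y^-1)) (expR (- x^-1) * x ^- 2).
    exact: (@is_derive1_comp _ (@expR R) (fun y : R => - y^-1)).
  have H := @is_deriveM _ _ (fun y : R => y^-1 ^+ n) _ x 1 _ _ dn de.
  apply: (is_derive_eq H).
  rewrite /flat x0 /GRing.scale /= -exprVn.
  by case: n {dn H} => [|n] /=; rewrite ?expr0 !exprS; ring.
- have C0 : 0 <= (n.+2)`!%:R :> R by [].
  rewrite /flat ltxx mulr0 addr0.
  suff h : h^-1 *: (flat n (h *: 1 + 0) - flat n 0) @[h --> 0^'] --> (0 : R).
    by apply: DeriveDef; [apply/cvg_ex; exists 0|exact: cvg_lim].
  apply/cvgr0Pnorm_le => e e0; near=> h.
  rewrite addr0 {2}/flat ltxx subr0 /GRing.scale /= mulr1 normrM.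
  have h0 : h != 0 by near: h; exact: nbhs_dnbhs_neq.
  rewrite normfV mulrC ler_pdivrMr ?normr_gt0// (ger0_norm (flat_ge0 _ _)).
  apply: le_trans (flat_le _ _) _; rewrite -real_normK ?num_real// expr2 mulrA.
  rewrite ler_wpM2r// mulrC -ler_pdivlMr ?ltr0n ?fact_gt0//.
  near: h; apply: dnbhs0_le; by rewrite divr_gt0// ltr0n fact_gt0.
Unshelve. all: by end_near. Qed.

Lemma sm1_flat k n : Ck_real k (flat n).
Proof.
elim: k n => [//|k IH] n.
exists (fun x => - n%:R * flat n.+1 x + flat n.+2 x); first exact: is_derive_flat.
by apply: sm1D => //; exact: sm1Z.
Qed.

Lemma tower_sm1 T k n : tower T -> Ck_real k (T n).
Proof. by move=> tT; elim: k n => [//|k IH] n; exists (T n.+1). Qed.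

Lemma tower_locally_zero T (A : set R) n : tower T -> open A ->
  (forall x, A x -> T 0%N x = 0) -> forall x, A x -> T n x = 0.
Proof.
move=> tT oA h; elim: n => [//|n IH] x Ax.
have [_ <-] := tT n x; rewrite (@near_eq_derive _ _ _ (T n) (cst 0)).
  exact: derive_cst.
by near=> y; apply: IH; near: y; exact: open_nbhs_nbhs.
Unshelve. all: by end_near. Qed.

Lemma tower_zero_outside T (a : R) n : tower T ->
  (forall x, a < `|x| -> T 0%N x = 0) -> forall x, a < `|x| -> T n x = 0.
Proof.
move=> tT; apply: (tower_locally_zero _ tT).
rewrite (_ : (fun x : R => is_true (a < `|x|)) = (fun x : R => `|x|) @^-1` [set y | a < y])//.
by apply: open_comp => [x _|]; [exact: norm_continuous|exact: open_gt].
Qed.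

Lemma tower_bounded T (a : R) : tower T ->
  (forall x, a < `|x| -> T 0%N x = 0) ->
  exists c : nat -> R, forall n x, `|T n x| <= c n.
Proof.
move=> tT Ta; suff /(_ _)/cid-/all_sig[c hc] : forall n, exists c, forall x, `|T n x| <= c by exists c.
move=> n; have cT : continuous (T n) by exact: is_derive_continuous (tT n).
have cTa : {within `[- a, a], continuous (T n)} by exact: continuous_subspaceT.
have [M [Mr hM]] := compact_bounded (continuous_compact cTa (@segment_compact _ _ _)).
exists (`|M| + 1) => x; have [xa|ax] := leP `|x| a; last first.
  by rewrite (tower_zero_outside _ tT Ta)// normr0 addr_ge0.
apply: hM; first by rewrite (le_lt_trans (ler_norm M))// ltrDl.
by exists x => //=; rewrite in_itv /= -ler_norml.
Qed.

(** The plateau is the difference of two translates of a smooth step, the primitive of a bump on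
    [-1, 1]. The translations by 2 and -2 put the transitions between 1 and 3 in modulus, and the
    scale [3 / a] brings them to the required places. *)
Lemma exists_plateau (a : R) : 0 < a -> exists2 T, tower T &
  (forall x, a < `|x| -> T 0%N x = 0) /\ (forall x, `|x| < a / 3 -> T 0%N x = 1).
Proof.
move=> a0; pose f x := flat 0 (1 * x + 1) * flat 0 (-1 * x + 1).
have sf k : Ck_real k f by apply: sm1M; apply: sm1_affine; exact: sm1_flat.
have f0 x : 1 <= `|x| -> f x = 0.
  rewrite /f ler_normr => /orP[x1|x1].
    by rewrite [X in _ * X]flat_neg ?mulr0//; lra.
  by rewrite flat_neg ?mul0r//; lra.
have [T tT T0] := sm1_tower sf.
have cf : continuous f by rewrite -T0; exact: is_derive_continuous (tT 0%N).
have [|P dP] := @exists_primitive _ f (-1) cf.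
  by move=> x x1; apply: f0; rewrite ler_normr; apply/orP; right; lra.
have sP k : Ck_real k P.
  by case: k => [//|k]; exists f.
have Pc x y : x <= y -> (forall z, x <= z <= y -> f z = 0) -> P x = P y.
  move=> xy h; have [z hz e] := MVT_everywhere dP xy.
  by apply/esym/eqP; rewrite -subr_eq0 e h// mul0r.
have Pl x : x <= -1 -> P x = P (-1).
  move=> x1; apply: Pc => // z hz; apply: f0.
  by rewrite ler_normr; apply/orP; right; lra.
have Pr x : 1 <= x -> P x = P 1.
  move=> x1; apply/esym; apply: Pc => // z hz; apply: f0.
  by rewrite ler_normr; apply/orP; left; lra.
have Pm x y : x <= y -> P x <= P y.
  move=> xy; have [z hz e] := MVT_everywhere dP xy.
  rewrite -subr_ge0 e mulr_ge0 ?subr_ge0// /f; by rewrite mulr_ge0// flat_ge0.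
(* [P] is nondecreasing, so [P 1 = P (-1)] would make it constant on [-1, 1] and its derivative
   [f 0] zero, whereas [f 0] is the square of [expR (-1)]. *)
have J0 : P 1 - P (-1) != 0.
  apply/eqP => J0.
  have h : f 0 = 0.
    have [_ <-] := dP 0; rewrite (@near_eq_derive _ _ _ P (cst (P 1))).
      exact: derive_cst.
    near=> y; have y1 : y <= 1.
      by apply: ltW; near: y; apply: lt_nbhsl; lra.
    have y2 : -1 <= y.
      by apply: ltW; near: y; apply: lt_nbhsr; lra.
    by apply/eqP; rewrite eq_le Pm//= (le_trans _ (Pm _ _ y2))//; lra.
  move: h; rewrite /f /flat !mulr0 !add0r ltr01 expr0 !mul1r => /eqP.
  by rewrite mulf_eq0 orbb gt_eqF ?expR_gt0.
pose g x := (P 1 - P (-1))^-1 * (P (3 / a * x + 2) + -1 * P (3 / a * x + -2)).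
have [T' tT' T'0] : exists2 T, tower T & T 0%N = g.
  apply: sm1_tower => k; apply: sm1Z; apply: sm1D; last apply: sm1Z;
    exact: sm1_affine.
have a3 : 0 < 3 / a by rewrite divr_gt0.
exists T' => //; rewrite T'0 /g; split=> x.
  rewrite -(ltr_pM2l a3) divfK ?gt_eqF// -[X in X * `|x|](gtr0_norm a3) -normrM.
  move: (3 / a * x) => y; rewrite ltr_normr => /orP[y1|y1].
    by rewrite (Pr (y + 2)) ?(Pr (y + -2)) ?mulN1r ?subrr ?mulr0//; lra.
  by rewrite (Pl (y + 2)) ?(Pl (y + -2)) ?mulN1r ?subrr ?mulr0//; lra.
rewrite -(ltr_pM2l a3) (_ : 3 / a * (a / 3) = 1); last by field; rewrite gt_eqF.
rewrite -[X in X * `|x|](gtr0_norm a3) -normrM; move: (3 / a * x) => y.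
rewrite ltr_norml => y1.
by rewrite (Pr (y + 2)) ?(Pl (y + -2)) ?mulN1r ?mulVf//; lra.
Unshelve. all: by end_near. Qed.

(** Combines [n ^ n * n! <= (2 n)!] with the bound [4 ^ n] for the central binomial coefficient. *)
Lemma expnn_le_fact (n : nat) : (n ^ n <= 4 ^ n * n`!)%N.
Proof.
have h : (n ^ n * n`! <= (2 * n)`!)%N.
  rewrite mul2n -addnn.
  have g m : (n ^ m * n`! <= (m + n)`!)%N.
    elim: m => [|m IH]; first by rewrite mul1n.
    by rewrite expnS -mulnA addSn factS leq_mul// ltnW// ltnS leq_addl.
  exact: g.
have b : ('C(2 * n, n) <= 4 ^ n)%N.
  rewrite (_ : 4 = (1 + 1) ^ 2)%N// -expnM expnDn.
  have nn : (n < (2 * n).+1)%N by lia.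
  by rewrite (bigD1 (Ordinal nn))//= !exp1n !muln1 leq_addr.
have e := @bin_fact (2 * n) n ltac:(lia).
have nn : (2 * n - n = n)%N by lia.
rewrite nn in e; move: h; rewrite -e mulnA leq_pmul2r ?fact_gt0// => h.
by apply: leq_trans h _; rewrite leq_mul2r b orbT.
Qed.

(* Ehrenpreis cutoffs: averaging a fixed plateau function [p] times over windows
   of length comparable to [a / p] makes [p] extra derivatives cost only
   [(C p) ^ p], hence [C ^ p p!]. *)
Lemma exists_cutoffs (a : R) : 0 < a -> exists (c : nat -> R) (C : R), 0 < C /\
  forall p, exists T, [/\ tower T,
    (forall x, a <= `|x| -> T 0%N x = 0),
    (forall x, `|x| < a / 8 -> T 0%N x = 1),
    (forall n x, `|T n x| <= c n) &
    (forall n x, `|T (n + p)%N x| <= c n * (C ^+ p * p`!%:R))].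
Proof.
(* Zero beyond [3 a / 4] and one up to [a / 4]: a total smoothing of at most [a / 8] respects both
   requirements. *)
move=> a0; have [|T tT [Ta Tb]] := @exists_plateau (3 / 4 * a); first lra.
have [c hc] := tower_bounded tT Ta.
exists (fun n => 4 * c n), (32 / a); split; first by rewrite divr_gt0.
have c0 n : 0 <= c n by exact: le_trans (normr_ge0 _) (hc n 0).
move=> p; pose w := a / 8 / p.+1%:R.
have w0 : 0 < w by rewrite !divr_gt0.
have wp : w *+ p <= a / 8.
  have e : w *+ p = a / 8 * (p%:R / p.+1%:R) by rewrite -mulr_natr /w; ring.
  rewrite e -[leRHS]mulr1 ler_wpM2l//; first lra.
  by rewrite ler_pdivrMr// mul1r ler_nat.
have [T' [tT' T'a T'b T'c T'p]] := iterated_average p tT w0 Ta Tb.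
exists T'; split=> //.
- by move=> x ax; apply: T'a; lra.
- by move=> x ax; apply: T'b; lra.
- by move=> n x; apply: le_trans (T'c n _ (hc n) x) _; have := c0 n; lra.
- move=> n x; apply: le_trans (T'p n _ (hc n) x) _.
  rewrite -mulrA mulrCA ler_wpM2l//.
  rewrite -exprVn (_ : w^-1 = 8 / a * p.+1%:R); last first.
    by rewrite /w; field; rewrite gt_eqF//= addrC natr1.
  rewrite (_ : 32 / a = 8 / a * 4); last by field; rewrite gt_eqF.
  (* Divided by [p + 1], this bounds [(p + 1) ^ p] by [4 * 4 ^ p * p!]: hence the factor 4 in front
     of [c n] and the rate [32 / a = 4 * (8 / a)]. *)
  have := expnn_le_fact p.+1; rewrite expnSr factS expnS.
  rewrite [X in (_ <= X)%N](_ : _ = 4 * 4 ^ p * p`! * p.+1)%N; last by lia.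
  rewrite leq_pmul2r// -(ler_nat R) !natrM !natrX => h.
  rewrite (_ : 4 * _ = (8 / a) ^+ p * (4 * 4 ^+ p * p`!%:R)); last first.
    by rewrite [(8 / a * 4) ^+ p]exprMn; ring.
  rewrite [(8 / a * _) ^+ p]exprMn ler_wpM2l//.
  by rewrite exprn_ge0// divr_ge0// ltW.
Qed.

End SmoothCutoffs.

(** * Exponentials on the unit circle and nearest integers *)

Section Exponentials.
Context {R : realType}.
Local Notation C := (complex R).

(* [exp (- i t)], with the sign used in [wave]. *)
Definition cis (t : R) : C := (cos t -i* sin t)%C.

Lemma cisD s t : cis (s + t) = cis s * cis t.
Proof.
apply/eqP; rewrite eq_complex /= cosD sinD.
by apply/andP; split; apply/eqP; ring.
Qed.

Lemma cis0 : cis 0 = 1.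
Proof. by rewrite /cis cos0 sin0 oppr0. Qed.

Lemma cmod_cis t : cmod (cis t) = 1.
Proof. by rewrite cmodE /= sqrrN cos2Dsin2 sqrtr1. Qed.

Lemma cisNK t : cis (- t) * cis t = 1.
Proof. by rewrite -cisD addNr cis0. Qed.

Lemma cisMn t n : cis (t * n%:R) = cis t ^+ n.
Proof.
elim: n => [|n IH]; first by rewrite mulr0 cis0 expr0.
by rewrite exprSr -IH -natr1 mulrDr mulr1 cisD.
Qed.

Lemma cis_2pi_int (m : int) : cis (2 * pi * m%:~R) = 1.
Proof.
have h : cis (2 * pi) = 1.
  by rewrite /cis mulr_natl cos2pi sin2pi oppr0.
case: m => n; first by rewrite -pmulrn cisMn h expr1n.
rewrite NegzE rmorphN mulrN -[LHS]mulr1.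
by rewrite -[X in _ * X](expr1n _ n.+1) -h -cisMn cisNK.
Qed.

(** [sin y - y cos y] has derivative [y sin y >= 0], so [x cos x <= sin x], which suffices if
    [cos x >= 1 / 3]. Otherwise [sin x ^ 2 > 8 / 9], while [x / 3 < 2 / 3]. *)
Lemma sin_ge_third (x : R) : 0 <= x <= pi / 2 -> x / 3 <= sin x.
Proof.
move=> /andP[x0 xpi].
have [/andP[_ pi2] _] := @pihalf_02_cos_pihalf R.
have pi0 := @pi_gt0 R.
have sx0 : 0 <= sin x by apply: sin_ge0_pi; lra.
have xc : x * cos x <= sin x.
  pose g (y : R) := sin y - y * cos y.
  have dg (y : R) : is_derive y 1 g (y * sin y).
    have H := is_deriveM (is_derive_id y 1) (is_derive_cos y).
    have H' := is_deriveB (is_derive_sin y) H.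
    apply: (is_derive_eq H'); rewrite /GRing.scale /=; ring.
  have [z hz e] := MVT_everywhere dg x0.
  have : 0 <= g x - g 0.
    rewrite e subr0 !mulr_ge0//; first by lra.
    apply: sin_ge0_pi; lra.
  by rewrite /g sin0 mul0r subr0 subr0 subr_ge0.
have [c3|c3] := leP (1 / 3) (cos x).
  by apply: le_trans xc; rewrite ler_wpM2l//; lra.
have cx0 : 0 <= cos x by apply: cos_ge0_pihalf; lra.
have := @cos2Dsin2 _ x; nra.
Qed.

(** As [|1 - cis t| = 2 |sin (t / 2)|], this is [sin_ge_third] at half the angle. *)
Lemma cmod_1Bcis_ge (t : R) : `|t| <= pi -> `|t| / 3 <= cmod (1 - cis t).
Proof.
move=> tpi.
have e : cmod (1 - cis t) = 2 * `|sin (t / 2)|.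
  rewrite -[RHS]ger0_norm ?mulr_ge0// -sqrtr_sqr cmodE /=; congr Num.sqrt.
  rewrite exprMn real_normK ?num_real//.
  rewrite [in LHS](_ : t = t / 2 + t / 2); last by lra.
  rewrite cosD sinD; have := @cos2Dsin2 _ (t / 2).
  set c := cos _; set s := sin _ => h.
  have -> : s ^+ 2 = 1 - c ^+ 2 by rewrite -h; ring.
  have h' : s ^+ 2 = 1 - c ^+ 2 by rewrite -h; ring.
  have -> : (1 - (c * c - s * s)) ^+ 2 = (1 - (c ^+ 2 - s ^+ 2)) ^+ 2 by ring.
  have -> : (0 - - (s * c + c * s)) ^+ 2 = 4 * (s ^+ 2 * c ^+ 2) by ring.
  by rewrite h'; ring.
have [t0|t0] := leP 0 t.
  rewrite ger0_norm// in tpi *; rewrite e.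
  have h : t / 2 / 3 <= sin (t / 2) by apply: sin_ge_third; lra.
  by rewrite ger0_norm; lra.
rewrite ltr0_norm// in tpi *; rewrite e.
have h : - t / 2 / 3 <= sin (- t / 2) by apply: sin_ge_third; lra.
by rewrite -[sin _]opprK -sinN normrN -mulNr ger0_norm; lra.
Qed.

Definition rnd (t : R) : int := Num.floor (t + 1 / 2).

Lemma rndP t : `|t - (rnd t)%:~R| <= 1 / 2.
Proof.
have /andP[h1 h2] := mem_rg1_floor (t + 1 / 2).
by rewrite /rnd ler_norml; move: h1 h2; rewrite ?intrD; lra.
Qed.

Lemma rnd_unique (t : R) (m : int) : `|t - m%:~R| < 1 / 2 -> rnd t = m.
Proof.
move=> h; apply: floor_def; move: h; rewrite ltr_norml intrD; lra.
Qed.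

Lemma cis_eq1 (t : R) : cis (2 * pi * t) = 1 -> exists m : int, t = m%:~R.
Proof.
move=> h; exists (rnd t); apply/eqP; rewrite -subr_eq0.
set s := t - _; have hs : `|s| <= 1 / 2 by exact: rndP.
have pi0 := @pi_gt0 R.
have cs : cis (2 * pi * s) = 1.
  rewrite -[LHS]mulr1 -[X in _ * X](cis_2pi_int (rnd t)) -cisD -mulrDr /s subrK; exact: h.
have := @cmod_1Bcis_ge (2 * pi * s).
rewrite cs subrr cmod0 normrM (gtr0_norm (_ : 0 < 2 * pi)); last by lra.
move=> /(_ ltac:(nra)) => h'; rewrite -normr_le0.
by have := normr_ge0 s; nra.
Qed.

Lemma cder_cis (b u : R) :
  cder u 1 (fun v : R => cis (b * v)) ((0 -i* b)%C * cis (b * u)).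
Proof.
have hc : is_derive u 1 (fun v : R => cos (b * v)) (b * - sin (b * u)).
  have := is_derive_affine b 0 u (@is_derive_cos R); rewrite addr0.
  by under eq_fun do rewrite addr0.
have hs : is_derive u 1 (fun v : R => sin (b * v)) (b * cos (b * u)).
  have := is_derive_affine b 0 u (@is_derive_sin R); rewrite addr0.
  by under eq_fun do rewrite addr0.
split; first by apply: (is_derive_eq hc) => /=; ring.
have H := is_deriveN hs; apply: (is_derive_eq H) => /=; ring.
Qed.

Definition ctower (T : nat -> R -> C) := forall n (u : R), cder u 1 (T n) (T n.+1 u).

Lemma ctower_Re T : ctower T -> tower (fun n u => complex.Re (T n u)).
Proof. by move=> h n u; exact: (h n u).1. Qed.

Lemma ctower_Im T : ctower T -> tower (fun n u => complex.Im (T n u)).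
Proof. by move=> h n u; exact: (h n u).2. Qed.

Lemma towers_ctower (A B : nat -> R -> R) : tower A -> tower B ->
  ctower (fun n u => (A n u +i* B n u)%C).
Proof. by move=> tA tB n u; split; [exact: tA|exact: tB]. Qed.

Lemma ctowerB S T : ctower S -> ctower T -> ctower (fun n u => S n u - T n u).
Proof.
move=> tS tT n u.
have := cderD (tS n u) (cderM (cder_cst u 1 (-1)) (tT n u)).
rewrite mul0r add0r mulN1r (_ : (fun y => S n y + -1 * T n y) = (fun y => S n y - T n y))//.
by apply/funext => y; rewrite mulN1r.
Qed.

End Exponentials.

(** * Decay of discrete Fourier coefficients by summation by parts *)

Section TrigonometricInterpolation.
Context {R : realType}.
Local Notation C := (complex R).
Implicit Types (f : R -> R) (T : nat -> R -> R).

(* The grid of mesh [1 / (2 n + 1)], read on [-1, 1]: [grid n l] corresponds to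
   the integer [l - (2 n + 1)]. *)
Definition mesh (n : nat) : R := (2 * n).+1%:R.
Definition grid (n l : nat) : R := (l%:R - mesh n) / mesh n.

Definition gridsum f (t : R) (n : nat) : C :=
  \sum_(l < 2 * (2 * n).+1) (f (grid n l))%:C%C * cis (t * grid n l).

(** Riemann sum for a Fourier coefficient of [f u exp (- 2 pi i eta u)], with [f] supported near 0.
    The nodes fill [-1, 1], two periods, which leaves room for the support that forward differences
    push to the left. *)
Definition coef f (eta : R) (n : nat) (k : R) : C :=
  ((mesh n)^-1)%:C%C * gridsum f (2 * pi * (eta - k)) n.

Lemma mesh_gt0 n : 0 < mesh n.
Proof. by rewrite ltr0n. Qed.

Lemma meshE n : mesh n = 2 * n%:R + 1.
Proof. by rewrite /mesh -[(2 * n).+1%:R]natr1 natrM. Qed.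

Lemma grid0 n : grid n 0 = -1.
Proof. by rewrite /grid sub0r mulNr mulfV// gt_eqF// mesh_gt0. Qed.

Lemma grid_last n : grid n (2 * (2 * n).+1) = 1.
Proof.
rewrite /grid natrM -/(mesh n) (_ : 2%:R * mesh n - mesh n = mesh n); last by ring.
by rewrite mulfV// gt_eqF// mesh_gt0.
Qed.

Lemma gridS n l : grid n l.+1 = grid n l + (mesh n)^-1.
Proof. by rewrite /grid -natr1; field; rewrite gt_eqF// mesh_gt0. Qed.

(** Summation by parts: the boundary terms drop out because [f] vanishes at both ends of the
    grid. *)
Lemma gridsum_diff f t n : f (-1) = 0 -> f 1 = 0 ->
  gridsum (fun u => f (u + (mesh n)^-1) - f u) t n =
  (cis (- (t / mesh n)) - 1) * gridsum f t n.
Proof.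
move=> f0 f1; rewrite /gridsum.
pose g l : C := (f (grid n l))%:C%C * cis (t * grid n l).
have shift : \sum_(l < 2 * (2 * n).+1) g l.+1 = \sum_(l < 2 * (2 * n).+1) g l.
  have e1 : \sum_(l < (2 * (2 * n).+1).+1) g l = \sum_(l < 2 * (2 * n).+1) g l.+1.
    by rewrite big_ord_recl /g /= grid0 f0 mul0r add0r.
  by rewrite -e1 big_ord_recr /g /= grid_last f1 mul0r addr0.
rewrite mulrBl mul1r -{1}shift mulr_sumr -sumrB; apply: eq_bigr => l _.
rewrite /g gridS rmorphB mulrBl /=; congr (_ - _).
rewrite [RHS]mulrCA; congr (_ * _); rewrite -cisD; congr cis.
by field; rewrite gt_eqF// mesh_gt0.
Qed.

(** Each summation by parts trades a factor [1 - cis] for a forward difference, which is at most a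
    derivative divided by [mesh n]. It also moves the support one mesh to the left, whence the
    condition on [s]. *)
Lemma gridsum_bound T (t s b c : R) (n M : nat) : tower T ->
  (forall u : R, u <= - s \/ b <= u -> T 0%N u = 0) ->
  s + M%:R / mesh n <= 1 -> b <= 1 -> (forall u, `|T M u| <= c) ->
  cmod (1 - cis (t / mesh n)) ^+ M * cmod (gridsum (T 0%N) t n) <=
    2 * mesh n * (c / mesh n ^+ M).
Proof.
have N0 := mesh_gt0 n.
elim: M T s c => [|M IH] T s c tT hT hs hb hc.
  rewrite expr0 mul1r expr0 divr1.
  apply: le_trans (cmod_sum _ _ _) _.
  apply: (@le_trans _ _ (\sum_(l < 2 * (2 * n).+1) c)).
    by apply: ler_sum => l _; rewrite cmodM cmod_real cmod_cis mulr1.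
  by rewrite sumr_const card_ord -[c *+ _]mulr_natl natrM.
pose T' m u := T m (u + (mesh n)^-1) - T m u.
have hi : 0 < (mesh n)^-1 by rewrite invr_gt0.
have tT' : tower T'.
  move=> m u; have h := is_derive_affine 1 (mesh n)^-1 u (tT m).
  have h1 : is_derive u 1 (fun v : R => T m (v + (mesh n)^-1)) (T m.+1 (u + (mesh n)^-1)).
    by move: h; rewrite !mul1r; under eq_fun do rewrite mul1r.
  exact: is_deriveB.
have /(IH T') H : forall u, `|T' M u| <= c / mesh n.
  move=> u; apply: le_trans (derive_lipschitz (tT M) hc _ _) _.
  by rewrite addrC addKr gtr0_norm.
have {}H := H (s + (mesh n)^-1) tT' _ _ hb.
have e : gridsum (T' 0%N) t n = (cis (- (t / mesh n)) - 1) * gridsum (T 0%N) t n.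
  have s1 : s <= 1 by apply: le_trans hs; rewrite lerDl divr_ge0// ltW.
  by apply: gridsum_diff; apply: hT; [left; lra|right; lra].
have e2 : cmod (cis (- (t / mesh n)) - 1) = cmod (1 - cis (t / mesh n)).
  have -> : cis (- (t / mesh n)) - 1 = cis (- (t / mesh n)) * (1 - cis (t / mesh n)).
    by rewrite mulrBr mulr1 cisNK.
  by rewrite cmodM cmod_cis mul1r.
rewrite exprSr -mulrA -e2 -cmodM -e e2; apply: le_trans (H _ _) _.
- move=> u; rewrite /T'; move: (mesh n)^-1 hi => h h0 [hu|hu];
    rewrite (hT u) ?(hT (u + h)) ?subrr//.
  + left; lra.
  + left; lra.
  + right; lra.
  + right; lra.
- by apply: le_trans hs; rewrite -[M.+1%:R]natr1 mulrDl mul1r addrA addrAC.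
- by rewrite exprS invfM !mulrA.
Qed.

(** Up to [|eta - k| = mesh n / 2] the angle stays in [-pi, pi], where [1 - cis] is bounded below;
    farther away aliasing would spoil the decay. The loss of 1/3 is covered by [2 pi], and
    [2 * M <= n] keeps the shifted support inside the grid. *)
Lemma coef_bound T (eta k c : R) (n M : nat) : tower T ->
  (forall u : R, 1 / 8 <= `|u| -> T 0%N u = 0) ->
  (2 * M <= n)%N -> `|eta - k| <= mesh n / 2 -> (forall u, `|T M u| <= c) ->
  `|eta - k| ^+ M * cmod (coef (T 0%N) eta n k) <= 2 * c.
Proof.
move=> tT hT Mn hk hc; have N0 := mesh_gt0 n; have pi2 := @pi_ge2 R.
have pi0 := @pi_gt0 R.
have et : `|2 * pi * (eta - k) / mesh n| = 2 * pi * (`|eta - k| / mesh n).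
  rewrite normrM normfV (gtr0_norm N0) normrM (gtr0_norm (_ : 0 < 2 * pi)); last lra.
  by rewrite mulrA.
have hq : `|eta - k| / mesh n <= 1 / 2.
  by rewrite ler_pdivrMr// (le_trans hk)// [leRHS]mulrC div1r.
have q0 : 0 <= `|eta - k| / mesh n by rewrite divr_ge0// ltW.
have hcis : `|eta - k| / mesh n <= cmod (1 - cis (2 * pi * (eta - k) / mesh n)).
  apply: le_trans (cmod_1Bcis_ge _); rewrite et.
    move: (_ / mesh n) q0 hq => q q0 hq; clear - pi2 q0; nra.
  move: (_ / mesh n) q0 hq => q q0 hq; clear - pi2 q0 hq; nra.
rewrite /coef cmodM cmod_real [`|_^-1|]gtr0_norm ?invr_gt0//.
rewrite [leLHS]mulrCA ler_pdivrMl//.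
apply: (@le_trans _ _ ((mesh n ^+ M) * (2 * mesh n * (c / mesh n ^+ M)))); last first.
  by rewrite le_eqVlt; apply/orP; left; apply/eqP; field; rewrite expf_neq0// gt_eqF.
apply: le_trans (_ : mesh n ^+ M * (cmod (1 - cis (2 * pi * (eta - k) / mesh n)) ^+ M *
  cmod (gridsum (T 0%N) (2 * pi * (eta - k)) n)) <= _).
  rewrite mulrA -exprMn ler_wpM2r ?cmod_ge0// lerXn2r ?nnegrE ?normr_ge0//.
    by rewrite mulr_ge0 ?cmod_ge0// ltW.
  by rewrite mulrC -ler_pdivrMr.
rewrite ler_wpM2l//; first by rewrite exprn_ge0// ltW.
apply: (@gridsum_bound T _ (1 / 8) (1 / 8)) => //.
- move=> u [h|h]; apply: hT; first by rewrite ler_normr; apply/orP; right; lra.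
  by rewrite ler_normr; apply/orP; left; lra.
- have : M%:R / mesh n <= 1 / 2.
    rewrite ler_pdivrMr// meshE; move: Mn; rewrite -(ler_nat R) natrM; lra.
  move: (_ / mesh n) => r hr; lra.
- by lra.
Qed.

Lemma coef_decay T (b0 bq eta k : R) (n q : nat) : tower T ->
  (forall u : R, 1 / 8 <= `|u| -> T 0%N u = 0) ->
  (2 * q <= n)%N -> `|eta - k| <= mesh n / 2 ->
  (forall u, `|T 0%N u| <= b0) -> (forall u, `|T q u| <= bq) ->
  (1 + `|eta - k|) ^+ q * cmod (coef (T 0%N) eta n k) <= 2 ^+ q.+1 * (b0 + bq).
Proof.
move=> tT hT qn hk hb0 hbq.
have h0 := @coef_bound T eta k _ n 0 tT hT (leq0n _) hk hb0.
have hq := @coef_bound T eta k _ n q tT hT qn hk hbq.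
rewrite expr0 mul1r in h0.
have t0 := normr_ge0 (eta - k); set t := `|eta - k| in t0 hq *.
have c0 := cmod_ge0 (coef (T 0%N) eta n k).
set z := cmod _ in h0 hq c0 *.
have h : (1 + t) ^+ q <= 2 ^+ q * (1 + t ^+ q).
  have [t1|t1] := leP t 1.
    apply: (@le_trans _ _ (2 ^+ q)); first by rewrite lerXn2r ?nnegrE; lra.
    by rewrite ler_peMr ?exprn_ge0// lerDl exprn_ge0.
  apply: (@le_trans _ _ (2 ^+ q * t ^+ q)).
    by rewrite -exprMn lerXn2r ?nnegrE; lra.
  by rewrite ler_wpM2l ?exprn_ge0// lerDr.
apply: le_trans (ler_wpM2r c0 h) _.
rewrite exprSr -!mulrA ler_wpM2l ?exprn_ge0// mulrDl mul1r; lra.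
Qed.

End TrigonometricInterpolation.

(** * The interpolating trigonometric polynomial *)

Section InterpolationConvergence.
Context {R : realType}.
Local Notation C := (complex R).
Local Notation mesh := (@mesh R).
Local Notation grid := (@grid R).
Implicit Types (f : R -> R) (T : nat -> R -> R) (eta u : R).

Definition freq eta (n r : nat) : int := rnd eta - n%:Z + r%:Z.

(* The [j]-th derivative of the trigonometric polynomial that interpolates the
   periodized [f u exp (- 2 pi i eta u)] on the mesh. The window of frequencies
   is centred at [eta], so that [`|eta - k|] is at most half the number of nodes
   and summation by parts controls [coef f eta n k] for every [k] in it. *)
Definition trig f eta (n j : nat) u : C :=
  \sum_(r < (2 * n).+1) coef f eta n (freq eta n r)%:~R *
    ((0 -i* (2 * pi * (freq eta n r)%:~R))%C ^+ j *
     cis (2 * pi * (freq eta n r)%:~R * u)).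

Lemma freqE eta n r :
  (freq eta n r)%:~R = (rnd eta)%:~R - n%:R + r%:R :> R.
Proof. by rewrite /freq !rmorphD rmorphN /= -!pmulrn. Qed.

Lemma freq_near eta n r : (r < (2 * n).+1)%N ->
  `|eta - (freq eta n r)%:~R| <= mesh n / 2 /\
  1 / 2 + `|r%:R - n%:R| <= 1 + `|eta - (freq eta n r)%:~R|.
Proof.
move=> rn; rewrite freqE meshE; have h := rndP eta.
set x := eta - _ in h.
have -> : eta - ((rnd eta)%:~R - n%:R + r%:R) = x - (r%:R - n%:R) by rewrite /x; ring.
have h2 : `|r%:R - n%:R| <= n%:R :> R.
  rewrite ler_norml; have : (r%:R : R) <= 2%:R * n%:R by rewrite -natrM ler_nat -ltnS.
  have : 0 <= r%:R :> R by [].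
  by move=> a b; apply/andP; split; lra.
move: (r%:R - n%:R) h2 => y h2; split.
  by apply: le_trans (ler_normB _ _) _; lra.
have := ler_normB (x) (x - y); rewrite opprB addrC subrK; lra.
Qed.

(** The bound is made to telescope: it equals 4 for [n = 0], and the next window adds two end terms
    at distance [m = n + 1], each at most [1 / m - 1 / (m + 1)]. *)
Lemma sum_weights_aux n :
  \sum_(r < (2 * n).+1) (1 / 2 + `|r%:R - n%:R|) ^- 2 <= 6 - 2 / n.+1%:R :> R.
Proof.
pose F (n r : nat) : R := (1 / 2 + `|r%:R - n%:R|) ^- 2.
rewrite -[X in X <= _]/(\sum_(r < (2 * n).+1) F n r).
elim: n => [|n IH].
  by rewrite big_ord1 /F subrr normr0 addr0 -exprVn; lra.
rewrite (_ : 2 * n.+1 = (2 * n).+2)%N; last by lia.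
rewrite big_ord_recl big_ord_recr /=.
have e : \sum_(i < (2 * n).+1) F n.+1 (bump 0 (widen_ord (leqnSn (2 * n).+1) i))
    = \sum_(i < (2 * n).+1) F n i.
  apply: eq_bigr => i _; rewrite /F /bump /= add1n; congr ((_ + `|_|) ^- 2).
  by rewrite -[i.+1%:R]natr1 -[n.+1%:R]natr1; ring.
rewrite e; move: (\sum_(_ < _) _) IH => S IH; rewrite /F /bump /= add1n.
rewrite sub0r normrN normr_nat.
have -> : `|(2 * n).+2%:R - n.+1%:R| = n.+1%:R :> R.
  rewrite -natrB; last by lia.
  by rewrite normr_nat; congr (_%:R); lia.
set m : R := n.+1%:R; have m0 : 1 <= m by rewrite ler1n.
have -> : n.+2%:R = m + 1 :> R by rewrite natr1.
have h : (1 / 2 + m) ^- 2 <= m^-1 - (m + 1)^-1.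
  have -> : m^-1 - (m + 1)^-1 = (m * (m + 1))^-1 by field; rewrite !gt_eqF//; lra.
  rewrite lef_pV2 ?posrE; [nra|rewrite exprn_gt0//; lra|rewrite mulr_gt0//; lra].
move: IH h; rewrite -/m.
move: (_ ^- 2) (m^-1) ((m + 1)^-1) => x y z; lra.
Qed.

Lemma sum_weights eta n :
  \sum_(r < (2 * n).+1) (1 + `|eta - (freq eta n r)%:~R|) ^- 2 <= 6.
Proof.
apply: le_trans (_ : \sum_(r < (2 * n).+1) (1 / 2 + `|r%:R - n%:R|) ^- 2 <= _).
  apply: ler_sum => r _; have [_ h] := freq_near eta (ltn_ord r).
  have := normr_ge0 (r%:R - n%:R : R) => h0.
  rewrite lef_pV2 ?posrE ?exprn_gt0//; try lra.
  by rewrite lerXn2r ?nnegrE//; lra.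
apply: le_trans (sum_weights_aux n) _; have : 0 <= 2 / n.+1%:R :> R by [].
by move: (_ / _) => x; lra.
Qed.

Lemma ctower_trig f eta n : ctower (trig f eta n).
Proof.
move=> j u; rewrite /trig; apply: cder_sum => r.
set c := coef _ _ _ _; set b := 2 * pi * _.
have := cderM (cder_cst u 1 (c * (0 -i* b)%C ^+ j)) (cder_cis b u).
rewrite mul0r add0r -mulrA (mulrA _ _ (cis _)) -exprSr.
by under eq_fun do rewrite -mulrA.
Qed.

Lemma grid_inj n : injective (grid n).
Proof.
move=> l l' /(congr1 (fun x => x * mesh n + mesh n)).
rewrite /grid !divfK ?gt_eqF ?mesh_gt0// !subrK => /eqP.
by rewrite eqr_nat => /eqP.
Qed.

(** A geometric sum over all powers of a root of unity of order dividing [2 n + 1] and different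
    from 1. *)
Lemma sum_cis_window eta n (s : int) :
  (forall z : int, s%:~R / mesh n != z%:~R) ->
  \sum_(r < (2 * n).+1) cis (2 * pi * (freq eta n r)%:~R * (s%:~R / mesh n)) = 0 :> C.
Proof.
move=> hs; pose z : C := cis (2 * pi * (s%:~R / mesh n)).
have z1 : z - 1 != 0.
  by rewrite subr_eq0; apply/eqP => /cis_eq1[m e]; move: (hs m); rewrite e eqxx.
have zN : z ^+ (2 * n).+1 = 1.
  rewrite /z -cisMn -/(mesh n) -!mulrA mulVf ?gt_eqF ?mesh_gt0// mulr1 mulrA.
  exact: cis_2pi_int.
apply: (mulfI z1); rewrite mulr0.
have -> : \sum_(r < (2 * n).+1) cis (2 * pi * (freq eta n r)%:~R * (s%:~R / mesh n)) =
  cis (2 * pi * (rnd eta - n%:Z)%:~R * (s%:~R / mesh n)) * \sum_(r < (2 * n).+1) z ^+ r.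
  rewrite mulr_sumr; apply: eq_bigr => r _.
  rewrite /z -cisMn -cisD; congr cis; rewrite /freq [in LHS]rmorphD /= -pmulrn; ring.
by rewrite mulrCA -subrX1 zN subrr mulr0.
Qed.

(** For [f] vanishing outside (-1/8, 1/8) this is the sum of all integer translates of
    [f u exp (- 2 pi i eta u)], written without a sum. *)
Definition periodized f eta u : C :=
  (f (u - (rnd u)%:~R))%:C%C * cis (2 * pi * eta * (u - (rnd u)%:~R)).

(** Discrete Fourier inversion: once the sums are exchanged, node [l] contributes only if it is
    congruent to the evaluation point modulo 1. The grid contains two such nodes, of which the
    support condition leaves at most the one equal to [v]. *)
Lemma trig_interpolates f eta n (q : int) :
  (forall u : R, 1 / 8 <= `|u| -> f u = 0) ->
  trig f eta n 0 (q%:~R / mesh n) = periodized f eta (q%:~R / mesh n).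
Proof.
move=> hf; have N0 := @mesh_gt0 R n; have Nn0 : mesh n != 0 :> R by rewrite gt_eqF.
pose I l : C := \sum_(r < (2 * n).+1)
  cis (2 * pi * (freq eta n r)%:~R * (q%:~R / mesh n - grid n l)).
have -> : trig f eta n 0 (q%:~R / mesh n) = \sum_(l < 2 * (2 * n).+1)
    (f (grid n l))%:C%C * cis (2 * pi * eta * grid n l) * (((mesh n)^-1)%:C%C * I l).
  rewrite /trig /coef /gridsum /I.
  under eq_bigr => r _ do rewrite expr0 mul1r mulr_sumr mulr_suml.
  rewrite exchange_big; apply: eq_bigr => l _ /=.
  rewrite !mulr_sumr; apply: eq_bigr => r _.
  rewrite (_ : 2 * pi * (eta - _) * _ = 2 * pi * eta * grid n l -
    2 * pi * (freq eta n r)%:~R * grid n l); last by ring.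
  rewrite (mulrBr (2 * pi * (freq eta n r)%:~R)) !cisD; ring.
have gl l : q%:~R / mesh n - grid n l = (q - l%:Z + (2 * n).+1%:Z)%:~R / mesh n.
  rewrite /grid rmorphD rmorphB /= -!pmulrn -/(mesh n) ; by field.
pose v : R := q%:~R / mesh n - (rnd (q%:~R / mesh n))%:~R.
have hv : `|v| <= 1 / 2 by exact: rndP.
have sing l : f (grid n l) != 0 -> I l != 0 -> grid n l = v.
  move=> fl Il; have gl8 : `|grid n l| < 1 / 8.
    by rewrite ltNge; apply/negP => /hf fl0; rewrite fl0 eqxx in fl.
  have [z hz] : exists z : int, q%:~R / mesh n - grid n l = z%:~R.
    apply: contrapT => hn; move/eqP: Il; apply; rewrite /I.
    under eq_bigr => r _ do rewrite gl.
    apply: sum_cis_window => z; apply/eqP => e; apply: hn; exists z.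
    by rewrite gl.
  have gE : grid n l = q%:~R / mesh n - z%:~R by rewrite -hz; ring.
  rewrite gE in gl8 *; rewrite /v; congr (_ - _); congr (_%:~R); apply/esym.
  by apply: rnd_unique; apply: lt_trans gl8 _; lra.
have [l0 hl0] : exists l0 : 'I_(2 * (2 * n).+1), grid n l0 = v.
  pose m : int := q - (2 * n).+1%:Z * rnd (q%:~R / mesh n).
  have vm : v = m%:~R / mesh n.
    rewrite /v /m rmorphB rmorphM /= -pmulrn -/(mesh n) mulrBl; congr (_ - _).
    by rewrite mulrAC mulfV// mul1r.
  have hm : `|m%:~R| <= mesh n / 2 :> R.
    move: hv; rewrite vm normrM normfV (gtr0_norm N0) ler_pdivrMr//.
    by rewrite mulrC div1r.
  have hm2 : `|m| <= (2 * n).+1%:Z.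
    rewrite -(ler_int R) intr_norm (le_trans hm)// -pmulrn -/(mesh n); lra.
  have hm3 : `|m| < (2 * n).+1%:Z.
    rewrite -(ltr_int R) intr_norm (le_lt_trans hm)// -pmulrn -/(mesh n); lra.
  have [l hl] : exists l : nat, m + (2 * n).+1%:Z = l%:Z.
    exists (absz (m + (2 * n).+1%:Z)); rewrite gez0_abs//; lia.
  have ll : (l < 2 * (2 * n).+1)%N by lia.
  exists (Ordinal ll); rewrite /grid /= vm; congr (_ / _).
  rewrite (_ : (l%:R : R) = (l%:Z)%:~R) // -hl rmorphD /= -pmulrn -/(mesh n); ring.
rewrite (bigD1 l0)//= big1 ?addr0; last first.
  move=> l ll0; have [->|fl] := eqVneq (f (grid n l)) 0; first by rewrite !mul0r.
  have [->|Il] := eqVneq (I l) 0; first by rewrite !mulr0.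
  exfalso; move/eqP: ll0; apply; apply: val_inj; apply: (@grid_inj n).
  by rewrite hl0; exact: sing.
rewrite hl0 /periodized -/v /I.
rewrite (eq_bigr (fun=> 1)) => [|r _]; last first.
  rewrite hl0 /v opprB addrCA subrr addr0 -mulrA -intrM; exact: cis_2pi_int.
rewrite sumr_const card_ord (_ : 1 *+ _ = (mesh n)%:C%C); last by rewrite rmorph_nat.
by rewrite -rmorphM /= mulVf// mulr1.
Qed.

End InterpolationConvergence.

(** * Convergence of the interpolants with all derivatives *)

Section PeriodizationLimit.
Context {R : realType}.
Local Notation C := (complex R).
Local Notation mesh := (@mesh R).
Implicit Types (f : R -> R) (A D T : nat -> R -> R) (eta u : R).

(** The jumps of [rnd] are at half-integers, where both candidate arguments of [A] lie outside the
    support; elsewhere [rnd] is locally constant. *)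
Lemma tower_periodization A : tower A ->
  (forall u, 1 / 8 <= `|u| -> A 0%N u = 0) ->
  tower (fun n u => A n (u - (rnd u)%:~R)).
Proof.
move=> tA hA n u.
have A0 m v : 1 / 8 < `|v| -> A m v = 0.
  by apply: tower_zero_outside => // w hw; apply: hA; exact: ltW.
set z := (rnd u)%:~R.
have h1 : is_derive u 1 (fun v : R => A n (v - z)) (A n.+1 (u - z)).
  have := is_derive_affine 1 (- z) u (tA n); rewrite !mul1r.
  by under eq_fun do rewrite mul1r.
apply: near_eq_is_derive h1.
have hu : `|u - z| <= 1 / 2 by exact: rndP.
near=> v.
have hv : `|v - u| < 1 / 4.
  by rewrite -normrN opprB; near: v; apply: nbhsx_ballx.
have hvz : `|v - z| < 3 / 4.
  rewrite (_ : v - z = (v - u) + (u - z)); last by ring.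
  by apply: le_lt_trans (ler_normD _ _) _; lra.
have [<- //|ne] := eqVneq (rnd u) (rnd v).
have ge1 : 1 <= `|(rnd v)%:~R - z|.
  rewrite -rmorphB /= -intr_norm -[1]/(1%:~R) ler_int; lia.
have hv' := rndP v.
have t1 : `|(rnd v)%:~R - z| <= `|v - z| + `|v - (rnd v)%:~R|.
  rewrite (_ : _ - z = (v - z) - (v - (rnd v)%:~R)); last by ring.
  exact: ler_normB.
by rewrite !A0//; lra.
Unshelve. all: by end_near. Qed.

Lemma sm1_cos_sin k : Ck_real k (@cos R) /\ Ck_real k (@sin R).
Proof.
elim: k => [//|k [IHc IHs]]; split.
  exists (fun x => -1 * sin x); last exact: sm1Z.
  by move=> x; rewrite mulN1r; exact: is_derive_cos.
by exists cos => // x; exact: is_derive_sin.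
Qed.

Lemma exists_periodization T eta : tower T ->
  (forall u, 1 / 8 <= `|u| -> T 0%N u = 0) ->
  exists (G : nat -> R -> C) (B : nat -> R), [/\ ctower G,
    forall n u, cmod (G n u) <= B n & forall u, G 0%N u = periodized (T 0%N) eta u].
Proof.
move=> tT hT.
pose w := 2 * pi * eta.
have [P tP P0] : exists2 P, tower P & P 0%N = (fun u => T 0%N u * cos (w * u + 0)).
  apply: sm1_tower => k; apply: sm1M; first exact: tower_sm1.
  by apply: sm1_affine; exact: (sm1_cos_sin k).1.
have [Q tQ Q0] : exists2 Q, tower Q & Q 0%N = (fun u => -1 * (T 0%N u * sin (w * u + 0))).
  apply: sm1_tower => k; apply: sm1Z; apply: sm1M; first exact: tower_sm1.
  by apply: sm1_affine; exact: (sm1_cos_sin k).2.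
have hP u : 1 / 8 <= `|u| -> P 0%N u = 0 by move=> h; rewrite P0 hT// mul0r.
have hQ u : 1 / 8 <= `|u| -> Q 0%N u = 0 by move=> h; rewrite Q0 hT// mul0r mulr0.
have [bP hbP] := tower_bounded tP (fun u h => hP u (ltW h)).
have [bQ hbQ] := tower_bounded tQ (fun u h => hQ u (ltW h)).
exists (fun n u => (P n (u - (rnd u)%:~R) +i* Q n (u - (rnd u)%:~R))%C).
exists (fun n => bP n + bQ n); split.
- by apply: towers_ctower; exact: tower_periodization.
- by move=> n u; apply: le_trans (cmod_le_ReIm _) _; rewrite lerD ?hbP ?hbQ.
- move=> u; rewrite P0 Q0 /periodized addr0; set v := u - _.
  by apply/eqP; rewrite eq_complex /= -/w; apply/andP; split; apply/eqP; ring.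
Qed.

(** Two adjacent intervals of length [h 2 ^ j] each contain a zero of [D j]; Rolle's theorem puts a
    zero of [D j.+1] between them. *)
Lemma tower_zeros D (h : R) : tower D -> 0 < h ->
  (forall q : int, D 0%N (q%:~R * h) = 0) ->
  forall j x, exists2 y, x <= y < x + h *+ (2 ^ j) & D j y = 0.
Proof.
move=> tD h0 hD; elim=> [|j IH] x.
  have /andP[] := mem_rg1_floor (- (x / h)); move: (Num.floor _) => m h1 h2.
  exists ((- m)%:~R * h); last exact: hD.
  rewrite expn0 mulr1n rmorphN /= -ler_pdivrMr//; apply/andP; split.
    by move: h1; lra.
  rewrite -{2}(mul1r h) -ltrBlDr -mulrBl -ltr_pdivlMr//.
  by move: h2; rewrite ?intrD; lra.
have [y1 /andP[a1 b1] z1] := IH x.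
have [y2 /andP[a2 b2] z2] := IH (x + h *+ (2 ^ j)).
have y12 : y1 < y2 by exact: lt_le_trans b1 a2.
have cD : {within `[y1, y2], continuous (D j)}.
  by apply: continuous_subspaceT; exact: is_derive_continuous (tD j).
have [y hy [_ e]] := Rolle y12 (fun z _ => @ex_derive _ _ _ _ _ _ _ (tD j z)) cD (etrans z1 (esym z2)).
exists y; last by have [_ <-] := tD j y.
move: hy; rewrite in_itv /= => /andP[h1 h2].
rewrite expnS mul2n -addnn mulrnDr addrA; apply/andP; split.
  by apply: ltW; exact: le_lt_trans h1.
exact: lt_trans b2.
Qed.

(** Of the [j + 2] derivatives spent, [j] pay for the factors [k ^ j] and two for the convergence of
    the sum. The point is that [c] is independent of [n]; it may depend on [eta]. *)
Lemma trig_bounded T (b : nat -> R) eta (j : nat) : tower T ->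
  (forall u, 1 / 8 <= `|u| -> T 0%N u = 0) ->
  (forall m u, `|T m u| <= b m) ->
  exists c, forall n u, (2 * j.+2 <= n)%N -> cmod (trig (T 0%N) eta n j u) <= c.
Proof.
move=> tT hT hb; have pi0 := @pi_ge0 R.
pose K := (2 * pi * (1 + `|eta|)) ^+ j * (2 ^+ j.+3 * (b 0%N + b j.+2)).
have b0 m : 0 <= b m by exact: le_trans (normr_ge0 _) (hb m 0).
have K1 : 0 <= (2 * pi * (1 + `|eta|)) ^+ j.
  by rewrite exprn_ge0// !mulr_ge0// addr_ge0.
have K0 : 0 <= K by rewrite mulr_ge0// mulr_ge0 ?exprn_ge0// addr_ge0.
exists (K * 6) => n u hn; apply: le_trans (cmod_sum _ _ _) _.
apply: (@le_trans _ _ (K * \sum_(r < (2 * n).+1) (1 + `|eta - (freq eta n r)%:~R|) ^- 2)).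
  rewrite mulr_sumr; apply: ler_sum => r _.
  have [hr _] := freq_near eta (ltn_ord r).
  have h := coef_decay tT hT hn hr (hb 0%N) (hb j.+2).
  rewrite cmodM cmodM cmod_cis mulr1 cmodX.
  set k := (freq eta n r)%:~R in hr h *; set t := `|eta - k| in hr h *.
  have t0 : 0 <= t by rewrite normr_ge0.
  have t1 : 0 < 1 + t by lra.
  rewrite ler_pdivlMr ?exprn_gt0//.
  have hk : cmod (0 -i* (2 * pi * k))%C <= 2 * pi * (1 + `|eta|) * (1 + t).
    rewrite cmodE /= expr0n add0r sqrtr_sqr normrN normrM ger0_norm ?mulr_ge0//.
    rewrite -mulrA ler_wpM2l ?mulr_ge0//.
    have hk : `|k| <= `|eta| + t.
      rewrite (_ : k = eta - (eta - k)); last by ring.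
      exact: ler_normB.
    by have := normr_ge0 eta; nra.
  have hkj := lerXn2r j (cmod_ge0 _) (_ : _ \is Num.nneg) hk.
  have {}hkj := hkj ltac:(rewrite nnegrE !mulr_ge0//; lra).
  apply: (@le_trans _ _ (cmod (coef (T 0%N) eta n k) *
    ((2 * pi * (1 + `|eta|) * (1 + t)) ^+ j * (1 + t) ^+ 2))).
    by rewrite -[leLHS]mulrA ler_wpM2l ?cmod_ge0// ler_wpM2r// exprn_ge0// ltW.
  rewrite (_ : _ * _ = (2 * pi * (1 + `|eta|)) ^+ j *
    ((1 + t) ^+ j.+2 * cmod (coef (T 0%N) eta n k))); last first.
    by rewrite -[j.+2]addn2 exprD [X in _ * (X * _)]exprMn; ring.
  by rewrite /K ler_wpM2l.
by rewrite ler_wpM2l// sum_weights.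
Qed.

(** The error vanishes at every node, so each part of its [j]-th derivative vanishes within [2 ^ j]
    meshes of any point, and the bounded next derivative makes it O(1 / mesh). Rolle's theorem is
    real, hence the separate treatment of real and imaginary parts. *)
Lemma trig_cvg T (G : nat -> R -> C) (b B : nat -> R) eta (j : nat) (e : R) :
  tower T -> (forall u, 1 / 8 <= `|u| -> T 0%N u = 0) ->
  (forall m u, `|T m u| <= b m) ->
  ctower G -> (forall n u, cmod (G n u) <= B n) ->
  (forall u, G 0%N u = periodized (T 0%N) eta u) -> 0 < e ->
  exists n0, forall n u, (n0 <= n)%N -> cmod (trig (T 0%N) eta n j u - G j u) <= e.
Proof.
move=> tT hT hb tG hB G0 e0.
have [c hc] := trig_bounded eta j.+1 tT hT hb.
pose M := `|c + B j.+1|.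
pose K := M * (2 ^ j)%:R.
have K0 : 0 <= K by rewrite mulr_ge0 ?normr_ge0.
have [n0 hn0] : exists n0 : nat, 2 * K / e < n0%:R.
  by exists (Num.truncn (2 * K / e)).+1; exact: truncnS_gt.
exists (maxn (2 * j.+3) n0) => n u; rewrite geq_max => /andP[hn1 hn2].
pose Dn m v := trig (T 0%N) eta n m v - G m v.
have tD : ctower Dn by apply: ctowerB => //; exact: ctower_trig.
have D1 v : cmod (Dn j.+1 v) <= M.
  apply: (le_trans (cmodB _ _)); apply: (le_trans _ (ler_norm _)).
  by apply: lerD; [exact: hc|exact: hB].
have D0 (q : int) : Dn 0%N (q%:~R * (mesh n)^-1) = 0.
  by rewrite /Dn G0 trig_interpolates// subrr.
have N0 := @mesh_gt0 R n.
have h0 : 0 < (mesh n)^-1 by rewrite invr_gt0.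
have key D : tower D -> (forall v, `|D j.+1 v| <= M) ->
    (forall q : int, D 0%N (q%:~R * (mesh n)^-1) = 0) -> `|D j u| <= K / mesh n.
  move=> tD' D1' D0'.
  have [y /andP[y1 y2] zy] := tower_zeros tD' h0 D0' j u.
  have := derive_lipschitz (tD' j) D1' u y; rewrite zy sub0r normrN => hl.
  apply: le_trans hl _; rewrite /K -mulrA ler_wpM2l ?normr_ge0//.
  by rewrite ger0_norm ?subr_ge0// lerBlDl mulrC mulr_natr ltW.
have hK : K / mesh n <= e / 2.
  have : 2 * K / e <= mesh n.
    apply: (le_trans (ltW hn0)); rewrite meshE.
    by move: hn2; rewrite -(ler_nat R); have := ler0n R n; lra.
  by rewrite !ler_pdivrMr//; lra.
rewrite -/(Dn j u); apply: le_trans (cmod_le_ReIm _) _.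
rewrite (splitr e); apply: lerD; apply: (le_trans _ hK).
  apply: (key _ (ctower_Re tD)) => [v|q]; last by rewrite D0.
  exact: le_trans (Re_le_cmod _) (D1 v).
apply: (key _ (ctower_Im tD)) => [v|q]; last by rewrite D0.
exact: le_trans (Im_le_cmod _) (D1 v).
Qed.

End PeriodizationLimit.

(** * Products of one-variable functions of linear forms *)

Section TensorProducts.
Context {R : realType} {d : nat}.
Local Notation C := (complex R).
Local Notation E := 'rV[R]_d.
Local Notation e_ j := (delta_mx 0 j : 'rV[R]_d).
Implicit Types (x y beta xi : E) (W : set E).

Lemma dotvC x y : dotv x y = dotv y x.
Proof. by apply: eq_bigr => i _; rewrite mulrC. Qed.

Lemma dotvDl x y beta : dotv (x + y) beta = dotv x beta + dotv y beta.
Proof. by rewrite -big_split; apply: eq_bigr => i _; rewrite !mxE mulrDl. Qed.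

Lemma dotvZl (a : R) x beta : dotv (a *: x) beta = a * dotv x beta.
Proof. by rewrite /dotv mulr_sumr; apply: eq_bigr => i _; rewrite !mxE mulrA. Qed.

Lemma dotvNl x beta : dotv (- x) beta = - dotv x beta.
Proof. by rewrite -scaleN1r dotvZl mulN1r. Qed.

Lemma dotvBl x y beta : dotv (x - y) beta = dotv x beta - dotv y beta.
Proof. by rewrite dotvDl dotvNl. Qed.

Lemma dotv_delta j beta : dotv (e_ j) beta = beta 0 j.
Proof.
rewrite /dotv (bigD1 j)//= big1 ?addr0 => [|i ij]; first by rewrite mxE !eqxx mul1r.
by rewrite mxE (negbTE ij) andbF mul0r.
Qed.

Lemma dotv_mulmx (v : E) (B : 'M[R]_d) x :
  dotv x (v *m B) = \sum_j v 0 j * dotv x (row j B).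
Proof.
rewrite /dotv; under eq_bigr do rewrite mxE mulr_sumr.
rewrite exchange_big; apply: eq_bigr => j _ /=; rewrite mulr_sumr.
by apply: eq_bigr => i _; rewrite mxE; ring.
Qed.

Lemma dotv_continuous beta : continuous (fun x => dotv x beta : R).
Proof.
apply: continuous_big; first exact: add_continuous.
by move=> i _ x; apply: (@continuousM _ _ (fun x : E => x 0 i) (cst (beta 0 i)));
  [exact: coord_continuous|exact: cst_continuous].
Qed.

Definition lin (x0 beta x : E) : R := dotv (x - x0) beta.

Lemma lin_continuous x0 beta : continuous (lin x0 beta).
Proof.
move=> x; rewrite (_ : lin x0 beta = (fun x => dotv x beta) - cst (dotv x0 beta)).
  by apply: continuousB; [exact: dotv_continuous|exact: cst_continuous].
by apply/funext => y; rewrite /lin dotvBl.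
Qed.

(** Along [v] the difference quotient is that of the one-variable function [t |-> f (b * t + a)] at
    0. *)
Lemma is_derive_lin (f df : R -> R) x0 beta x v :
  (forall u : R, is_derive u 1 f (df u)) ->
  is_derive x v (fun y => f (lin x0 beta y)) (dotv v beta * df (lin x0 beta x)).
Proof.
move=> h; set b := dotv v beta; set a := lin x0 beta x.
have H := is_derive_affine b a 0 h; rewrite mulr0 add0r in H.
have e : (fun k : R => k^-1 *: (f (lin x0 beta (k *: v + x)) - f a)) =
    (fun k : R => k^-1 *: (f (b * (k *: 1 + 0) + a) - f (b * 0 + a))).
  apply/funext => k; rewrite mulr0 add0r addr0 [k *: 1]mulr1; congr (_ *: (f _ - _)).
  by rewrite /lin -addrA dotvDl dotvZl -/a mulrC.
case: H => H1 H2; apply: DeriveDef.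
  by move: H1; rewrite /derivable /= -e.
by move: H2; rewrite /derive /= -e.
Qed.

Lemma cder_lin (T : nat -> R -> C) n x0 beta x j : ctower T ->
  cder x (e_ j) (fun y => T n (lin x0 beta y))
    ((beta 0 j)%:C%C * T n.+1 (lin x0 beta x)).
Proof.
move=> tT; have h1 := is_derive_lin x0 beta x (e_ j) (ctower_Re tT n).
have h2 := is_derive_lin x0 beta x (e_ j) (ctower_Im tT n).
rewrite dotv_delta in h1 h2; split.
  by apply: (is_derive_eq h1); case: (T n.+1 _) => a b /=; ring.
by apply: (is_derive_eq h2); case: (T n.+1 _) => a b /=; ring.
Qed.

Lemma ccont_lin (T : nat -> R -> C) n x0 beta x : ctower T ->
  ccont (fun y => T n (lin x0 beta y)) x.
Proof.
move=> tT; split.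
  apply: (@continuous_comp _ _ _ (lin x0 beta) (fun u => complex.Re (T n u))).
    exact: lin_continuous.
  exact: (is_derive_continuous (ctower_Re tT n)).
apply: (@continuous_comp _ _ _ (lin x0 beta) (fun u => complex.Im (T n u))).
  exact: lin_continuous.
exact: (is_derive_continuous (ctower_Im tT n)).
Qed.

Lemma sm_lin (T : nat -> R -> C) k n x0 beta : ctower T ->
  Ck setT k (fun y => T n (lin x0 beta y)).
Proof.
move=> tT; elim: k n => [|k IH] n; first by split=> // x _; exact: ccont_lin.
apply: (smS (D := fun j x => (beta 0 j)%:C%C * T n.+1 (lin x0 beta x))).
- exact: openT.
- by move=> x _; exact: ccont_lin.
- by move=> j x _; exact: cder_lin.
- by move=> j; apply: smM => //; [exact: openT|apply: sm_cst; exact: openT].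
Qed.

Lemma bd_lin (T : nat -> R -> C) k n x0 beta (b c : R) : ctower T -> 1 <= b ->
  (forall j, `|beta 0 j| <= b) ->
  (forall m u, (m <= n + k)%N -> cmod (T m u) <= c) ->
  Ck_bound setT k (fun y => T n (lin x0 beta y)) (b ^+ k * c).
Proof.
move=> tT b1 hb; elim: k n => [|k IH] n hc.
  by apply/bd0P => x _; rewrite mul1r hc// addn0.
have c0 : 0 <= c by exact: le_trans (cmod_ge0 _) (hc 0%N 0 _).
apply: (bdS (W := setT) (D := fun j x => (beta 0 j)%:C%C * T n.+1 (lin x0 beta x))) => //.
- exact: openT.
- by move=> j x _; exact: cder_lin.
- move=> x _; apply: le_trans (hc n _ _) _; first by rewrite leq_addr.
  by rewrite ler_peMl// exprn_ege1.
- move=> j; have hk : Ck_bound setT k (fun y => T n.+1 (lin x0 beta y)) (b ^+ k * c).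
    by apply: IH => m u hm; apply: hc; rewrite addnS -addSn.
  have := bdZ ((beta 0 j)%:C%C) openT (@subset_refl _ setT) (sm_lin k n.+1 x0 beta tT) hk.
  apply: bd_le; rewrite cmod_real exprS -mulrA ler_wpM2r//.
  by rewrite mulr_ge0// exprn_ge0//; lra.
Qed.

(** The factors are exchanged one at a time; [1 <= c] supplies the factor [c] that is missing from
    the term where [f i] becomes [g i]. *)
Lemma bd_prodB (S : set E) k (I : eqType) (r : seq I) (f g : I -> E -> C) (c e : R) :
  1 <= c -> 0 <= e ->
  (forall i, i \in r -> Ck setT k (f i)) -> (forall i, i \in r -> Ck setT k (g i)) ->
  (forall i, i \in r -> Ck_bound S k (f i) c) -> (forall i, i \in r -> Ck_bound S k (g i) c) ->
  (forall i, i \in r -> Ck_bound S k (fun x => f i x - g i x) e) ->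
  Ck_bound S k (fun x => \prod_(i <- r) f i x - \prod_(i <- r) g i x)
    ((size r)%:R * e * (2 ^+ k * c) ^+ size r).
Proof.
move=> c1 e0; have oT := @openT E; have ST : S `<=` setT by [].
have c0 : 0 <= c by lra.
elim: r => [|i r IH] sf sg bf bg bfg.
  apply: (eq_bd oT ST (f := fun=> 0)); first by move=> x _; rewrite !big_nil subrr.
  by rewrite mul0r mul0r; have := @bd_cst R d S k 0; rewrite cmod0.
have hr j : j \in r -> j \in i :: r by rewrite in_cons orbC => ->.
have hi : i \in i :: r by rewrite mem_head.
have sf' := sm_prod oT (fun j jr => sf j (hr j jr)).
have sg' := sm_prod oT (fun j jr => sg j (hr j jr)).
have bf' := bd_prod oT ST c0 (fun j jr => sf j (hr j jr)) (fun j jr => bf j (hr j jr)).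
have {}IH := IH (fun j jr => sf j (hr j jr)) (fun j jr => sg j (hr j jr))
  (fun j jr => bf j (hr j jr)) (fun j jr => bg j (hr j jr)) (fun j jr => bfg j (hr j jr)).
set P := fun x => \prod_(i <- r) f i x in sf' bf' IH.
set Q := fun x => \prod_(i <- r) g i x in sg' IH.
apply: (eq_bd oT ST (f := fun x => (f i x - g i x) * P x + g i x * (P x - Q x))).
  by move=> x _; rewrite !big_cons /P /Q; ring.
have q0 : 0 <= 2 ^+ k * c by rewrite mulr_ge0// exprn_ge0.
have t1 := bdM oT ST e0 (exprn_ge0 (size r) q0) (smB oT (sf i hi) (sg i hi)) sf' (bfg i hi) bf'.
have D0 : 0 <= (size r)%:R * e * (2 ^+ k * c) ^+ size r.
  by rewrite !mulr_ge0// exprn_ge0.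
have t2 := bdM oT ST c0 D0 (sg i hi) (smB oT sf' sg') (bg i hi) IH.
apply: bd_le (bdD oT ST _ _ t1 t2).
- rewrite /= exprS -[(size r).+1%:R]natr1 -subr_ge0.
  have q0' := exprn_ge0 (size r) q0; move: (_ ^+ size r) q0' => q q0'.
  rewrite (_ : _ - _ = 2 ^+ k * e * q * (c - 1)); last by ring.
  apply: mulr_ge0; last by rewrite subr_ge0.
  by rewrite !mulr_ge0// exprn_ge0.
- exact: smM oT (smB oT (sf i hi) (sg i hi)) sf'.
- exact: smM oT (sg i hi) (smB oT sf' sg').
Qed.

Definition ctower_cis (n : nat) (u : R) : C := (0 -i* 1)%C ^+ n * cis u.

Lemma ctower_cisP : ctower ctower_cis.
Proof.
move=> n u; rewrite /ctower_cis.
have := cderM (cder_cst u 1 ((0 -i* 1)%C ^+ n)) (cder_cis 1 u).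
rewrite mul0r add0r mul1r mulrA -exprSr.
by under eq_fun do rewrite mul1r.
Qed.

Lemma waveE xi x : wave xi x = cis (lin 0 ((2 * pi) *: xi) x).
Proof.
rewrite /wave /cis /lin subr0 (_ : dotv x _ = 2 * pi * dotv xi x)//.
by rewrite dotvC dotvZl.
Qed.

Lemma wave_sm k xi : Ck setT k (wave xi).
Proof.
apply: (@eq_sm _ _ _ _ (fun x => ctower_cis 0 (lin 0 ((2 * pi) *: xi) x))).
- exact: openT.
- by move=> x _; rewrite waveE /ctower_cis expr0 mul1r.
- exact: sm_lin ctower_cisP.
Qed.

Lemma wave_bd k xi (b : R) : 1 <= b -> (forall j, `|xi 0 j| <= b) ->
  Ck_bound setT k (wave xi) ((2 * pi * b) ^+ k).
Proof.
move=> b1 hb; have pi2 := @pi_ge2 R.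
apply: (@eq_bd _ _ setT _ _ (fun x => ctower_cis 0 (lin 0 ((2 * pi) *: xi) x))) => //.
- exact: openT.
- by move=> x _; rewrite waveE /ctower_cis expr0 mul1r.
- rewrite -[X in Ck_bound _ _ _ X]mulr1; apply: bd_lin ctower_cisP _ _ _; first nra.
    move=> j; rewrite mxE normrM ger0_norm ?ler_wpM2l//; lra.
  move=> m u _; rewrite /ctower_cis cmodM cmod_cis mulr1 cmodX.
  by rewrite cmodE /= expr0n add0r sqrtr_sqr normrN normr1 expr1n.
Qed.

End TensorProducts.

(** * Approximating a cut-off wave by waves with lattice frequencies *)

Section TrigonometricApproximation.
Context {R : realType} {d : nat}.
Local Notation C := (complex R).
Local Notation E := 'rV[R]_d.
Implicit Types (x y xi eta : E) (W K : set E) (B : 'M[R]_d) (T : nat -> R -> R).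

(** Continuity on C^oo(W) with compact set, order and constant made explicit, so that a whole
    sequence can share them. *)
Definition dominated W K (N : nat) (c : R) (F : (E -> C) -> C) : Prop :=
  linear_on (smooth W) F /\
  forall phi, smooth W phi -> cmod (F phi) <= c * seminorm K N phi.

Lemma smooth_of_sm W (phi : E -> C) : open W -> (forall k, Ck setT k phi) -> smooth W phi.
Proof. by move=> oW h; apply/smoothP => // k; exact: sm_sub (h k). Qed.

Lemma sm_of_smooth W k (phi : E -> C) : open W -> smooth W phi -> Ck W k phi.
Proof. by move=> oW h; exact: (smoothP _ oW).1. Qed.

Lemma linear_on0 W (F : (E -> C) -> C) : open W -> linear_on (smooth W) F ->
  F (fun=> 0) = 0.
Proof.
move=> oW lF.
have s0 : smooth W (fun=> 0 : C) by apply/smoothP => // k; exact: sm_cst.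
have e : (fun x : E => -1 * 0 + 0 : C) = (fun=> 0).
  by apply/funext => x; rewrite mulr0 addr0.
by have := lF (-1) _ _ s0 s0; rewrite e => ->; rewrite mulN1r addNr.
Qed.

Lemma linear_on_sum W (F : (E -> C) -> C) (I : Type) (r : seq I) (a : I -> C)
    (phi : I -> E -> C) : open W -> linear_on (smooth W) F ->
  (forall i, smooth W (phi i)) ->
  smooth W (fun x => \sum_(i <- r) a i * phi i x) /\
  F (fun x => \sum_(i <- r) a i * phi i x) = \sum_(i <- r) a i * F (phi i).
Proof.
move=> oW lF sphi; elim: r => [|i r [sr IH]].
  rewrite big_nil; under eq_fun do rewrite big_nil.
  by split; [apply/smoothP => // k; exact: sm_cst|exact: linear_on0 lF].
rewrite big_cons; under eq_fun do rewrite big_cons; split.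
  apply/smoothP => // k; apply: smD => //; last exact: sm_of_smooth.
  by apply: smM => //; [exact: sm_cst|exact: sm_of_smooth].
by rewrite lF// IH.
Qed.

Lemma dominated_sub W K N (c e : R) F (phi psi : E -> C) : open W -> compact K ->
  K `<=` W -> dominated W K N c F -> 0 <= c -> 0 <= e ->
  smooth W phi -> smooth W psi ->
  Ck_bound K N (fun x => phi x - psi x) e -> cmod (F phi) <= cmod (F psi) + c * e.
Proof.
move=> oW cK KW [lF hF] c0 e0 sphi spsi hb.
have e1 : F (fun x => -1 * psi x + phi x) = -1 * F psi + F phi by exact: lF.
have e2 : F phi = F psi + F (fun x => -1 * psi x + phi x) by rewrite e1; ring.
have s : smooth W (fun x => -1 * psi x + phi x).
  apply/smoothP => // k; apply: smD => //; last exact: sm_of_smooth.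
  by apply: smM => //; [exact: sm_cst|exact: sm_of_smooth].
rewrite e2; apply: le_trans (cmodD _ _) _; rewrite lerD2l.
apply: le_trans (hF _ s) _; rewrite ler_wpM2l//; apply: seminorm_le => //.
by apply: (eq_bd oW KW _ hb) => x _; rewrite mulN1r addrC.
Qed.

(** The coordinates [lin x0 (row j B)] are pairings with a lattice basis; they carry the dual
    lattice, translated at [x0], to integer points, which reduces the periodization to one
    variable. *)
Definition chi T B (x0 x : E) : C :=
  \prod_(j < d) (T 0%N (lin x0 (row j B) x))%:C%C.

Definition tensor (f : 'I_d -> R -> C) B (x0 x : E) : C :=
  \prod_(j < d) f j (lin x0 (row j B) x).

Lemma cis_sum (I : Type) (r : seq I) (f : I -> R) :
  cis (\sum_(i <- r) f i) = \prod_(i <- r) cis (f i).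
Proof. exact: (big_morph _ (@cisD R) (@cis0 R)). Qed.

Lemma wave_tensor eta B (x0 x : E) : wave (eta *m B) x =
  cis (2 * pi * dotv x0 (eta *m B)) *
  tensor (fun j u => cis (2 * pi * eta 0 j * u)) B x0 x.
Proof.
rewrite /tensor -cis_sum -cisD waveE; congr cis; rewrite /lin subr0 dotvC dotvZl.
rewrite -{1}(subrK x0 x) dotvC dotvDl mulrDr addrC; congr (_ + _).
rewrite dotv_mulmx mulr_sumr; apply: eq_bigr => j _; ring.
Qed.

Lemma chi_wave T eta B (x0 x : E) : chi T B x0 x * wave (eta *m B) x =
  cis (2 * pi * dotv x0 (eta *m B)) *
  tensor (fun j u => (T 0%N u)%:C%C * cis (2 * pi * eta 0 j * u)) B x0 x.
Proof. by rewrite (wave_tensor eta B x0) /tensor big_split /= mulrCA. Qed.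

Lemma ctower_real T : tower T -> ctower (fun n u => (T n u)%:C%C).
Proof. by move=> tT n u; split=> /=; [exact: tT|exact: is_derive_cst]. Qed.

Lemma sm_chi T B (x0 : E) k : tower T -> Ck setT k (chi T B x0).
Proof.
move=> tT; apply: sm_prod => [|j _]; first exact: openT.
exact: (sm_lin k 0 x0 (row j B) (ctower_real tT)).
Qed.

Lemma sm_tensor (G : 'I_d -> nat -> R -> C) B (x0 : E) k :
  (forall j, ctower (G j)) -> Ck setT k (tensor (fun j => G j 0%N) B x0).
Proof.
move=> tG; apply: sm_prod => [|j _]; first exact: openT.
exact: (sm_lin k 0 x0 (row j B) (tG j)).
Qed.

Definition freqv eta n (k : {ffun 'I_d -> 'I_(2 * n).+1}) : E :=
  \row_j (freq (eta 0 j) n (k j))%:~R.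

Lemma tensor_trig T eta B (x0 x : E) n :
  tensor (fun j => trig (T 0%N) (eta 0 j) n 0) B x0 x =
  \sum_(k : {ffun 'I_d -> 'I_(2 * n).+1})
    (\prod_j coef (T 0%N) (eta 0 j) n (freqv eta k 0 j) *
     cis (- (2 * pi * dotv x0 (freqv eta k *m B)))) *
    wave (freqv eta k *m B) x.
Proof.
rewrite /tensor /trig bigA_distr_bigA; apply: eq_bigr => k _ /=.
rewrite (wave_tensor _ _ x0) -mulrA (mulrA (cis (- _))) cisNK mul1r /tensor.
rewrite -big_split; apply: eq_bigr => j _ /=; by rewrite expr0 mul1r mxE.
Qed.

Lemma matrix_entries_bounded B : exists2 b : R, 1 <= b & forall j i, `|row j B 0 i| <= b.
Proof.
exists (1 + \sum_j \sum_i `|B j i|).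
  by rewrite lerDl; do 2 (apply: sumr_ge0 => ? _).
move=> j i; rewrite mxE; apply: (@le_trans _ _ (\sum_j \sum_i `|B j i|)).
  rewrite (bigD1 j)//= (bigD1 i)//= -addrA lerDl addr_ge0//; first exact: sumr_ge0.
  by apply: sumr_ge0 => k _; apply: sumr_ge0.
by rewrite lerDr.
Qed.

Lemma trig_cvg_uniform T (G : 'I_d -> nat -> R -> C) (b : nat -> R)
    (Bd : 'I_d -> nat -> R) eta (N : nat) (e : R) :
  tower T -> (forall u : R, 1 / 8 <= `|u| -> T 0%N u = 0) ->
  (forall m u, `|T m u| <= b m) ->
  (forall j, ctower (G j)) -> (forall j n u, cmod (G j n u) <= Bd j n) ->
  (forall j u, G j 0%N u = periodized (T 0%N) (eta 0 j) u) -> 0 < e ->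
  exists n0, forall n j m u, (n0 <= n)%N -> (m <= N)%N ->
    cmod (trig (T 0%N) (eta 0 j) n m u - G j m u) <= e.
Proof.
move=> tT hT hb tG hG G0 e0.
have h (p : 'I_d * 'I_N.+1) := trig_cvg p.2 tT hT hb (tG p.1) (hG p.1) (G0 p.1) e0.
have [n0 hn0] := choice h.
exists (\max_p n0 p) => n j m u hn hm.
apply: (hn0 (j, Ordinal (hm : m < N.+1)%N)).
by apply: leq_trans hn; exact: leq_bigmax.
Qed.

(* [delta]-separation of [K] from the non-trivial points of the lattice dual
   to the rows of [B], translated at [x0]. *)
Definition dual_separated K B (x0 : E) (delta : R) : Prop :=
  forall x (m : 'I_d -> int), K x ->
    (forall j, `|lin x0 (row j B) x - (m j)%:~R| < delta) -> forall j, m j = 0.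

(** Equality of two functions on [K] alone would not give equality of their derivatives there;
    equality on this open neighbourhood does. *)
Definition thickening K B (x0 : E) (r : R) : set E :=
  [set x | exists2 y, K y & forall j, `|lin x0 (row j B) x - lin x0 (row j B) y| < r].

Lemma open_thickening K B (x0 : E) (r : R) : open (thickening K B x0 r).
Proof.
rewrite openE => x [y Ky hy]; rewrite /interior.
have h : \forall z \near x, forall j, `|lin x0 (row j B) z - lin x0 (row j B) y| < r.
  apply: (@filter_forall _ 'I_d (fun j => [set z | `|lin x0 (row j B) z - lin x0 (row j B) y| < r]) (nbhs x) (nbhs_filter x)) => j.
  have cj : {for x, continuous (fun z => `|lin x0 (row j B) z - lin x0 (row j B) y|)}.
    apply: (@continuous_comp _ _ _ (lin x0 (row j B) - cst (lin x0 (row j B) y))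
      (fun t : R => `|t|)); last exact: norm_continuous.
    by apply: continuousB; [exact: lin_continuous|exact: cst_continuous].
  exact: (cvgr_lt _ cj _ (hy j)).
by near=> z; exists y => //; near: z.
Unshelve. all: by end_near. Qed.

(** If all coordinates of [x] are within [delta / 2] of integers, those of the nearby point of [K]
    are within [delta], so the integers are 0 and nothing is translated. Otherwise one coordinate is
    at least [delta / 2] away from the integers and its factor vanishes on both sides. *)
Lemma periodized_eq K B (x0 : E) (delta : R) T eta x : delta <= 1 / 4 ->
  dual_separated K B x0 delta -> (forall u : R, delta / 2 <= `|u| -> T 0%N u = 0) ->
  thickening K B x0 (delta / 2) x ->
  tensor (fun j => periodized (T 0%N) (eta 0 j)) B x0 x =
  tensor (fun j u => (T 0%N u)%:C%C * cis (2 * pi * eta 0 j * u)) B x0 x.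
Proof.
move=> d4 sK hT [y Ky hy].
pose u j := lin x0 (row j B) x.
have [hall|] := pselect (forall j, `|u j - (rnd (u j))%:~R| < delta / 2).
  have m0 := sK y (fun j => rnd (u j)) Ky.
  apply: eq_bigr => j _; rewrite /periodized -/(u j).
  rewrite m0 ?subr0// => i.
  rewrite (_ : _ - _ = (u i - (rnd (u i))%:~R) - (u i - lin x0 (row i B) y)); last by ring.
  by apply: le_lt_trans (ler_normB _ _) _; have := hall i; have := hy i; rewrite -/(u i); lra.
move=> /existsNP[j /negP]; rewrite -leNgt => hj.
have hu : delta / 2 <= `|u j|.
  have [uj|uj] := ltP `|u j| (1 / 2); last by apply: le_trans uj; lra.
  move: hj; rewrite (_ : rnd (u j) = 0) ?subr0//.
  by apply: rnd_unique; rewrite subr0.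
rewrite /tensor (bigD1 j)//= [RHS](bigD1 j)//= /periodized -/(u j) !hT//.
by rewrite !mul0r.
Qed.

(** The functional is linear on trigonometric polynomials, and the cut-off wave differs from its
    interpolant by an error that tends to 0 in the seminorm dominating [F]. *)
Lemma cutoff_wave_estimate W K N (c delta : R) F B (x0 : E) T (b : nat -> R) eta (e : R) :
  open W -> compact K -> K `<=` W -> 0 <= c -> dominated W K N c F ->
  tower T -> (forall u : R, delta / 2 <= `|u| -> T 0%N u = 0) ->
  (forall m u, `|T m u| <= b m) -> 0 < delta <= 1 / 4 ->
  dual_separated K B x0 delta -> 0 < e ->
  exists n0, forall n, (n0 <= n)%N ->
    cmod (F (fun x => chi T B x0 x * wave (eta *m B) x)) <=
    \sum_(k : {ffun 'I_d -> 'I_(2 * n).+1})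
      (\prod_j cmod (coef (T 0%N) (eta 0 j) n (freqv eta k 0 j))) *
      cmod (F (wave (freqv eta k *m B))) + e.
Proof.
move=> oW cK KW c0 dF tT hT hb /andP[d0 d4] sK e0.
have hT8 u : 1 / 8 <= `|u| -> T 0%N u = 0 by move=> hu; apply: hT; lra.
have /choice[GB hGB] : forall j : 'I_d, exists GB : (nat -> R -> C) * (nat -> R),
    [/\ ctower GB.1, forall n u, cmod (GB.1 n u) <= GB.2 n &
        forall u, GB.1 0%N u = periodized (T 0%N) (eta 0 j) u].
  move=> j; have [G [Bd [h1 h2 h3]]] := exists_periodization (eta 0 j) tT hT8.
  by exists (G, Bd).
pose G j := (GB j).1; pose Bd j := (GB j).2.
have tG j : ctower (G j) by have [] := hGB j.
have hG j n u : cmod (G j n u) <= Bd j n by have [_ h _] := hGB j; exact: h.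
have G0 j u : G j 0%N u = periodized (T 0%N) (eta 0 j) u by have [_ _ h] := hGB j; exact: h.
have [bB bB1 hbB] := matrix_entries_bounded B.
have Bd0 j n : 0 <= Bd j n by exact: le_trans (cmod_ge0 _) (hG j n 0).
pose M := 1 + \sum_j \sum_(m < N.+1) Bd j m.
have Mge j m : (m <= N)%N -> 1 + Bd j m <= M.
  move=> hm; rewrite /M lerD2l (bigD1 j)//= (bigD1 (Ordinal (hm : m < N.+1)%N))//=.
  rewrite -addrA lerDl addr_ge0//; first by apply: sumr_ge0.
  by apply: sumr_ge0 => i _; apply: sumr_ge0.
have M1 : 1 <= M by rewrite lerDl; apply: sumr_ge0 => i _; apply: sumr_ge0.
pose L := bB ^+ N * M.
have L1 : 1 <= L by rewrite mulr_ege1// exprn_ege1.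
(* The amplification of a one-variable error by the chain rule, the product of [d] factors and the
   functional. *)
pose Q := c * (d%:R * bB ^+ N * (2 ^+ N * L) ^+ d).
have bN0 : 0 <= bB ^+ N by rewrite exprn_ge0//; lra.
have Q0 : 0 <= Q.
  by rewrite !mulr_ge0// exprn_ge0// mulr_ge0 ?exprn_ge0//; lra.
(* The minimum with 1 keeps the interpolants below [1 + Bd j m <= M]; the second term makes the
   total error at most [e]. *)
pose e' := Num.min 1 (e / (Q + 1)).
have e'0 : 0 < e' by rewrite lt_min ltr01 divr_gt0//; lra.
have Qe : Q * e' <= e.
  apply: (@le_trans _ _ (Q * (e / (Q + 1)))).
    by rewrite ler_wpM2l// ge_min lexx orbT.
  by rewrite mulrA ler_pdivrMr; [rewrite mulrC ler_wpM2l; lra|lra].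
have [n0 hn0] := trig_cvg_uniform N tT hT8 hb tG hG G0 e'0.
exists n0 => n hn.
pose th := cis (2 * pi * dotv x0 (eta *m B)).
pose Z x := tensor (fun j => trig (T 0%N) (eta 0 j) n 0) B x0 x.
pose ZG x := tensor (fun j => G j 0%N) B x0 x.
have sZ k : Ck setT k Z.
  by apply: (sm_tensor (G := fun j => trig (T 0%N) (eta 0 j) n)) => j; exact: ctower_trig.
have sZG k : Ck setT k ZG by exact: sm_tensor.
have bZ : Ck_bound setT N (fun x => Z x - ZG x) (d%:R * (bB ^+ N * e') * (2 ^+ N * L) ^+ d).
  have sz : size (index_enum 'I_d) = d by rewrite -[RHS]card_ord cardE enumT.
  suff : Ck_bound setT N (fun x => Z x - ZG x) ((size (index_enum 'I_d))%:R *
    (bB ^+ N * e') * (2 ^+ N * L) ^+ size (index_enum 'I_d)) by rewrite sz.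
  apply: bd_prodB => //.
  - by rewrite mulr_ge0// ltW.
  - by move=> j _; apply: (sm_lin N 0 x0 (row j B) (@ctower_trig _ (T 0%N) (eta 0 j) n)).
  - by move=> j _; apply: (sm_lin N 0 x0 (row j B) (tG j)).
  - move=> j _; apply: (bd_lin (T := trig (T 0%N) (eta 0 j) n)) => // [|m u hm].
      exact: ctower_trig.
    rewrite -[trig _ _ _ _ _](subrK (G j m u)); apply: le_trans (cmodD _ _) _.
    apply: le_trans (Mge j m hm); apply: lerD => //.
    by apply: le_trans (hn0 _ _ _ _ hn hm) _; rewrite ge_min lexx.
  - move=> j _; apply: (bd_lin (T := G j)) => // m u hm.
    by apply: le_trans (hG j m u) _; apply: le_trans (Mge j m hm); rewrite lerDr.
  - move=> j _.
    apply: (bd_lin (T := fun m u => trig (T 0%N) (eta 0 j) n m u - G j m u)) => //.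
      by apply: ctowerB => //; exact: ctower_trig.
    by move=> m u hm; exact: hn0.
have sthZ k : Ck setT k (fun x => th * Z x).
  by apply: smM => //; [exact: openT|apply: sm_cst; exact: openT].
have sthZG k : Ck setT k (fun x => th * ZG x).
  by apply: smM => //; [exact: openT|apply: sm_cst; exact: openT].
have sX k : Ck setT k (fun x => chi T B x0 x * wave (eta *m B) x).
  by apply: smM; [exact: openT|exact: sm_chi|exact: wave_sm].
have bX : Ck_bound K N (fun x => chi T B x0 x * wave (eta *m B) x - th * Z x)
    (d%:R * (bB ^+ N * e') * (2 ^+ N * L) ^+ d).
  have bZ' := bdZ (- th) (@openT E) (@subset_refl _ setT)
    (smB (@openT E) (sZ N) (sZG N)) bZ.
  rewrite cmodN cmod_cis mul1r in bZ'.
  apply: (@eq_bd _ _ (thickening K B x0 (delta / 2)) _ _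
    (fun x => - th * (Z x - ZG x))).
  - exact: open_thickening.
  - by move=> y Ky; exists y => // j; rewrite subrr normr0; lra.
  - move=> x hx; rewrite chi_wave -/th -(periodized_eq eta d4 sK hT hx).
    rewrite /ZG /tensor (eq_bigr _ (fun j _ => G0 j _)); ring.
  - exact: bd_sub bZ'.
apply: le_trans (dominated_sub oW cK KW dF c0 _ _ _ bX) _.
- by rewrite !mulr_ge0 ?exprn_ge0 ?mulr_ge0 ?exprn_ge0//; lra.
- exact: smooth_of_sm.
- exact: smooth_of_sm.
apply: lerD; last first.
  by apply: le_trans Qe; rewrite /Q le_eqVlt; apply/orP; left; apply/eqP; ring.
have eZ : (fun x => th * Z x) = (fun x => \sum_(k : {ffun 'I_d -> 'I_(2 * n).+1})
    (th * (\prod_j coef (T 0%N) (eta 0 j) n (freqv eta k 0 j) *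
     cis (- (2 * pi * dotv x0 (freqv eta k *m B))))) * wave (freqv eta k *m B) x).
  apply/funext => x; rewrite /Z tensor_trig mulr_sumr.
  by apply: eq_bigr => k _; rewrite mulrA.
have [_ eF] := linear_on_sum (index_enum _) (fun k : {ffun 'I_d -> 'I_(2 * n).+1} =>
    th * (\prod_j coef (T 0%N) (eta 0 j) n (freqv eta k 0 j) *
     cis (- (2 * pi * dotv x0 (freqv eta k *m B))))) oW dF.1
  (fun k => smooth_of_sm oW (fun l => wave_sm l (freqv eta k *m B))).
rewrite eZ eF; apply: le_trans (cmod_sum _ _ _) _; apply: ler_sum => k _.
by rewrite !cmodM !cmod_cis mul1r mulr1 cmod_prod.
Qed.

End TrigonometricApproximation.

(** * Bounded sequences of distributions are uniformly dominated *)

Section CommonDomination.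
Context {R : realType} {d : nat}.
Local Notation C := (complex R).
Local Notation E := 'rV[R]_d.
Implicit Types (x y : E) (W K : set E).

Definition exhaustion W (n : nat) : set E :=
  [set x | `|x| <= n%:R] `&` \bigcap_(y in ~` W) [set x | n.+1%:R^-1 <= `|x - y|].

Lemma compact_exhaustion W n : compact (exhaustion W n).
Proof.
apply: bounded_closed_compact.
  exists n%:R; split; first exact: num_real.
  by move=> M nM x [hx _]; apply: le_trans hx (ltW nM).
have cl (f : E -> R) (D : set R) : continuous f -> closed D -> closed (f @^-1` D).
  by move=> cf; apply: closed_comp => x _; exact: cf.
apply: closedI; first exact: (cl _ _ (@norm_continuous _ _) (@closed_le _ _)).
apply: closed_bigI => y _.
apply: (cl (fun x => `|x - y|) [set r | n.+1%:R^-1 <= r] _ (@closed_ge _ _)).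
move=> x; apply: (@continuous_comp _ _ _ (fun x : E => x - y) (fun z : E => `|z|)).
  by apply: (@continuousB _ _ _ id (cst y)); [exact: cvg_id|exact: cst_continuous].
exact: norm_continuous.
Qed.

Lemma exhaustion_sub W n : exhaustion W n `<=` W.
Proof.
move=> x [_ h]; apply: contrapT => /h /=.
by rewrite subrr normr0 leNgt invr_gt0 ltr0n.
Qed.

(** Around each point of [K] a ball of radius [r] lies in [W]; on half of it the distance to the
    complement is at least [r / 2], and compactness makes the choice of [n] uniform. *)
Lemma exhaustion_covers W K : open W -> compact K -> K `<=` W ->
  \forall n \near \oo, K `<=` exhaustion W n.
Proof.
move=> oW /compact_near_coveringP cK KW.
apply: (cK nat \oo (fun n x => exhaustion W n x)) => x Kx.
have [r /= r0 hr] : nbhs_ball x W.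
  by rewrite nbhs_ballE; apply: open_nbhs_nbhs; split => //; exact: KW.
have hx : \forall x' \near x, `|x - x'| < r / 2.
  have r2 : 0 < r / 2 by rewrite divr_gt0.
  by have := nbhsx_ballx x _ r2; rewrite -ball_normE.
have hn : \forall n \near \oo, `|x| + r <= n%:R /\ 2 / r <= n.+1%:R.
  near=> n; split; first by near: n; exact: nbhs_infty_ger.
  rewrite -[n.+1%:R]natr1; apply: ler_wpDr => //; near: n; exact: nbhs_infty_ger.
exists ([set x' : E | `|x - x'| < r / 2],
  [set n : nat | `|x| + r <= n%:R /\ 2 / r <= n.+1%:R]).
  by split.
move=> [x' n] /= [h1 [h2 h3]]; split=> /=.
  by have := ler_normB x (x - x'); rewrite opprB addrCA subrr addr0; lra.
move=> y Wy /=; have rxy : r <= `|x - y|.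
  by rewrite leNgt; apply/negP => h; apply: Wy; apply: hr; rewrite -ball_normE.
have t : `|x - y| <= `|x - x'| + `|x' - y|.
  by rewrite (_ : x - y = (x - x') + (x' - y)) ?ler_normD// addrA subrK.
apply: (@le_trans _ _ (r / 2)); last by lra.
rewrite -[r / 2]invrK lef_pV2 ?posrE ?invr_gt0 ?divr_gt0//.
by rewrite invf_div.
Unshelve. all: by end_near. Qed.

Lemma linear_onZ W (F : (E -> C) -> C) (a : C) phi : open W ->
  linear_on (smooth W) F -> smooth W phi -> F (fun x => a * phi x) = a * F phi.
Proof.
move=> oW lF sphi.
have s0 : smooth W (fun=> 0 : C) by apply/smoothP => // k; exact: sm_cst.
have := lF a phi _ sphi s0; rewrite (linear_on0 oW lF) addr0 => <-.
by congr F; apply/funext => x; rewrite addr0.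
Qed.

Lemma smoothZ W (a : C) (phi : E -> C) : open W -> smooth W phi ->
  smooth W (fun x => a * phi x).
Proof.
move=> oW sphi; apply/smoothP => // k; apply: smM => //; first exact: sm_cst.
exact: sm_of_smooth.
Qed.

(* Otherwise a sequence of counterexamples, rescaled, would be a bounded set on
   which the functionals are not uniformly bounded. *)
Lemma bounded_sequence_dominated W F : open W -> bounded_sequence W F ->
  exists K N (c : R), [/\ compact K, K `<=` W, 0 <= c & forall p, dominated W K N c (F p)].
Proof.
move=> oW [hF hB]; apply: contrapT => hn.
have lF p : linear_on (smooth W) (F p) by case: (hF p).
have ex (n : nat) : exists q : nat * (E -> C), smooth W q.2 /\
    n%:R * seminorm (exhaustion W n) n q.2 < cmod (F q.1 q.2).
  apply: contrapT => hn'; apply: hn; exists (exhaustion W n), n, n%:R; split => //.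
  - exact: compact_exhaustion.
  - exact: exhaustion_sub.
  - move=> p; split => // phi sphi; rewrite leNgt; apply/negP => h.
    by apply: hn'; exists (p, phi).
have [q hq] := choice ex.
(* Scaled so that the functional takes a value of modulus [n], while the [n]-th seminorm is at most
   1. *)
pose t n := n%:R / cmod (F (q n).1 (q n).2).
pose psi n x := (t n)%:C%C * (q n).2 x.
have Fpos n : 0 < cmod (F (q n).1 (q n).2).
  by apply: le_lt_trans (hq n).2; rewrite mulr_ge0// seminorm_ge0.
have spsi n : smooth W (psi n) by apply: smoothZ => //; exact: (hq n).1.
have t0 n : 0 <= t n by rewrite divr_ge0// ltW.
have Fpsi n : cmod (F (q n).1 (psi n)) = n%:R.
  rewrite (linear_onZ _ oW (lF _) (hq n).1) cmodM cmod_real ger0_norm//.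
  by rewrite /t divfK// gt_eqF.
have bpsi n : Ck_bound (exhaustion W n) n (psi n) 1.
  have cE : compact (exhaustion W n) by exact: compact_exhaustion.
  have EW : exhaustion W n `<=` W by exact: exhaustion_sub.
  have sq := sm_of_smooth n oW (hq n).1.
  have := bdZ ((t n)%:C%C) oW EW sq (bd_seminorm cE EW sq).
  apply: bd_le; rewrite cmod_real ger0_norm// /t mulrAC ler_pdivrMr// mul1r.
  exact: ltW (hq n).2.
have [M hM] : exists M : R, forall p phi, range psi phi -> cmod (F p phi) <= M.
  apply: hB; split; first by move=> _ [n _ <-].
  move=> K N cK KW.
  have [n0 _ hn0] : \forall n \near \oo, K `<=` exhaustion W n /\ (N <= n)%N.
    near=> n; split; near: n; first exact: exhaustion_covers.
    exact: nbhs_infty_ge.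
  (* Only finitely many [psi i] precede [n0]; the sum of their seminorms takes care of them. *)
  exists (1 + \sum_(i < n0) seminorm K N (psi i)) => _ [n _ <-].
  have [nn|nn] := leqP n0 n.
    have [KE Nn] := hn0 n nn.
    apply: (@le_trans _ _ 1); last by rewrite lerDl sumr_ge0// => i _; exact: seminorm_ge0.
    by apply: seminorm_le => //; apply: bd_leq Nn _; apply: bd_sub (bpsi n).
  rewrite (bigD1 (Ordinal nn))//= addrCA lerDl addr_ge0// sumr_ge0// => i _.
  exact: seminorm_ge0.
have [m hm] : exists m : nat, M < m%:R.
  by exists (Num.truncn M).+1; exact: truncnS_gt.
have := hM (q m).1 (psi m) (ex_intro2 _ _ m I erefl).
by rewrite Fpsi leNgt hm.
Unshelve. all: by end_near. Qed.

End CommonDomination.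

(** * Every lattice has a basis *)

Section LatticeBasis.
Context {R : realType} {d : nat}.
Local Notation E := 'rV[R]_d.
Implicit Types (x y : E) (L : set E) (A B : 'M[R]_d).

Section Subgroup.
Variable L : set E.
Hypothesis L0 : L 0.
Hypothesis LB : forall x y, L x -> L y -> L (x - y).

Lemma lattice_opp x : L x -> L (- x).
Proof. by move=> Lx; rewrite -sub0r; exact: LB. Qed.

Lemma lattice_add x y : L x -> L y -> L (x + y).
Proof. by move=> Lx Ly; rewrite -[y]opprK; apply: (LB) => //; exact: lattice_opp. Qed.

Lemma lattice_scale (m : int) x : L x -> L (m%:~R *: x).
Proof.
move=> Lx; have h (n : nat) : L (n%:R *: x).
  elim: n => [|n IH]; first by rewrite scale0r.
  by rewrite -[n.+1%:R]natr1 scalerDl scale1r; exact: lattice_add.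
case: m => n; first by rewrite -pmulrn.
by rewrite NegzE rmorphN scaleNr; apply: lattice_opp; exact: h.
Qed.

Lemma lattice_sum (I : Type) (r : seq I) (f : I -> E) :
  (forall i, L (f i)) -> L (\sum_(i <- r) f i).
Proof. by move=> h; elim/big_ind: _ => // *; exact: lattice_add. Qed.

Lemma lattice_comb A (m : 'I_d -> int) : (forall i, L (row i A)) ->
  L ((\row_j (m j)%:~R) *m A).
Proof.
move=> LA; rewrite mulmx_sum_row; apply: lattice_sum => i.
by rewrite mxE; exact: lattice_scale.
Qed.

End Subgroup.

(** The lattice vectors that occur in expansions of the unit vectors form a matrix of full rank,
    from which [d] independent rows are selected. *)
Lemma lattice_full_rank L : is_lattice L ->
  exists2 A, A \in unitmx & forall i, L (row i A).
Proof.
case=> L0 LB _ Lspan.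
have /choice[n hn] : forall i : 'I_d, exists n : nat, exists cv : ('I_n -> R) * ('I_n -> E),
    (forall k, L (cv.2 k)) /\ delta_mx 0 i = \sum_(k < n) cv.1 k *: cv.2 k.
  by move=> i; have [n [c [v h]]] := Lspan (delta_mx 0 i); exists n, (c, v).
pose cv i := proj1_sig (cid (hn i)).
have hcv i := proj2_sig (cid (hn i)).
pose T := {i : 'I_d & 'I_(n i)}.
pose V : 'M[R]_(#|{: T}|, d) := \matrix_k ((cv (tag (enum_val k))).2 (tagged (enum_val k))).
have fV : row_full V.
  rewrite -sub1mx; apply/row_subP => i; rewrite rowE mulmx1 (hcv i).2.
  apply: summx_sub => k _; apply: scalemx_sub.
  have -> : (sval (cid (hn i))).2 k = row (enum_rank (Tagged (fun i => 'I_(n i)) k)) V.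
    by rewrite rowK enum_rankK.
  exact: row_sub.
exists (rowsub (fullrankfun fV) V); first exact: fullrowsub_unit.
by move=> i; rewrite row_rowsub rowK; exact: (hcv _).1.
Qed.

Lemma lattice_separation L : is_lattice L -> exists2 r : R, 0 < r &
  forall x, L x -> (forall j, `|x 0 j| < r) -> x = 0.
Proof.
case=> L0 _ Liso _; have [_ [V V0 hV]] := Liso 0 L0.
have [r /= r0 hr] : nbhs_ball (0 : E) V by rewrite nbhs_ballE.
exists r => // x Lx hx; suff : [set (0 : E)] x by [].
rewrite -hV; split=> //; apply: hr; split=> // i j.
by rewrite mxE ord1 -ball_normE /= sub0r normrN.
Qed.

(** Pigeonhole: among [Q + 1] multiples of [x], reduced modulo the rows of [A], two fall into the
    same of [Q] cells. They differ by a lattice vector shorter than the separation, hence by 0, so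
    some [D <= Q] clears the denominators of [x]; [Q!] serves all [x] at once. *)
Lemma lattice_finite_index L A : is_lattice L -> A \in unitmx ->
  (forall i, L (row i A)) -> exists2 P : nat, (0 < P)%N &
  forall x, L x -> exists m : 'I_d -> int, P%:R *: (x *m invmx A) = \row_j (m j)%:~R.
Proof.
move=> Llat uA LA; have [r r0 hr] := lattice_separation Llat.
have [L0 LB _ _] := Llat.
pose S := \sum_i \sum_j `|A i j|.
have S0 : 0 <= S by apply: sumr_ge0 => i _; exact: sumr_ge0.
have [q hq] : exists q : nat, S / r < q.+1%:R.
  by exists (Num.truncn (S / r)); exact: truncnS_gt.
have q0 : 0 < q.+1%:R :> R by [].
pose Q := #|{ffun 'I_d -> 'I_q.+1}|.
exists (Q`!)%N; first exact: fact_gt0.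
move=> x Lx.
pose t (k : nat) : E := k%:R *: (x *m invmx A).
pose fl k (j : 'I_d) : int := Num.floor (t k 0 j).
pose fr k (j : 'I_d) : R := t k 0 j - (fl k j)%:~R.
have fr01 k j : 0 <= fr k j < 1.
  have /andP[h1 h2] := mem_rg1_floor (t k 0 j).
  by rewrite /fr /fl; move: h1 h2; rewrite ?intrD => h1 h2; apply/andP; split; lra.
pose cell k : {ffun 'I_d -> 'I_q.+1} :=
  [ffun j => inord (Num.truncn (fr k j * q.+1%:R))].
have cellP k j : (cell k j)%:R <= fr k j * q.+1%:R < (cell k j)%:R + 1.
  have /andP[f0 f1] := fr01 k j.
  have p0 : 0 <= fr k j * q.+1%:R by rewrite mulr_ge0.
  have /andP[a1 a2] := truncn_itv p0.
  rewrite ffunE inordK; first by rewrite a1 natr1.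
  rewrite -(ltr_nat R); apply: le_lt_trans a1 _.
  by rewrite -[X in _ < X]mul1r ltr_pM2r.
have /injectivePn[k [k' kk' ck]] : ~~ injectiveb (fun k : 'I_Q.+1 => cell k).
  by apply/negP => /injectiveP /leq_card; rewrite card_ord ltnn.
wlog lt : k k' kk' ck / (k < k')%N => [H|].
  by have [/H|/H|/val_inj e] := ltngtP k k'; [exact|rewrite eq_sym; exact|rewrite e eqxx in kk'].
pose z k := k%:R *: x - (\row_j (fl k j)%:~R) *m A.
have Lz n : L (z n).
  apply: (LB); last exact: (lattice_comb L0 LB).
  by have := lattice_scale L0 LB n Lx; rewrite -pmulrn.
have zE n : z n = (\row_j fr n j) *m A.
  rewrite (_ : (\row_j fr n j) = t n - \row_j (fl n j)%:~R).
    by rewrite mulmxBl /t -scalemxAl mulmxKV.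
  by apply/rowP => j; rewrite [LHS]mxE [RHS]mxE /fr; congr (_ + _); rewrite !mxE.
have zz : z k - z k' = 0.
  apply: hr; first exact: LB.
  move=> j; rewrite !zE -mulmxBl mxE.
  apply: le_lt_trans (ler_norm_sum _ _ _) _.
  apply: (@le_lt_trans _ _ (q.+1%:R^-1 * S)).
    rewrite mulr_sumr; apply: ler_sum => i _.
    rewrite normrM; apply: ler_pM => //; last first.
      by rewrite (bigD1 j)//= lerDl sumr_ge0.
    have := cellP k i; have := cellP k' i; rewrite -ck => /andP[b1 b2] /andP[b3 b4].
    rewrite !mxE -[leRHS]mul1r ler_pdivlMr// -[X in _ * X](gtr0_norm q0) -normrM.
    by rewrite mulrBl ler_norml; apply/andP; split; lra.
  by rewrite mulrC ltr_pdivrMr// mulrC -ltr_pdivrMr.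
pose D := (k' - k)%N.
have D0 : (0 < D)%N by rewrite subn_gt0.
have DQ : (D <= Q)%N by rewrite (leq_trans (leq_subr _ _))// -ltnS.
have hD : D%:R *: (x *m invmx A) = \row_j (fl k' j - fl k j)%:~R.
  have := congr1 (fun v => v *m invmx A) zz; rewrite mul0mx /z.
  rewrite mulmxBl !mulmxBl !mulmxK// -!scalemxAl => e.
  apply/rowP => j; have := congr1 (fun v : E => v 0 j) e.
  rewrite !mxE natrB ?(ltnW lt)// rmorphB /=; lra.
have [Z hZ] : exists Z, (Q`! = Z * D)%N.
  by apply/dvdnP; rewrite dvdn_fact// D0.
exists (fun j => Z%:Z * (fl k' j - fl k j)).
rewrite hZ natrM -scalerA hD; apply/rowP => j.
by rewrite !mxE rmorphM /= -pmulrn.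
Qed.

Lemma cofactor_eq_off_row A B i j :
  (forall k l, k != i -> A k l = B k l) -> cofactor A i j = cofactor B i j.
Proof.
move=> h; rewrite /cofactor; congr (_ * \det _).
by apply/matrixP => k l; rewrite !mxE h// eq_sym neq_lift.
Qed.

(** Cramer's rule: the expansion along row [i] involves only cofactors of [A]. *)
Lemma det_replace_row A (t : E) (i : 'I_d) :
  \det (\matrix_k (if k == i then t *m A else row k A)) = t 0 i * \det A.
Proof.
set A' := \matrix_k _; rewrite (expand_det_row A' i).
have -> : \sum_j A' i j * cofactor A' i j = (t *m A *m \adj A) 0 i.
  rewrite [RHS]mxE; apply: eq_bigr => j _.
  rewrite [A' i j]mxE eqxx; congr (_ * _); rewrite [RHS]mxE.
  apply: cofactor_eq_off_row => k l ki.
  by rewrite mxE (negbTE ki) mxE.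
by rewrite -mulmxA mul_mx_adj mul_mx_scalar mxE mulrC.
Qed.

Lemma det_int (A : 'M[R]_d) : (forall i j, A i j \is a Num.int) -> \det A \is a Num.int.
Proof.
move=> h; rewrite /determinant; apply: rpred_sum => s _.
apply: rpredM; first by rewrite rpredX// rpredN rpred1.
by apply: rpred_prod => i _.
Qed.

(* A tuple of lattice vectors with smallest non-zero determinant is a basis:
   otherwise some coordinate has a non-trivial fractional part, by which the
   determinant could be reduced. *)
Lemma lattice_basis L : is_lattice L -> exists2 A, A \in unitmx &
  forall x, L x <-> exists m : 'I_d -> int, x = (\row_j (m j)%:~R) *m A.
Proof.
move=> Llat; have [L0 LB _ _] := Llat.
have [A0 uA0 LA0] := lattice_full_rank Llat.
have [P P0 hP] := lattice_finite_index Llat uA0 LA0.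
have dA0 : \det A0 != 0 by move: uA0; rewrite unitmxE unitfE.
(* Clearing denominators with [P] makes these normalised determinants integers, so that a smallest
   non-zero modulus exists. *)
pose nd A : R := P%:R ^+ d * \det A / \det A0.
have ndint A : (forall i, L (row i A)) -> nd A \is a Num.int.
  move=> LA; have -> : nd A = \det (P%:R *: (A *m invmx A0)).
    by rewrite detZ det_mulmx det_inv mulrA.
  apply: det_int => i j; have [m hm] := hP _ (LA i).
  rewrite -row_mul in hm; have := congr1 (fun v : E => v 0 j) hm.
  by rewrite mxE [X in _ * X]mxE [RHS]mxE [X in X \is a _]mxE => ->; exact: intr_int.
have nd0 A : \det A != 0 -> nd A != 0.
  move=> dA; rewrite /nd !mulf_neq0 ?invr_eq0// expf_neq0// pnatr_eq0.
  by rewrite -lt0n.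
pose pr (n : nat) := `[< exists A, [/\ forall i, L (row i A), \det A != 0 & `|nd A| = n%:R] >].
have exn : exists n, pr n.
  have /natrP[n hn] : `|nd A0| \is a Num.nat by rewrite natr_norm_int// ndint.
  by exists n; apply/asboolP; exists A0.
case: (ex_minnP exn) => n /asboolP[A [LA dA nA]] nmin.
have uA : A \in unitmx by rewrite unitmxE unitfE.
exists A => // x; split=> [Lx|[m ->]]; last exact: (lattice_comb L0 LB).
pose c := x *m invmx A.
exists (fun j => Num.floor (c 0 j)).
have xc : x = c *m A by rewrite /c mulmxKV.
pose t : E := c - \row_j (Num.floor (c 0 j))%:~R.
suff t0 : t = 0 by rewrite {1}xc; congr (_ *m _); apply/eqP; rewrite -subr_eq0 -/t t0.
apply/rowP => i; rewrite [RHS]mxE; apply: contrapT => /eqP ti.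
have t01 : 0 <= t 0 i < 1.
  have -> : t 0 i = c 0 i - (Num.floor (c 0 i))%:~R.
    by rewrite /t mxE; congr (_ + _); rewrite !mxE.
  have /andP[h1 h2] := mem_rg1_floor (c 0 i).
  by move: h1 h2; rewrite ?intrD => h1 h2; apply/andP; split; lra.
(* Putting the lattice vector [t *m A] in row [i] multiplies the determinant by [t 0 i], which is
   strictly between 0 and 1. *)
pose A' := \matrix_k (if k == i then t *m A else row k A).
have dA' : \det A' = t 0 i * \det A by exact: det_replace_row.
have LA' k : L (row k A').
  rewrite rowK; case: eqP => // _; rewrite mulmxBl -xc; apply: (LB) => //.
  exact: (lattice_comb L0 LB).
have dA'0 : \det A' != 0 by rewrite dA' mulf_neq0.
have nA' : `|nd A'| = t 0 i * n%:R.
  rewrite -nA /nd dA' (_ : _ / _ = t 0 i * (P%:R ^+ d * \det A / \det A0)); last by ring.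
  by rewrite normrM ger0_norm//; case/andP: t01.
have /natrP[n' hn'] : `|nd A'| \is a Num.nat by rewrite natr_norm_int// ndint.
have : (n <= n')%N by apply: nmin; apply/asboolP; exists A'.
apply/negP; rewrite -ltnNge -(ltr_nat R) -hn' nA' -[ltRHS]mul1r ltr_pM2r.
  by case/andP: t01.
by rewrite -nA normr_gt0 nd0.
Qed.

End LatticeBasis.

(** * Norms, cones, separation from the dual lattice, and cells *)

Section Geometry.
Context {R : realType} {d : nat}.
Local Notation C := (complex R).
Local Notation E := 'rV[R]_d.
Implicit Types (x y xi mu : E) (W K G : set E) (B : 'M[R]_d).

Lemma rV_norm_leP x (b : R) : 0 <= b -> (forall j, `|x 0 j| <= b) <-> `|x| <= b.
Proof.
move=> b0; rewrite [X in _ <-> X <= _]/Num.norm /= mx_normrE; split=> [h|h j].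
  by apply/bigmax_leP; split=> // -[i j] _ /=; rewrite ord1.
by move/bigmax_leP: h => [_ /(_ (0, j) isT)].
Qed.

Lemma coord_le_norm x j : `|x 0 j| <= `|x|.
Proof. exact: ((rV_norm_leP x (normr_ge0 x)).2 (lexx _) j). Qed.

Lemma norm_le_enorm x : `|x| <= enorm x.
Proof.
apply/rV_norm_leP => [|j]; first exact: sqrtr_ge0.
rewrite -sqrtr_sqr ler_wsqrtr// /dotv (bigD1 j)//= -expr2 lerDl sumr_ge0// => i _.
by rewrite -expr2 sqr_ge0.
Qed.

Lemma enorm_le_norm x : enorm x <= d%:R * `|x|.
Proof.
rewrite -[leRHS]ger0_norm ?mulr_ge0// -sqrtr_sqr ler_wsqrtr//.
apply: (@le_trans _ _ (\sum_(i < d) `|x| ^+ 2)).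
  apply: ler_sum => i _; rewrite -expr2 -real_normK ?num_real// lerXn2r ?nnegrE//.
  exact: coord_le_norm.
rewrite sumr_const card_ord -[leLHS]mulr_natl exprMn ler_wpM2r ?sqr_ge0//.
by rewrite -natrX ler_nat; case: (d) => // n; rewrite expnS leq_pmulr// expn1.
Qed.

Lemma conic_shrink G xi : xi != 0 -> open_conic_nbhd xi G ->
  exists (G' : set E) (e : R), [/\ open_conic_nbhd xi G', 0 < e <= 1 / 2 &
    forall x mu, G' x -> `|mu - x| < e * `|x| -> G mu].
Proof.
move=> xi0 [oG Gxi _ cG].
have [r /= r0 hr] : nbhs_ball xi G.
  by rewrite nbhs_ballE; apply: open_nbhs_nbhs; split.
have nxi : 0 < `|xi| by rewrite normr_gt0.
(* The new cone is generated by the ball of radius [s]. The bound [|xi| / 2] keeps 0 out of it and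
   gives [|x| <= 2 t |xi|]; half of [r] is left for the perturbation [mu - x], which fixes [e]. *)
pose s := Num.min (r / 2) (`|xi| / 2).
have s0 : 0 < s by rewrite lt_min !divr_gt0.
have sr : s <= r / 2 by rewrite ge_min lexx.
have sxi : s <= `|xi| / 2 by rewrite ge_min lexx orbT.
pose e := Num.min (1 / 2) (r / (4 * `|xi|)).
have e0 : 0 < e by rewrite lt_min !divr_gt0// mulr_gt0.
have e1 : e <= 1 / 2 by rewrite ge_min lexx.
have er : e * (4 * `|xi|) <= r.
  by rewrite -ler_pdivlMr ?mulr_gt0// ge_min lexx orbT.
exists [set x | exists2 t : R, 0 < t & `|x - t *: xi| < t * s], e; split; last first.
- move=> x mu [t t0 hx] hmu.
  have nx : `|x| <= 2 * (t * `|xi|).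
    rewrite -[x](subrK (t *: xi)); apply: le_trans (ler_normD _ _) _.
    by rewrite normrZ (gtr0_norm t0); nra.
  have hb : `|mu - t *: xi| < t * r.
    rewrite (_ : mu - t *: xi = (mu - x) + (x - t *: xi)); last by rewrite addrA subrK.
    apply: le_lt_trans (ler_normD _ _) _.
    have h1 : `|mu - x| < t * r / 2.
      apply: lt_le_trans hmu _; apply: (@le_trans _ _ (e * (2 * (t * `|xi|)))).
        by rewrite ler_wpM2l// ltW.
      by nra.
    have h2 : `|x - t *: xi| < t * r / 2 by apply: lt_le_trans hx _; nra.
    by lra.
  rewrite (_ : mu = t *: (t^-1 *: mu)); last by rewrite scalerA mulfV ?gt_eqF// scale1r.
  apply: cG => //; apply: hr; rewrite -ball_normE /= -normrN opprB.
  rewrite (_ : _ - xi = t^-1 *: (mu - t *: xi)); last first.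
    by rewrite scalerBr scalerA mulVf ?gt_eqF// scale1r.
  by rewrite normrZ gtr0_norm ?invr_gt0// ltr_pdivrMl.
- by rewrite e0 e1.
- split.
  + rewrite openE => x [t t0 hx]; rewrite /interior.
    have q0 : 0 < t * s - `|x - t *: xi| by rewrite subr_gt0.
    have := nbhsx_ballx x _ q0; rewrite -ball_normE; apply: filterS => y /= hy.
    exists t => //; rewrite (_ : y - t *: xi = (y - x) + (x - t *: xi)).
      apply: le_lt_trans (ler_normD _ _) _.
      by move: hy; rewrite -normrN opprB; lra.
    by rewrite addrA subrK.
  + by exists 1 => //; rewrite scale1r subrr normr0 mul1r.
  + case=> t t0; rewrite sub0r normrN normrZ gtr0_norm// ltr_pM2l//.
    by rewrite ltNge; apply/negP/negPn; lra.
  + move=> t y t0 [t' t'0 hy]; exists (t * t'); first exact: mulr_gt0.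
    by rewrite -scalerA -scalerBr normrZ gtr0_norm// -mulrA ltr_pM2l.
Qed.

Lemma dist_int_ge (u : R) (m : int) : `|u - (rnd u)%:~R| <= `|u - m%:~R|.
Proof.
have [h|h] := ltP `|u - m%:~R| (1 / 2); first by rewrite (rnd_unique h).
exact: le_trans (rndP u) h.
Qed.

(** Compactness makes a local statement uniform. Near [x0] all coordinates are small, forcing
    [m = 0]; near any other point of [K] some coordinate keeps away from the integers and no [m] is
    admissible. *)
Lemma separated_exists K B (x0 : E) : compact K ->
  (forall x, K x -> (forall j, lin x0 (row j B) x \is a Num.int) -> x = x0) ->
  exists2 delta, 0 < delta <= 1 / 4 & dual_separated K B x0 delta.
Proof.
move=> /compact_near_coveringP cK hK.
pose P (r : R) x := forall m : 'I_d -> int,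
  (forall j, `|lin x0 (row j B) x - (m j)%:~R| < r) -> forall j, m j = 0.
have near_lin x j (r : R) : 0 < r ->
    \forall y \near x, `|lin x0 (row j B) y - lin x0 (row j B) x| < r.
  move=> r0; have := @lin_continuous _ _ x0 (row j B) x.
  move=> /cvgrPdist_lt /(_ r r0); apply: filterS => y.
  by rewrite -normrN opprB.
have : \forall r \near 0^'+, K `<=` P r.
  apply: cK => x Kx.
  have [hint|] := pselect (forall j, lin x0 (row j B) x \is a Num.int).
    have xx0 := hK x Kx hint.
    exists ([set y : E | forall j, `|lin x0 (row j B) y - lin x0 (row j B) x| < 1 / 4],
       [set r : R | r < 1 / 4]).
      split => /=; last by apply: nbhs_right_lt; lra.
      apply: (@filter_forall _ 'I_d (fun j => [set y | `|lin x0 (row j B) y -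
        lin x0 (row j B) x| < 1 / 4]) (nbhs x) (nbhs_filter x)) => j.
      by apply: near_lin; lra.
    move=> [y r] /= [hy hr] m hm j.
    have lx0 : lin x0 (row j B) x = 0.
      by rewrite xx0 /lin subrr /dotv big1// => i _; rewrite mxE mul0r.
    have := hy j; have := hm j; rewrite lx0 subr0 => h1 h2.
    have h3 : `|(m j)%:~R| < 1 :> R.
      rewrite (_ : (m j)%:~R = lin x0 (row j B) y - (lin x0 (row j B) y - (m j)%:~R)).
        by apply: le_lt_trans (ler_normB _ _) _; lra.
      by ring.
    by move: h3; rewrite -intr_norm -[1]/(1%:~R) ltr_int; lia.
  move=> /existsNP[j hj].
  set u := lin x0 (row j B) x in hj.
  have q0 : 0 < `|u - (rnd u)%:~R|.
    rewrite normr_gt0 subr_eq0; apply/eqP => e; apply: hj.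
    by rewrite e; exact: intr_int.
  set q := `|u - _| in q0.
  exists ([set y : E | `|lin x0 (row j B) y - u| < q / 2], [set r : R | r < q / 2]).
    split => /=; last by apply: nbhs_right_lt; lra.
    by apply: near_lin; lra.
  move=> [y r] /= [hy hr] m hm; exfalso.
  have := dist_int_ge u (m j); rewrite -/q; have := hm j.
  rewrite (_ : u - (m j)%:~R = (lin x0 (row j B) y - (m j)%:~R) - (lin x0 (row j B) y - u)).
    have := ler_normB (lin x0 (row j B) y - (m j)%:~R) (lin x0 (row j B) y - u); lra.
  by ring.
move=> hP; have : \forall r \near (0 : R)^'+, K `<=` P r /\ 0 < r <= 1 / 4.
  near=> r; split; first by near: r.
  apply/andP; split; near: r; first exact: nbhs_right_gt.
  by apply: nbhs_right_le; lra.
move=> hP2; have [r [KP r0]] := @filter_ex _ _ (at_right_proper_filter (0 : R)) _ hP2; exists r => // x m Kx; exact: KP.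
Unshelve. all: by end_near. Qed.

Definition cell B (x0 : E) (a : R) : set E := [set x | forall j, `|lin x0 (row j B) x| <= a].

Lemma norm_mulmx_le (u : E) B (b : R) : 0 <= b -> (forall j, `|u 0 j| <= b) ->
  `|u *m B| <= b * \sum_i \sum_j `|B i j|.
Proof.
move=> b0 hu; have S0 : 0 <= \sum_i \sum_j `|B i j|.
  by apply: sumr_ge0 => i _; exact: sumr_ge0.
apply/rV_norm_leP => [|j]; first exact: mulr_ge0.
rewrite mxE; apply: le_trans (ler_norm_sum _ _ _) _.
rewrite mulr_sumr; apply: ler_sum => i _; rewrite normrM ler_pM//.
by rewrite (bigD1 j)//= lerDl sumr_ge0.
Qed.

Lemma cell_norm B (x0 : E) (a : R) x : B \in unitmx -> 0 <= a -> cell B x0 a x ->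
  `|x - x0| <= a * \sum_i \sum_j `|invmx B^T i j|.
Proof.
move=> uB a0 hx; have uBT : B^T \in unitmx by rewrite unitmx_tr.
have -> : x - x0 = (\row_j lin x0 (row j B) x) *m invmx B^T.
  rewrite (_ : (\row_j _) = (x - x0) *m B^T) ?mulmxK//.
  by apply/rowP => j; rewrite !mxE /lin /dotv; apply: eq_bigr => i _; rewrite !mxE.
by apply: norm_mulmx_le => // j; rewrite mxE.
Qed.

Lemma cell_closed B (x0 : E) (a : R) : closed (cell B x0 a).
Proof.
rewrite (_ : cell B x0 a = \bigcap_(j in setT) ((fun x => `|lin x0 (row j B) x|) @^-1` [set r | r <= a])).
  apply: closed_bigI => j _; apply: closed_comp => [x _|]; last exact: closed_le.
  apply: (@continuous_comp _ _ _ (lin x0 (row j B)) (fun t : R => `|t|)).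
    exact: lin_continuous.
  exact: norm_continuous.
by apply/seteqP; split=> [x h j _|x h j]; [exact: h|exact: (h j I)].
Qed.

Lemma cell_compact B (x0 : E) (a : R) : B \in unitmx -> 0 <= a -> compact (cell B x0 a).
Proof.
move=> uB a0; apply: bounded_closed_compact; last exact: cell_closed.
exists (a * \sum_i \sum_j `|invmx B^T i j| + `|x0|); split; first exact: num_real.
move=> M hM x hx; apply: le_trans (ltW hM).
rewrite -[x](subrK x0); apply: le_trans (ler_normD _ _) _; rewrite lerD2r.
exact: cell_norm.
Qed.

Lemma cell_sub W B (x0 : E) : open W -> W x0 -> B \in unitmx ->
  exists2 rho : R, 0 < rho & forall a, a <= rho -> cell B x0 a `<=` W.
Proof.
move=> oW Wx0 uB.
have [r /= r0 hr] : nbhs_ball x0 W.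
  by rewrite nbhs_ballE; apply: open_nbhs_nbhs; split.
set S := \sum_i \sum_j `|invmx B^T i j|.
have S0 : 0 <= S by apply: sumr_ge0 => i _; exact: sumr_ge0.
exists (r / (S + 1)); first by rewrite divr_gt0//; lra.
have rS0 : 0 <= r / (S + 1) by rewrite divr_ge0//; lra.
move=> a ha x hx; apply: hr; rewrite -ball_normE /= -normrN opprB.
have hx' : cell B x0 (r / (S + 1)) x by move=> j; exact: le_trans (hx j) ha.
apply: le_lt_trans (cell_norm uB rS0 hx') _.
by rewrite -/S mulrAC ltr_pdivrMr; nra.
Qed.

End Geometry.

(** * Fourier transforms of cut-off functionals *)

Section CutoffEstimates.
Context {R : realType} {d : nat}.
Local Notation C := (complex R).
Local Notation E := 'rV[R]_d.
Implicit Types (x y xi mu eta : E) (W K G : set E) (B : 'M[R]_d) (T : nat -> R -> R).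

Lemma dominated_bounded W K N (c : R) F : compact K -> K `<=` W -> 0 <= c ->
  (forall p, dominated W K N c (F p)) -> bounded_sequence W F.
Proof.
move=> cK KW c0 hF; split=> [p|Bs [Bsm hB]].
  by case: (hF p) => lF bF; split=> //; exists K, c, N.
have [M hM] := hB K N cK KW; exists (c * M) => p phi Bphi.
have [_ bF] := hF p; apply: le_trans (bF _ (Bsm _ Bphi)) _.
by rewrite ler_wpM2l// hM.
Qed.

Lemma sm_union W W' k (f : E -> C) : Ck W k f -> Ck W' k f -> Ck (W `|` W') k f.
Proof.
elim: k f => [|k IH] f [c1 h1] [c2 h2].
  by split=> // x [Wx|Wx]; [exact: c1|exact: c2].
split=> [x [Wx|Wx]|j]; [exact: c1|exact: c2|].
have [d1 s1] := h1 j; have [d2 s2] := h2 j.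
by split=> [x [Wx|Wx]|]; [exact: d1|exact: d2|exact: IH].
Qed.

Lemma chi_outside_cell T B (x0 : E) (a : R) x :
  (forall u : R, a <= `|u| -> T 0%N u = 0) -> ~ cell B x0 a x -> chi T B x0 x = 0.
Proof.
move=> hT /existsNP[j /negP]; rewrite -ltNge => hj.
by rewrite /chi (bigD1 j)//= hT ?mul0r// ltW.
Qed.

(** Off [W] the function [phi] is arbitrary, but the product is locally 0 there: [W] and the
    complement of the cell are open and cover the space. *)
Lemma smooth_chi_mul W T B (x0 : E) (a : R) (phi : E -> C) : open W ->
  tower T -> (forall u : R, a <= `|u| -> T 0%N u = 0) -> cell B x0 a `<=` W ->
  smooth W phi -> forall k, Ck setT k (fun x => chi T B x0 x * phi x).
Proof.
move=> oW tT hT cW sphi k.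
have oC : open (~` cell B x0 a) by apply: closed_openC; exact: cell_closed.
rewrite (_ : setT = W `|` ~` cell B x0 a); last first.
  apply/seteqP; split=> x // _; have [/cW|] := pselect (cell B x0 a x); first by left.
  by right.
apply: sm_union.
  by apply: smM => //; [exact: sm_sub (sm_chi _ _ _ tT)|exact: sm_of_smooth].
apply: (@eq_sm _ _ _ _ (fun=> 0)) => //; last exact: sm_cst.
by move=> x hx; rewrite (chi_outside_cell hT)// mul0r.
Qed.

Lemma bd_chi T B (x0 : E) (N : nat) (bB b : R) : tower T -> 1 <= bB -> 0 <= b ->
  (forall j i, `|row j B 0 i| <= bB) ->
  (forall m u, (m <= N)%N -> `|T m u| <= b) ->
  Ck_bound setT N (chi T B x0) ((2 ^+ N * (bB ^+ N * b)) ^+ d).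
Proof.
move=> tT bB1 b0 hB hT.
have sz : size (index_enum 'I_d) = d by rewrite -[RHS]card_ord cardE enumT.
suff : Ck_bound setT N (chi T B x0) ((2 ^+ N * (bB ^+ N * b)) ^+ size (index_enum 'I_d)).
  by rewrite sz.
apply: (bd_prod (@openT E) (@subset_refl _ setT)).
- by rewrite mulr_ge0// exprn_ge0//; lra.
- by move=> j _; exact: (sm_lin N 0 x0 (row j B) (ctower_real tT)).
- move=> j _; apply: (bd_lin (T := fun m u => (T m u)%:C%C)) => //.
    exact: ctower_real.
  by move=> m u hm; rewrite cmod_real hT.
Qed.

(** Multiplication by [chi] moves the compact set from [K] into the cell, hence from [W1] to [W2]:
    the product vanishes on the open complement of the cell, so only derivatives on the cell
    count. *)
Lemma cutoff_dominated W1 W2 K N (c a s : R) F T B (x0 : E) : open W1 -> open W2 ->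
  K `<=` W1 -> 0 <= c -> dominated W1 K N c F -> 0 <= a -> B \in unitmx ->
  tower T -> (forall u : R, a <= `|u| -> T 0%N u = 0) -> cell B x0 a `<=` W2 ->
  0 <= s -> Ck_bound setT N (chi T B x0) s ->
  dominated W2 (cell B x0 a) N (c * (2 ^+ N * s)) (fun phi => F (fun x => chi T B x0 x * phi x)).
Proof.
move=> oW1 oW2 KW1 c0 [lF bF] a0 uB tT hT cW2 s0 hs.
have schi phi : smooth W2 phi -> smooth W1 (fun x => chi T B x0 x * phi x).
  by move=> sphi; apply: smooth_of_sm => // k; exact: (smooth_chi_mul oW2 tT hT cW2 sphi).
split=> [al phi psi sphi spsi|phi sphi].
  rewrite -lF; [|exact: schi|exact: schi].
  by congr F; apply/funext => x; ring.
apply: le_trans (bF _ (schi _ sphi)) _; rewrite -mulrA ler_wpM2l//.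
have oC : open (~` cell B x0 a) by apply: closed_openC; exact: cell_closed.
have cC : compact (cell B x0 a) by exact: cell_compact.
apply: seminorm_le; first by rewrite !mulr_ge0 ?exprn_ge0// seminorm_ge0.
have b1 : Ck_bound (cell B x0 a) N (fun x => chi T B x0 x * phi x)
    (2 ^+ N * s * seminorm (cell B x0 a) N phi).
  have sphi' := sm_of_smooth N oW2 sphi.
  apply: (bdM oW2 cW2 s0 (seminorm_ge0 _ _ _) _ sphi').
  - exact: sm_sub (sm_chi B x0 N tT).
  - exact: bd_sub hs.
  - exact: bd_seminorm sphi'.
have b2 : Ck_bound (~` cell B x0 a) N (fun x => chi T B x0 x * phi x) 0.
  apply: (eq_bd oC (@subset_refl _ _) (f := fun=> 0)).
    by move=> x hx; rewrite (chi_outside_cell hT)// mul0r.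
  by have := @bd_cst R d (~` cell B x0 a) N 0; rewrite cmod0.
move=> t x tN Kx; have [hx|hx] := pselect (cell B x0 a x); first exact: b1.
apply: le_trans (b2 t x tN hx) _.
by rewrite !mulr_ge0 ?exprn_ge0// seminorm_ge0.
Qed.

Lemma sum_prod_weights eta n :
  \sum_(k : {ffun 'I_d -> 'I_(2 * n).+1})
    \prod_j (1 + `|eta 0 j - freqv eta k 0 j|) ^- 2 <= 6 ^+ d.
Proof.
rewrite (eq_bigr (fun k : {ffun 'I_d -> 'I_(2 * n).+1} =>
    \prod_j (1 + `|eta 0 j - (freq (eta 0 j) n (k j))%:~R|) ^- 2)); last first.
  by move=> k _; apply: eq_bigr => j _; rewrite mxE.
rewrite -(bigA_distr_bigA (fun j (r : 'I_(2 * n).+1) =>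
  (1 + `|eta 0 j - (freq (eta 0 j) n r)%:~R|) ^- 2)).
rewrite -[X in _ <= _ ^+ X]card_ord -prodr_const; apply: ler_prod => j _.
rewrite sum_weights andbT; apply: sumr_ge0 => r _.
by rewrite invr_ge0 exprn_ge0// addr_ge0.
Qed.

(** [D0] is the cost of two derivatives of the cutoff, paid in every coordinate; [D1] is the cost of
    [p + N + 2], paid once, in the coordinate where the frequency deviates most from [xi]. [Y]
    covers the frequencies near [xi], and [6 ^+ d] sums the weights. *)
Lemma fourier_cutoff_estimate W K N (c delta e Y D0 D1 : R) (p : nat) F B (x0 : E) T
    (b : nat -> R) xi :
  open W -> compact K -> K `<=` W -> 0 <= c -> dominated W K N c F -> B \in unitmx ->
  tower T -> (forall u : R, delta / 2 <= `|u| -> T 0%N u = 0) ->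
  (forall m u, `|T m u| <= b m) -> 0 < delta <= 1 / 4 -> dual_separated K B x0 delta ->
  1 <= D0 -> 2 ^+ 3 * (b 0%N + b 2%N) <= D0 ->
  2 ^+ (p + N).+3 * (b 0%N + b (p + N).+2) <= D1 ->
  0 < e -> 1 <= `|xi| -> 0 <= Y ->
  (forall m : 'I_d -> int, let mu := (\row_j (m j)%:~R) *m B in
    `|mu - xi| < e * `|xi| -> cmod (F (wave mu)) * `|xi| ^+ p <= Y) ->
  forall S e' : R, S = 1 + \sum_i \sum_j `|B i j| -> e' = e / S ->
  cmod (F (fun x => chi T B x0 x * wave xi x)) * `|xi| ^+ p <=
  (D0 ^+ d * (Y + D1 * (c * (2 * pi * (e'^-1 + S)) ^+ N / e' ^+ p))) * 6 ^+ d.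
Proof.
move=> oW cK KW c0 dF uB tT hT hb d0 sK D01 hD0 hD1 e0 xi1 Y0 hnear S e' SE e'E.
have dd : delta <= 1 / 4 by case/andP: d0.
have hT8 u : 1 / 8 <= `|u| -> T 0%N u = 0 by move=> hu; apply: hT; lra.
have S1 : 1 <= S by rewrite SE lerDl; apply: sumr_ge0 => i _; exact: sumr_ge0.
have e'0 : 0 < e' by rewrite e'E divr_gt0//; lra.
have b0 m : 0 <= b m by exact: le_trans (normr_ge0 _) (hb m 0).
have D10 : 0 <= D1.
  by apply: le_trans hD1; rewrite mulr_ge0 ?exprn_ge0// addr_ge0.
pose H := e'^-1 + S.
have H0 : 0 < H by rewrite addr_gt0 ?invr_gt0//; lra.
have pi2 := @pi_ge2 R.
set Z := c * (2 * pi * (e'^-1 + S)) ^+ N / e' ^+ p.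
have Z0 : 0 <= Z.
  have pH : 0 <= 2 * pi * H by rewrite !mulr_ge0//; lra.
  by rewrite divr_ge0 ?(exprn_ge0 _ (ltW e'0))// mulr_ge0// exprn_ge0.
have Dd0 : 0 <= D0 ^+ d by rewrite exprn_ge0//; lra.
have X0 : 0 < `|xi| by lra.
have Xp : 0 < `|xi| ^+ p by rewrite exprn_gt0.
pose eta := xi *m invmx B.
have xiE : xi = eta *m B by rewrite /eta mulmxKV.
(* The number of nodes is sent to infinity: the interpolation error is an arbitrary [ep] divided by
   [|xi| ^ p]. *)
apply/ler_addgt0Pr => ep ep0.
have [n0 hn0] := cutoff_wave_estimate eta oW cK KW c0 dF tT hT hb d0 sK
  (divr_gt0 ep0 Xp).
have [n [hn1 hn2]] : exists n, (n0 <= n)%N /\ (2 * (p + N).+2 <= n)%N.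
  by exists (maxn n0 (2 * (p + N).+2)); split; [exact: leq_maxl|exact: leq_maxr].
have {}hn0 := hn0 n hn1; rewrite -xiE in hn0.
apply: le_trans (ler_wpM2r (ltW Xp) hn0) _.
rewrite mulrDl divfK ?gt_eqF// lerD2r.
apply: le_trans (ler_wpM2l _ (sum_prod_weights eta n)); last first.
  by apply: mulr_ge0 => //; rewrite addr_ge0// mulr_ge0.
rewrite mulr_suml mulr_sumr; apply: ler_sum => k _.
pose rho j := `|eta 0 j - freqv eta k 0 j|.
pose w j : R := (1 + rho j) ^- 2.
pose cf j := cmod (coef (T 0%N) (eta 0 j) n (freqv eta k 0 j)).
rewrite -/(\prod_j cf j) -/(\prod_j w j).
have rho0 j : 0 <= rho j by exact: normr_ge0.
have rho1 j : 0 < 1 + rho j by have := rho0 j; lra.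
have w0 j : 0 <= w j by rewrite invr_ge0 exprn_ge0// ltW.
have cf0 j : 0 <= cf j by exact: cmod_ge0.
have hrho j : rho j <= mesh n / 2.
  by rewrite /rho [freqv _ _ _ _]mxE; exact: (freq_near (eta 0 j) (ltn_ord (k j))).1.
have h0 j : cf j <= D0 * w j.
  have h := @coef_decay R T _ _ (eta 0 j) (freqv eta k 0 j) n 2 tT hT8 _ (hrho j) (hb 0%N) (hb 2%N).
  rewrite ler_pdivlMr ?exprn_gt0// mulrC; apply: le_trans (h _) hD0.
  by apply: leq_trans hn2; rewrite leq_mul2l.
have h1 j : cf j * rho j ^+ (p + N) <= D1 * w j.
  have h := @coef_decay R T _ _ (eta 0 j) (freqv eta k 0 j) n (p + N).+2 tT hT8 hn2
    (hrho j) (hb 0%N) (hb _).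
  rewrite ler_pdivlMr ?exprn_gt0//; apply: le_trans hD1; apply: le_trans h.
  rewrite -/(rho j) -/(cf j) -mulrA mulrC -[(p + N).+2]addn2.
  rewrite [(1 + rho j) ^+ (p + N + 2)]exprD ler_wpM2r// ler_wpM2r//.
    by rewrite exprn_ge0// ltW.
  by rewrite lerXn2r ?nnegrE ?lerDr//; exact: ltW.
have prodD (P : pred 'I_d) : \prod_(j | P j) cf j <= \prod_(j | P j) (D0 * w j).
  by apply: ler_prod => j _; rewrite cf0 h0.
have w_all : \prod_j (D0 * w j) = D0 ^+ d * \prod_j w j.
  by rewrite big_split /= prodr_const card_ord.
have pw0 : 0 <= \prod_j w j by apply: prodr_ge0 => j _.
set mu := freqv eta k *m B.
have [near|far] := ltP `|mu - xi| (e * `|xi|).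
  have hY : cmod (F (wave mu)) * `|xi| ^+ p <= Y by exact: hnear near.
  rewrite -mulrA; apply: (@le_trans _ _ (\prod_j cf j * Y)).
    by rewrite ler_wpM2l// prodr_ge0.
  apply: (@le_trans _ _ (D0 ^+ d * \prod_j w j * Y)).
    by rewrite ler_wpM2r// -w_all.
  rewrite mulrAC ler_wpM2r// ler_wpM2l// lerDl mulr_ge0//.
(* A maximum over the coordinates needs an index; [1 <= |xi|] excludes [d = 0]. *)
have [j00 _] : exists j : 'I_d, True.
  apply: contrapT => hno; have : `|xi| <= 0.
    by apply/rV_norm_leP => // j; exfalso; apply: hno; exists j.
  by lra.
have [j0 hj0] : exists j0, forall j, rho j <= rho j0.
  have := @Order.TotalTheory.arg_maxP _ R 'I_d j00 predT rho isT.
  by case=> j0 _ hj0; exists j0 => j; exact: hj0.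
set r := rho j0.
have r0 : 0 <= r by exact: rho0.
have hdist : `|mu - xi| <= r * S.
  rewrite /mu {1}xiE -mulmxBl; apply: le_trans (norm_mulmx_le _ r0 _) _.
    by move=> j; rewrite mxE [X in _ + X]mxE -normrN opprB; exact: hj0.
  by rewrite ler_wpM2l// SE lerDr.
(* Far from [xi] the largest deviation [r] dominates [|xi|], so powers of [r] pay for both
   [|xi| ^ p] and the growth of [F (wave mu)]. *)
have xr : `|xi| <= r / e'.
  rewrite ler_pdivlMr// e'E mulrA ler_pdivrMr; last by lra.
  by rewrite mulrC; exact: le_trans far hdist.
have Hr1 : 1 <= H * r.
  rewrite /H mulrDl; apply: le_trans xi1 _; apply: le_trans xr _.
  by rewrite mulrC lerDl mulr_ge0//; lra.
have muH : `|mu| <= H * r.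
  rewrite -[mu](subrK xi) addrC; apply: le_trans (ler_normD _ _) _.
  by rewrite /H mulrDl mulrC (mulrC S) lerD.
have Fmu : cmod (F (wave mu)) <= c * (2 * pi * H) ^+ N * r ^+ N.
  have bw : Ck_bound K N (wave mu) ((2 * pi * (H * r)) ^+ N).
    apply: (@bd_sub _ _ setT) => //; apply: wave_bd => // j.
    exact: le_trans (coord_le_norm _ _) muH.
  apply: le_trans (dF.2 _ (smooth_of_sm oW (fun l => wave_sm l mu))) _.
  rewrite -[leRHS]mulrA ler_wpM2l// -exprMn -[2 * pi * H * r]mulrA.
  apply: seminorm_le => //.
  by rewrite exprn_ge0// mulr_ge0 ?mulr_ge0// ?pi_ge0// ltW.
have xip : `|xi| ^+ p <= r ^+ p / e' ^+ p.
  rewrite -expr_div_n lerXn2r ?nnegrE//.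
  by rewrite divr_ge0// ltW.
have FZ : cmod (F (wave mu)) * `|xi| ^+ p <= Z * r ^+ (p + N).
  apply: (@le_trans _ _ (c * (2 * pi * H) ^+ N * r ^+ N * (r ^+ p / e' ^+ p))).
    exact: (ler_pM (cmod_ge0 _) (ltW Xp) Fmu xip).
  by rewrite /Z -/H exprD le_eqVlt; apply/orP; left; apply/eqP; ring.
rewrite -mulrA; apply: (@le_trans _ _ (\prod_j cf j * (Z * r ^+ (p + N)))).
  by rewrite ler_wpM2l// prodr_ge0.
apply: (@le_trans _ _ (D1 * Z * \prod_j (D0 * w j))); last first.
  rewrite w_all mulrCA mulrA ler_wpM2r// ler_wpM2l// lerDr//.
rewrite (bigD1 j0)//= [in leRHS](bigD1 j0)//=.
set P1 := \prod_(j | _) cf j; set P2 := \prod_(j | _) (D0 * w j).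
have P12 : P1 <= P2 by exact: prodD.
have P10 : 0 <= P1 by rewrite prodr_ge0.
rewrite (_ : cf j0 * P1 * (Z * r ^+ (p + N)) = Z * (cf j0 * r ^+ (p + N) * P1)); last by ring.
rewrite (_ : D1 * Z * (D0 * w j0 * P2) = Z * (D0 * (D1 * w j0) * P2)); last by ring.
(* Coordinate [j0] spends the high-order decay, the others the quadratic one; [D0 >= 1] fills the
   place left free at [j0]. *)
rewrite ler_wpM2l//; apply: ler_pM => //.
  by rewrite mulr_ge0// exprn_ge0.
apply: le_trans (h1 j0) _; rewrite ler_peMl// mulr_ge0//.
Qed.

End CutoffEstimates.

(** * From lattice frequencies to a full cone, with uniform constants *)

Section Localisation.
Context {R : realType} {d : nat}.
Local Notation C := (complex R).
Local Notation E := 'rV[R]_d.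

Lemma chi_eq1 (T : nat -> R -> R) (B : 'M[R]_d) (x0 x : E) (r : R) :
  (forall u : R, `|u| < r -> T 0%N u = 1) -> thickening [set x0] B x0 r x ->
  chi T B x0 x = 1.
Proof.
move=> hT [y -> hx]; rewrite /chi big1// => j _; rewrite hT//.
have := hx j; rewrite (_ : lin x0 (row j B) x0 = 0) ?subr0//.
by rewrite /lin subrr /dotv big1// => i _; rewrite mxE mul0r.
Qed.

(** [W1] carries the given sequence and [W2] must carry the new one; the two inclusions exchange the
    roles of [Omega] and of its part in [x0 + U]. *)
Lemma localisation (W1 W2 V G : set E) (x0 xi0 : E) (B : 'M[R]_d) (K : set E)
    (N : nat) (c : R) (F : nat -> (E -> C) -> C) (f : (E -> C) -> C) (A D : R) :
  open W1 -> open W2 -> W2 x0 -> B \in unitmx -> xi0 != 0 ->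
  compact K -> K `<=` W1 -> 0 <= c -> (forall p, dominated W1 K N c (F p)) ->
  (forall x, K x -> (forall j, lin x0 (row j B) x \is a Num.int) -> x = x0) ->
  open V -> V x0 -> (forall p, eq_on V (F p) f) -> open_conic_nbhd xi0 G ->
  0 <= A -> 0 <= D ->
  (forall p (m : 'I_d -> int), let mu := (\row_j (m j)%:~R) *m B in G mu ->
    cmod (fourier (F p) mu) * enorm mu ^+ p <= A * D ^+ p * p`!%:R) ->
  exists (G' V' : set E) (F' : nat -> (E -> C) -> C),
    [/\ open_conic_nbhd xi0 G', open_nbhs x0 V' /\ V' `<=` V `&` W2,
        bounded_sequence W2 F', forall p, eq_on V' (F' p) f &
        exists A' D' : R, [/\ 0 < A', 0 < D' & forall p xi, G' xi ->
          cmod (fourier (F' p) xi) * enorm xi ^+ p <= A' * D' ^+ p * p`!%:R]].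
Proof.
move=> oW1 oW2 W2x0 uB xi00 cK KW1 c0 dF hK oV Vx0 eqF cG A0 D0 hF.
have [delta d0 sK] := separated_exists cK hK.
have [rho rho0 cW2] := cell_sub oW2 W2x0 uB.
have dpos : 0 < delta by case/andP: d0.
(* Below [delta / 2] the periodization is faithful near [K]; below [rho] the cutoff lives in
   [W2]. *)
pose a := Num.min (delta / 2) rho.
have a0 : 0 < a by rewrite lt_min rho0 andbT; lra.
have ad : a <= delta / 2 by rewrite ge_min lexx.
have cellW2 : cell B x0 a `<=` W2 by apply: cW2; rewrite ge_min lexx orbT.
have [cn [C1 [C10 hT]]] := exists_cutoffs a0.
have [T hT'] := choice hT.
have tT p : tower (T p) by have [h _ _ _ _] := hT' p; exact: h.
have Ta p u : a <= `|u| -> T p 0%N u = 0 by have [_ h _ _ _] := hT' p; exact: h.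
have T1 p u : `|u| < a / 8 -> T p 0%N u = 1 by have [_ _ h _ _] := hT' p; exact: h.
have Tc p n u : `|T p n u| <= cn n by have [_ _ _ h _] := hT' p; exact: h.
have Tp p n u : `|T p (n + p)%N u| <= cn n * (C1 ^+ p * p`!%:R).
  by have [_ _ _ _ h] := hT' p; exact: h.
have cn0 n : 0 <= cn n by exact: le_trans (normr_ge0 _) (Tc 0%N n 0).
have [bB bB1 hbB] := matrix_entries_bounded B.
pose b := \sum_(m < N.+1) cn m.
have b0 : 0 <= b by apply: sumr_ge0.
have Tb p m u : (m <= N)%N -> `|T p m u| <= b.
  move=> mN; apply: le_trans (Tc p m u) _.
  by rewrite /b (bigD1 (Ordinal (mN : m < N.+1)%N))//= lerDl sumr_ge0.
pose s := (2 ^+ N * (bB ^+ N * b)) ^+ d.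
have s0 : 0 <= s.
  by rewrite exprn_ge0// mulr_ge0 ?exprn_ge0// mulr_ge0 ?exprn_ge0//; lra.
have bs p : Ck_bound setT N (chi (T p) B x0) s by apply: bd_chi => // m u; exact: Tb.
pose F' p phi := F p (fun x => chi (T p) B x0 x * phi x).
have dF' p : dominated W2 (cell B x0 a) N (c * (2 ^+ N * s)) (F' p).
  exact: (cutoff_dominated oW1 oW2 KW1 c0 (dF p) (ltW a0) uB (tT p) (Ta p) cellW2 s0 (bs p)).
pose c' := c * (2 ^+ N * s).
have c'0 : 0 <= c' by rewrite mulr_ge0// mulr_ge0// exprn_ge0.
have cC : compact (cell B x0 a) by apply: cell_compact => //; exact: ltW.
have [G' [e [cG' /andP[e0 e1] hG']]] := conic_shrink xi00 cG.
pose V' := V `&` W2 `&` thickening [set x0] B x0 (a / 8).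
exists G', V', F'; split => //.
- split; last by move=> x [].
  split; first by apply: openI; [exact: openI|exact: open_thickening].
  split => //; exists x0 => // j; rewrite subrr normr0; lra.
- exact: (dominated_bounded cC cellW2 c'0 dF').
- move=> p phi [sphi cphi supp]; have <- : F p phi = f phi by apply: (eqF p); split=> // x /supp[[]].
  congr (F p _); apply/funext => x.
  have [->|nz] := eqVneq (phi x) 0; first by rewrite mulr0.
  rewrite (chi_eq1 (T1 p)) ?mul1r//.
  have sx : Defs.supp phi x by exact: (@subset_closure _ [set x | phi x != 0]).
  by have [] := supp x sx.
pose S := 1 + \sum_i \sum_j `|B i j|.
pose e' := e / S.
pose D0' := 1 + 2 ^+ 3 * (cn 0%N + cn 2%N).
pose D1' := 2 ^+ N.+3 * (cn 0%N + cn N.+2).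
pose Z := c * (2 * pi * (e'^-1 + S)) ^+ N.
(* [2 * D] is the rate of the near frequencies and [2 * (C1 + 1) / e'] that of the far ones; the
   final 1 gives [1 <= M]. *)
pose M := 2 * D + 2 * (C1 + 1) / e' + 1.
pose Q := D0' ^+ d * 6 ^+ d * (A + D1' * Z).
pose Q2 := c' * (2 * pi) ^+ N.
have pi2 := @pi_ge2 R.
have S1 : 1 <= S by rewrite lerDl; apply: sumr_ge0 => i _; exact: sumr_ge0.
have e'0 : 0 < e' by rewrite divr_gt0// (lt_le_trans ltr01 S1).
have D0'1 : 1 <= D0' by rewrite lerDl mulr_ge0 ?exprn_ge0// addr_ge0.
have D1'0 : 0 <= D1' by rewrite mulr_ge0 ?exprn_ge0// addr_ge0.
have Z0 : 0 <= Z.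
  rewrite mulr_ge0// exprn_ge0// mulr_ge0//; first by clear - pi2; lra.
  by rewrite addr_ge0 ?invr_ge0 ?(ltW e'0)// (le_trans ler01 S1).
have q0 : 0 <= 2 * (C1 + 1) / e' by rewrite divr_ge0 ?(ltW e'0)// mulr_ge0// addr_ge0// ltW.
have M1 : 1 <= M by rewrite lerDr addr_ge0// mulr_ge0.
have Q0 : 0 <= Q.
  rewrite /Q mulr_ge0//; last by rewrite addr_ge0// mulr_ge0.
  by rewrite mulr_ge0// exprn_ge0// (le_trans ler01 D0'1).
have Q20 : 0 <= Q2 by rewrite mulr_ge0// exprn_ge0//; clear - pi2; lra.
have dM0 : 0 <= d%:R * M by rewrite mulr_ge0// (le_trans ler01 M1).
exists (Q + Q2 + 1), (d%:R * M + 1); split.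
- by clear - Q0 Q20; lra.
- by clear - dM0; lra.
move=> p xi Gxi.
have pf : 1 <= p`!%:R :> R by rewrite ler1n fact_gt0.
have pf0 : 0 <= p`!%:R :> R by [].
have dMp : (d%:R * M) ^+ p <= (d%:R * M + 1) ^+ p.
  by rewrite lerXn2r ?nnegrE//; clear - dM0; lra.
have enp : enorm xi ^+ p <= d%:R ^+ p * `|xi| ^+ p.
  by rewrite -exprMn lerXn2r ?nnegrE ?sqrtr_ge0 ?mulr_ge0 ?enorm_le_norm.
have cm0 := cmod_ge0 (fourier (F' p) xi).
have [xi1|xi1] := leP 1 `|xi|; last first.
  have hQ2 : cmod (fourier (F' p) xi) <= Q2.
    apply: le_trans ((dF' p).2 _ (smooth_of_sm oW2 (fun l => wave_sm l xi))) _.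
    rewrite ler_wpM2l// -[2 * pi]mulr1; apply: seminorm_le.
      by rewrite exprn_ge0//; clear - pi2; lra.
    apply: (@bd_sub _ _ setT) => //; apply: wave_bd => // j.
    exact: le_trans (coord_le_norm _ _) (ltW xi1).
  apply: (@le_trans _ _ (Q2 * (d%:R * M) ^+ p)).
    apply: ler_pM => //; first by rewrite exprn_ge0// sqrtr_ge0.
    apply: le_trans enp _; rewrite exprMn ler_wpM2l ?exprn_ge0//.
    apply: (@le_trans _ _ 1); first by rewrite exprn_ile1// ltW.
    by rewrite exprn_ege1.
  apply: (@le_trans _ _ ((Q + Q2 + 1) * (d%:R * M + 1) ^+ p)).
    by apply: ler_pM => //; [rewrite exprn_ge0|clear - Q0; lra].
  by rewrite ler_peMr// mulr_ge0 ?exprn_ge0//; clear - Q0 Q20 dM0; lra.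
(* The estimate uses only the orders 0, 2 and [p + N + 2]; the last gets the Ehrenpreis bound, the
   others a bound independent of [p]. For [p = N = 0] the last two coincide. *)
pose bp m := if m == (p + N).+2 then cn N.+2 * (C1 ^+ p * p`!%:R) else cn m.
have hbp m u : `|T p m u| <= bp m.
  rewrite /bp; case: eqP => [->|_]; last exact: Tc.
  by rewrite (_ : (p + N).+2 = N.+2 + p)%N; [exact: Tp|rewrite addnC].
have bp0 : bp 0%N = cn 0%N by [].
have bp2 : bp 2%N = cn 2%N.
  rewrite /bp; case: eqP => // -[] /eqP; rewrite eq_sym addn_eq0 => /andP[/eqP -> /eqP ->].
  by rewrite expr0 mul1r mulr1.
have bpq : bp (p + N).+2 = cn N.+2 * (C1 ^+ p * p`!%:R) by rewrite /bp eqxx.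
pose D1 := D1' * ((2 * (C1 + 1)) ^+ p * p`!%:R).
pose Y := A * (2 * D) ^+ p * p`!%:R.
have Y0 : 0 <= Y by rewrite mulr_ge0// mulr_ge0// exprn_ge0// mulr_ge0.
have hD1 : 2 ^+ (p + N).+3 * (bp 0%N + bp (p + N).+2) <= D1.
  rewrite bp0 bpq /D1 /D1' exprMn.
  rewrite (_ : 2 ^+ (p + N).+3 = 2 ^+ N.+3 * 2 ^+ p); last first.
    by rewrite -exprD !addSn addnC.
  have g1 : 1 <= (C1 + 1) ^+ p * p`!%:R by rewrite mulr_ege1// exprn_ege1// lerDr ltW.
  have g2 : C1 ^+ p * p`!%:R <= (C1 + 1) ^+ p * p`!%:R.
    by rewrite ler_wpM2r// lerXn2r ?nnegrE//; clear - C10; lra.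
  rewrite [leRHS](_ : _ = 2 ^+ N.+3 * 2 ^+ p *
    ((cn 0%N + cn N.+2) * ((C1 + 1) ^+ p * p`!%:R))); last by ring.
  apply: ler_wpM2l; first by rewrite mulr_ge0// exprn_ge0.
  rewrite (mulrDl (cn 0%N)); apply: lerD; first by rewrite ler_peMr.
  by rewrite ler_wpM2l.
have hnear (m : 'I_d -> int) : let mu := (\row_j (m j)%:~R) *m B in
    `|mu - xi| < e * `|xi| -> cmod (F p (wave mu)) * `|xi| ^+ p <= Y.
  move=> mu hmu; have Gmu := hG' xi mu Gxi hmu.
  (* Since [e <= 1 / 2], the norm of [mu] is at least half that of [xi]; this doubles the rate
     [D]. *)
  have xmu : `|xi| <= 2 * enorm mu.
    have t : `|xi| <= `|mu| + `|mu - xi|.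
      by have := ler_normB mu (mu - xi); rewrite opprB addrCA subrr addr0.
    have t2 : e * `|xi| <= `|xi| / 2.
      by rewrite mulrC ler_wpM2l//; clear - e1; lra.
    by have := norm_le_enorm mu; clear - t t2 hmu; lra.
  apply: (@le_trans _ _ (cmod (F p (wave mu)) * (2 * enorm mu) ^+ p)).
    rewrite ler_wpM2l ?cmod_ge0// lerXn2r ?nnegrE//.
    by rewrite mulr_ge0// sqrtr_ge0.
  rewrite exprMn mulrCA /Y exprMn (_ : A * _ * _ = 2 ^+ p * (A * D ^+ p * p`!%:R)); last by ring.
  by rewrite ler_wpM2l ?exprn_ge0//; exact: hF.
have hD0 : 2 ^+ 3 * (bp 0%N + bp 2%N) <= D0' by rewrite bp0 bp2 lerDr.
have main := fourier_cutoff_estimate oW1 cK KW1 c0 (dF p) uB (tT p)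
  (fun u h => Ta p u (le_trans ad h)) hbp d0 sK D0'1 hD0 hD1 e0 xi1 Y0 hnear erefl erefl.
rewrite -/S -/e' in main.
have hM : cmod (fourier (F' p) xi) * `|xi| ^+ p <= Q * (M ^+ p * p`!%:R).
  apply: le_trans main _.
  rewrite /Q -/(e') (_ : D0' ^+ d * 6 ^+ d * (A + D1' * Z) * (M ^+ p * p`!%:R) =
    (D0' ^+ d * (A * M ^+ p * p`!%:R + D1' * Z * (M ^+ p * p`!%:R))) * 6 ^+ d); last by ring.
  rewrite ler_wpM2r ?exprn_ge0// ler_wpM2l ?exprn_ge0// ?(le_trans ler01 D0'1)//.
  apply: lerD.
    rewrite /Y ler_wpM2r// ler_wpM2l// lerXn2r ?nnegrE ?mulr_ge0// ?(le_trans ler01 M1)//.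
    by rewrite /M; clear - q0; lra.
  rewrite /D1 -/Z (_ : _ * (Z / _) = D1' * Z * ((2 * (C1 + 1) / e') ^+ p * p`!%:R)); last first.
    rewrite [(_ / e') ^+ p]expr_div_n; move: ((2 * (C1 + 1)) ^+ p) (e' ^+ p)^-1 p`!%:R => X y z.
    by clear; move: D1' Z => D2 Z'; ring.
  apply: ler_wpM2l; first exact: mulr_ge0.
  apply: ler_wpM2r => //; rewrite lerXn2r ?nnegrE// ?(le_trans ler01 M1)//.
  by rewrite /M; clear - D0; lra.
apply: (@le_trans _ _ (d%:R ^+ p * (Q * (M ^+ p * p`!%:R)))).
  apply: (@le_trans _ _ (cmod (fourier (F' p) xi) * (d%:R ^+ p * `|xi| ^+ p))).
    by rewrite ler_wpM2l.
  by rewrite mulrCA ler_wpM2l ?exprn_ge0.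
rewrite (_ : d%:R ^+ p * _ = Q * (d%:R * M) ^+ p * p`!%:R); last by rewrite exprMn; ring.
rewrite ler_wpM2r//; apply: ler_pM => //; last by clear - Q20; lra.
by rewrite exprn_ge0.
Qed.

End Localisation.

(** * The two implications between the notions of regularity *)

Section TwoDirections.
Context {R : realType} {d : nat}.
Local Notation C := (complex R).
Local Notation E := 'rV[R]_d.
Implicit Types (L U Omega : set E) (f : (E -> C) -> C).

Lemma open_translate U (x0 : E) : open U -> open [set x0 + u | u in U].
Proof.
move=> oU; rewrite (_ : [set x0 + u | u in U] = (fun x => x - x0) @^-1` U).
  apply: open_comp => // x _.
  by apply: (@continuousB _ _ _ id (cst x0)); [exact: cvg_id|exact: cst_continuous].
apply/seteqP; split=> [_ [u Uu <-]|x Ux] /=; first by rewrite addrC addKr.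
by exists (x - x0) => //; rewrite addrC subrK.
Qed.

Lemma analytic_lattice_regular L U Omega f (x0 xi0 : E) :
  open U -> U 0 -> open Omega -> Omega x0 -> xi0 != 0 ->
  analytic_regular Omega f x0 xi0 -> lattice_regular L U Omega f x0 xi0.
Proof.
move=> oU U0 oO Ox0 xi00 [G [V [F [cG [[oV Vx0] VO] bF eqF [A [D [A0 D0 hF]]]]]]].
have [K [N [c [cK KO c0 dF]]]] := bounded_sequence_dominated oO bF.
set W := Omega `&` [set x0 + u | u in U].
have oW : open W by apply: openI => //; exact: open_translate.
have Wx0 : W x0 by split=> //; exists 0 => //; rewrite addr0.
have [r r0 hr] : exists2 r : R, 0 < r & forall x, K x -> `|x - x0| < r.
  have [M [Mr hM]] := compact_bounded cK.
  exists (`|M| + 1 + `|x0| + 1) => [|x Kx].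
    by rewrite ltr_wpDl// !addr_ge0.
  apply: le_lt_trans (ler_normB _ _) _.
  have hx : `|x| <= `|M| + 1.
    by apply: hM => //; rewrite (le_lt_trans (ler_norm M))// ltrDl.
  by lra.
(* The dual of [r^-1 Z^d] is [r Z^d], and [r] exceeds the distance from [x0] to any point of [K], so
   the translate of this dual at [x0] meets [K] at most in [x0]. *)
pose B : 'M[R]_d := (r^-1)%:M.
have uB : B \in unitmx.
  by rewrite unitmxE det_scalar unitrX// unitfE invr_eq0 gt_eqF.
have linB x j : lin x0 (row j B) x = r^-1 * (x - x0) 0 j.
  rewrite /lin /dotv (bigD1 j)//= big1 ?addr0 => [|i ij].
    by rewrite !mxE eqxx mulr1n mulrC.
  by rewrite !mxE eq_sym (negbTE ij) mulr0n mulr0.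
have hK x : K x -> (forall j, lin x0 (row j B) x \is a Num.int) -> x = x0.
  move=> Kx hj; apply/eqP; rewrite -subr_eq0; apply/eqP/rowP => j; rewrite [RHS]mxE.
  have /intrP[m hm] := hj j.
  have m1 : `|m%:~R| < 1 :> R.
    rewrite -hm linB normrM gtr0_norm ?invr_gt0// mulrC ltr_pdivrMr// mul1r.
    exact: le_lt_trans (coord_le_norm _ _) (hr x Kx).
  have m0 : m = 0 by move: m1; rewrite -intr_norm -[1]/(1%:~R) ltr_int; lia.
  move: hm; rewrite linB m0 => /eqP; rewrite mulf_eq0 invr_eq0 (gt_eqF r0) /=.
  by move=> /eqP.
have hFm p (m : 'I_d -> int) : let mu := (\row_j (m j)%:~R) *m B in G mu ->
    cmod (fourier (F p) mu) * enorm mu ^+ p <= A * D ^+ p * p`!%:R.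
  move=> mu Gmu; rewrite -lee_fin; apply: le_trans (ltW (hF p)).
  by apply: ereal_sup_ubound; exists mu.
have [G' [V' [F' [cG' [oV' V'V] bF' eqF' [A' [D' [A'0 D'0 hF']]]]]]] :=
  localisation oO oW Wx0 uB xi00 cK KO c0 dF hK oV Vx0 eqF cG (ltW A0) (ltW D0) hFm.
exists V', G', F'; split=> //.
- by split=> // x /V'V[].
(* One constant replaces two, by [A' * D' ^ p <= (A' + D') ^ (p + 1)]. *)
- exists (A' + D'); split; first exact: addr_gt0.
  move=> p; apply: ge_ereal_sup => _ [mu [Gmu _] <-]; rewrite lee_fin.
  apply: le_trans (hF' p mu Gmu) _; rewrite ler_wpM2r// exprS.
  apply: ler_pM; rewrite ?exprn_ge0 ?(ltW A'0) ?(ltW D'0)// ?lerDl ?(ltW D'0)//.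
  by rewrite lerXn2r ?nnegrE ?lerDr ?addr_ge0 ?(ltW A'0) ?(ltW D'0).
Qed.

Lemma lattice_analytic_regular L U Omega f (x0 xi0 : E) :
  is_lattice L -> open U -> U 0 -> U `&` dual_lattice L = [set 0] ->
  open Omega -> Omega x0 -> xi0 != 0 ->
  lattice_regular L U Omega f x0 xi0 -> analytic_regular Omega f x0 xi0.
Proof.
move=> latL oU U0 UL oO Ox0 xi00.
move=> [V [G [F [[[oV Vx0] VW] cG bF eqF [h [h0 hF]]]]]].
set W := Omega `&` [set x0 + u | u in U] in VW bF.
have oW : open W by apply: openI => //; exact: open_translate.
have [K [N [c [cK KW c0 dF]]]] := bounded_sequence_dominated oW bF.
have [B uB hB] := lattice_basis latL.
(* Integer coordinates mean that [x - x0] pairs integrally with a basis of [L], hence lies in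
   [dual_lattice L]; it also lies in [U], so it is 0. *)
have hK x : K x -> (forall j, lin x0 (row j B) x \is a Num.int) -> x = x0.
  move=> Kx hj; have [_ [u Uu xu]] := KW x Kx.
  suff : [set (0 : E)] u by move=> /= u0; rewrite -xu u0 addr0.
  rewrite -UL; split=> // y /hB[m ->]; rewrite dotvC dotv_mulmx.
  apply: rpred_sum => j _; rewrite mxE rpredM ?intr_int//.
  by have := hj j; rewrite /lin -xu addrC addKr.
have hFm p (m : 'I_d -> int) : let mu := (\row_j (m j)%:~R) *m B in G mu ->
    cmod (fourier (F p) mu) * enorm mu ^+ p <= h * h ^+ p * p`!%:R.
  move=> mu Gmu; rewrite -exprS -lee_fin; apply: le_trans (hF p).
  by apply: ereal_sup_ubound; exists mu => //; split=> //; apply/hB; exists m.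
have [G' [V' [F' [cG' [oV' V'V] bF' eqF' [A' [D' [A'0 D'0 hF']]]]]]] :=
  localisation oW oO Ox0 uB xi00 cK KW c0 dF hK oV Vx0 eqF cG (ltW h0) (ltW h0) hFm.
exists G', V', F'; split=> //.
- by split=> // x /V'V[].
(* [A' + 1] yields the strict inequality for the supremum, which may attain the bound with [A']. *)
- exists (A' + 1), D'; split=> //; first exact: addr_gt0.
  move=> p; apply: (@le_lt_trans _ _ (A' * D' ^+ p * p`!%:R)%:E).
    by apply: ge_ereal_sup => _ [xi Gxi <-]; rewrite lee_fin hF'.
  by rewrite lte_fin ltr_pM2r ?ltr0n ?fact_gt0// ltr_pM2r ?exprn_gt0// ltrDl.
Qed.

End TwoDirections.

Theorem theorem1p2 (R : realType) (d : nat)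
    (L U Omega : set 'rV[R]_d)
    (f : ('rV[R]_d -> complex R) -> complex R)
    (L_lattice : is_lattice L)
    (U_open : open U)
    (U_convex : @convex_set R 'rV[R]_d U)
    (U_0 : U 0)
    (U_dual : U `&` dual_lattice L = [set 0])
    (Omega_open : open Omega)
    (f_distribution : distributions Omega f) :
  WF_A Omega f =
  (Omega `*` ~` [set 0]) `\` [set z | lattice_regular L U Omega f z.1 z.2].
Proof.
(* Both sides are complements, so each inclusion is the implication between the regularity notions
   in the reverse direction. *)
rewrite /WF_A; apply/seteqP; split=> -[x0 xi0] [[/= Ox0 xi00] hreg]; split=> //= h;
  apply: hreg; have xi0_neq0 : xi0 != 0 by apply/eqP.
- exact: (lattice_analytic_regular L_lattice U_open U_0 U_dual).
- exact: analytic_lattice_regular.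
Qed.
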